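(* Let $n$ be a positive integer and let $B$ be the unit ball of $\mathbf{C}^n$. The norm of the Berezin transform $$\mathfrak{B}f(z)=\int_B\frac{(1-|z|^2)^{n+1}}{|1-\langle z,w\rangle|^{2n+2}}\,f(w)\,dv(w),\quad z\in B,$$ as an operator $\mathfrak{B}:L^p(B)\rightarrow L^p(B)$ is given by $$\|\mathfrak{B}\|_{L^p(B)\rightarrow L^p(B)}=\left\{\prod_{k=1}^n\left(1+\frac1{kp}\right)\right\}\frac{\pi/p}{\sin(\pi/p)}$$ for $1<p<\infty$, and $$\|\mathfrak{B}\|_{L^\infty(B)\rightarrow L^\infty(B)}=1.$$
   Context: $\langle z,w\rangle=z_1\overline{w}_1+\dots+z_n\overline{w}_n$ is the inner product in $\mathbf{C}^n$, $|z|=\sqrt{\langle z,z\rangle}$, and $B=\{z\in\mathbf{C}^n:|z|<1\}$. $dv$ is the Lebesgue measure on $B$ normalized so that $v(B)=1$. $L^p(B)$ ($1\le p<\infty$) is the Lebesgue space of measurable functions on $B$ with $\|f\|_p^p=\int_B|f(z)|^p\,dv(z)<\infty$, and $L^\infty(B)$ is the space of essentially bounded measurable functions with the essential supremum norm. For a linear operator $T:X\to Y$ between normed spaces, $\|T\|_{X\rightarrow Y}=\sup_{\|x\|_X\le1}\|Tx\|_Y$. *)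

(* Defs.v *)
From HB Require Import structures.
From mathcomp Require Import all_boot all_order all_algebra.
From mathcomp Require Import all_classical all_reals all_analysis.
From mathcomp Require Import measurable_realfun complex.
Set Implicit Arguments.
Unset Strict Implicit.
Unset Printing Implicit Defensive.
Import Order.TTheory GRing.Theory Num.Theory.
Import numFieldNormedType.Exports.
Import ComplexField.Normc.

Local Open Scope classical_set_scope.
Local Open Scope ring_scope.
Local Open Scope complex_scope.

Section pushforward_iso.
Context d1 d2 (T1 : measurableType d1) (T2 : measurableType d2) (R : realType).
Variables (mu : {sigma_finite_measure set T1 -> \bar R}).
Variables (f : T1 -> T2) (g : T2 -> T1).
Hypotheses (mf : measurable_fun setT f) (mg : measurable_fun setT g).
Hypothesis fK : cancel f g.

(* The inverse g only serves to transport sigma-finiteness. *)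
Definition pushforward_iso of measurable_fun setT f & measurable_fun setT g
  & cancel f g : set T2 -> \bar R := pushforward mu f.

Local Notation nu := (pushforward_iso mf mg fK).

Let nu0 : nu set0 = 0%E.
Proof. by rewrite /pushforward_iso /pushforward preimage_set0 measure0. Qed.

Let nu_ge0 A : (0 <= nu A)%E. Proof. exact: measure_ge0. Qed.

Let nu_sigma_additive : semi_sigma_additive nu.
Proof.
move=> F mF tF mUF; rewrite /pushforward_iso /pushforward preimage_bigcup.
apply: measure_semi_sigma_additive.
- by move=> n; rewrite -[X in measurable X]setTI; exact: mf.
- apply/trivIsetP => /= i j _ _ ij; rewrite -preimage_setI.
  by move/trivIsetP : tF => /(_ _ _ _ _ ij) ->//; rewrite preimage_set0.
- by rewrite -preimage_bigcup -[X in measurable X]setTI; exact: mf.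
Qed.

HB.instance Definition _ :=
  isMeasure.Build _ _ _ nu nu0 nu_ge0 nu_sigma_additive.

Let nu_sigma_finite : sigma_finite setT nu.
Proof.
have [F TF Foo] := sigma_finiteT mu.
exists (fun n => g @^-1` F n); first by rewrite -preimage_bigcup -TF preimage_setT.
move=> n; have [mFn Fnoo] := Foo n; split.
  by rewrite -[X in measurable X]setTI; exact: mg.
by rewrite /pushforward_iso /pushforward -comp_preimage (_ : g \o f = id)//; apply/funext.
Qed.

HB.instance Definition _ :=
  Measure_isSigmaFinite.Build _ _ _ nu nu_sigma_finite.

End pushforward_iso.

(* The product measure again, bundled as a sigma-finite measure: the library's
   \x is only found canonically as one when the factors are probabilities. *)
Section prod_measure.
Local Open Scope ereal_scope.
Context d1 d2 (T1 : measurableType d1) (T2 : measurableType d2) (R : realType).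
Variable m1 : {sigma_finite_measure set T1 -> \bar R}.
Variable m2 : {sigma_finite_measure set T2 -> \bar R}.

Definition prod_measure : set (T1 * T2) -> \bar R := m1 \x m2.

HB.instance Definition _ := Measure.on prod_measure.

Let prod_measure_sigma_finite : sigma_finite setT prod_measure.
Proof.
have /sigma_finiteP[F [TF ndF Foo]] := sigma_finiteT m1.
have /sigma_finiteP[G [TG ndG Goo]] := sigma_finiteT m2.
exists (fun n => F n `*` G n).
  rewrite -setXTT TF TG predeqE => -[x y]; split.
    move=> [/= [n _ Fnx] [k _ Gky]]; exists (maxn n k) => //; split.
    - by move: x Fnx; exact/subsetPset/ndF/leq_maxl.
    - by move: y Gky; exact/subsetPset/ndG/leq_maxr.
  by move=> [n _ []/= ? ?]; split; exists n.
move=> k; have [? ?] := Foo k; have [? ?] := Goo k.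
split; first exact: measurableX.
by rewrite /prod_measure product_measure1E// lte_mul_pinfty// ge0_fin_numE.
Qed.

HB.instance Definition _ := Measure_isSigmaFinite.Build _ _ _ prod_measure
  prod_measure_sigma_finite.

End prod_measure.

Section tuple_measure.
Context d (T : measurableType d) (R : realType).
Variable mu : {sigma_finite_measure set T -> \bar R}.

Let glue n (x : T * n.-tuple T) : n.+1.-tuple T := [tuple of x.1 :: x.2].
Let cut n (t : n.+1.-tuple T) : T * n.-tuple T := (thead t, [tuple of behead t]).

Let measurable_glue n : measurable_fun setT (@glue n).
Proof. exact: measurable_cons. Qed.

Let measurable_cut n : measurable_fun setT (@cut n).
Proof. by apply: measurable_fun_pair; [exact: measurable_tnth|exact: measurable_behead]. Qed.

Let glueK n : cancel (@glue n) (@cut n).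
Proof. by move=> [x t]; rewrite /cut /glue theadE; congr pair; exact/val_inj. Qed.

Fixpoint tuple_measure n : {sigma_finite_measure set (n.-tuple T) -> \bar R} :=
  if n is m.+1 then
    pushforward_iso
      (prod_measure mu (tuple_measure m))
      (@measurable_glue m)
      (@measurable_cut m) (@glueK m)
  else \d_([tuple] : 0.-tuple T).

Lemma tuple_measure_box n (A : 'I_n -> set T) : (forall i, measurable (A i)) ->
  tuple_measure n [set t | forall i, A i (tnth t i)] = (\prod_(i < n) mu (A i))%E.
Proof.
elim: n A => [|n IHn] A mA /=.
  by rewrite big_ord0 diracE mem_set// => -[].
have mbox : measurable [set t : n.-tuple T | forall i, A (lift ord0 i) (tnth t i)].
  rewrite (_ : mkset _ =
      \bigcap_(i in [set: 'I_n]) ((@tnth n T ^~ i) @^-1` A (lift ord0 i))).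
    apply: fin_bigcap_measurable => // i _; rewrite -[X in measurable X]setTI.
    exact: measurable_tnth.
  by apply/seteqP; split=> t /= At i; [move=> _|]; apply: At.
rewrite big_ord_recl -IHn// -product_measure1E//.
rewrite /pushforward_iso /pushforward /prod_measure; congr product_measure1.
apply/seteqP; split=> -[x t] /=.
  move=> At; split; first by have := At ord0.
  by move=> i; have := At (lift ord0 i); rewrite tnthS.
move=> [Ax At] i; case: (unliftP ord0 i) => [j|] ->; last exact: Ax.
by rewrite tnthS.
Qed.

End tuple_measure.

(* Borel sigma-algebra of R[i], transported from R * R *)
Section complex_measurable.
Variable R : realType.

Definition pair_of_complex (z : R[i]) : R * R := (complex.Re z, complex.Im z).
Definition complex_of_pair (x : R * R) : R[i] := x.1 +i* x.2.

Lemma complex_of_pairK : cancel complex_of_pair pair_of_complex.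
Proof. by case. Qed.

HB.instance Definition _ := isPointed.Build R[i] 0.

Let measurableC_def : set (set R[i]) :=
  preimage_set_system setT pair_of_complex measurable.

Let sigma_algebra_measurableC : sigma_algebra setT measurableC_def.
Proof. exact/sigma_algebra_preimage/sigma_algebra_measurable. Qed.

Let measurableC0 : measurableC_def set0.
Proof. by have [] := sigma_algebra_measurableC. Qed.

Let measurableCC A : measurableC_def A -> measurableC_def (~` A).
Proof. by have [_ + _] := sigma_algebra_measurableC; rewrite -setTD; exact. Qed.

Let measurableC_bigcup (F : (set R[i])^nat) :
  (forall i, measurableC_def (F i)) -> measurableC_def (\bigcup_i F i).
Proof. by have [_ _] := sigma_algebra_measurableC; exact. Qed.

HB.instance Definition _ := @isMeasurable.Build default_measure_display R[i]
  measurableC_def measurableC0 measurableCC measurableC_bigcup.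

Lemma measurable_pair_of_complex : measurable_fun setT pair_of_complex.
Proof. by move=> _ Y mY; exists Y. Qed.

Lemma measurable_complex_of_pair : measurable_fun setT complex_of_pair.
Proof.
move=> _ _ [Y mY <-]; rewrite !setTI -comp_preimage.
by rewrite (_ : _ \o _ = id)//; apply/funext => -[].
Qed.

Lemma measurable_complexRe : measurable_fun setT (@complex.Re R).
Proof. exact: (measurableT_comp measurable_fst measurable_pair_of_complex). Qed.

Lemma measurable_complexIm : measurable_fun setT (@complex.Im R).
Proof. exact: (measurableT_comp measurable_snd measurable_pair_of_complex). Qed.

Definition lebesgue_complex : {sigma_finite_measure set R[i] -> \bar R} :=
  pushforward_iso
    (prod_measure (@lebesgue_measure R) (@lebesgue_measure R))
    measurable_complex_of_pair measurable_pair_of_complex complex_of_pairK.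

Definition lebesgue_Cn n : {sigma_finite_measure set (n.-tuple R[i]) -> \bar R} :=
  tuple_measure lebesgue_complex n.

End complex_measurable.

Section unit_ball.
Variables (R : realType) (n : nat).
Implicit Types z w : n.-tuple R[i].

Definition inner z w : R[i] := \sum_(i < n) tnth z i * (tnth w i)^*.

Definition enorm z : R := Num.sqrt (complex.Re (inner z z)).

Definition unit_ball : set (n.-tuple R[i]) := [set z | enorm z < 1].

Lemma enormE z : enorm z = Num.sqrt
  (\sum_(i < n) (complex.Re (tnth z i) ^+ 2 + complex.Im (tnth z i) ^+ 2)).
Proof.
rewrite /enorm /inner raddf_sum/=; congr Num.sqrt.
by apply: eq_bigr => i _; case: (tnth z i) => a b /=; rewrite mulrN opprK !expr2.
Qed.

Lemma measurable_enorm : measurable_fun setT enorm.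
Proof.
rewrite (funext enormE).
apply: measurableT_comp.
  by apply: continuous_measurable_fun; exact: sqrt_continuous.
have mX (h : R[i] -> R) (i : 'I_n) : measurable_fun setT h ->
    measurable_fun setT (fun z : n.-tuple R[i] => h (tnth z i) ^+ 2).
  move=> mh; apply: measurable_funX.
  exact: (measurableT_comp mh (measurable_tnth i)).
apply: measurable_sum => i; apply: measurable_funD; apply: mX.
- exact: measurable_complexRe.
- exact: measurable_complexIm.
Qed.

Lemma measurable_unit_ball : measurable unit_ball.
Proof.
rewrite -[X in measurable X]setTI.
rewrite (_ : unit_ball = enorm @^-1` `]-oo, 1[%classic); first exact: measurable_enorm.
by apply/seteqP; split=> z /=; rewrite /unit_ball/= in_itv.
Qed.

Let vol_inv_ge0 : 0 <= (fine (lebesgue_Cn R n unit_ball))^-1.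
Proof. by rewrite invr_ge0 fine_ge0. Qed.

(* A measure on the whole of C^n, concentrated on the ball. *)
Definition dv : {measure set (n.-tuple R[i]) -> \bar R} :=
  mscale (NngNum vol_inv_ge0) (mrestr (lebesgue_Cn R n) measurable_unit_ball).

Let square (c : R) : set R[i] :=
  [set z | `]-c, c[%classic (complex.Re z) /\ `]-c, c[%classic (complex.Im z)].

Let measurable_square c : measurable (square c).
Proof.
have -> : square c = (@pair_of_complex R) @^-1` (`]-c, c[ `*` `]-c, c[) by [].
rewrite -[X in measurable X]setTI; apply: measurable_pair_of_complex => //.
exact: measurableX.
Qed.

Let cube (c : R) : set (n.-tuple R[i]) := [set z | forall i, square c (tnth z i)].

Let measurable_cube c : measurable (cube c).
Proof.
rewrite (_ : cube c =
    \bigcap_(i in [set: 'I_n]) ((@tnth n R[i] ^~ i) @^-1` square c)).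
  apply: fin_bigcap_measurable => // i _; rewrite -[X in measurable X]setTI.
  exact: measurable_tnth.
by apply/seteqP; split=> t /= At i; [move=> _|]; apply: At.
Qed.

Let lebesgue_square c : 0 < c -> lebesgue_complex R (square c) = ((2 * c) ^+ 2)%:E.
Proof.
move=> c0; rewrite /lebesgue_complex/= /pushforward_iso /pushforward.
rewrite /prod_measure (_ : _ @^-1` _ = `]-c, c[ `*` `]-c, c[)//.
rewrite product_measure1E//= lebesgue_measure_itv/= lte_fin gtrN//.
by rewrite opprK -EFinM -mulr2n -expr2 mulr_natl.
Qed.

Let lebesgue_cube c : 0 < c -> lebesgue_Cn R n (cube c) = (((2 * c) ^+ 2) ^+ n)%:E.
Proof.
move=> c0; rewrite (tuple_measure_box _ (fun=> measurable_square c)).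
under eq_bigr do rewrite lebesgue_square//.
by rewrite prodEFin prodr_const card_ord.
Qed.

Lemma lebesgue_unit_ball_gt0 : (0 < lebesgue_Cn R n unit_ball)%E.
Proof.
pose c : R := (2 * n.+1%:R)^-1.
have c0 : 0 < c by rewrite invr_gt0 mulr_gt0.
apply: (@lt_le_trans _ _ (lebesgue_Cn R n (cube c))).
  by rewrite lebesgue_cube// lte_fin !exprn_gt0// mulr_gt0.
apply: le_measure; rewrite ?inE//; first exact: measurable_unit_ball.
move=> z zc; rewrite /unit_ball/= enormE -sqrtr1 ltr_sqrt//.
have sq (x : R) : x \in `]-c, c[ -> x ^+ 2 <= c ^+ 2.
  move=> /[!in_itv]/= /andP[cx xc].
  rewrite -(real_normK (num_real x)) lerXn2r ?nnegrE//; first exact: ltW.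
  by rewrite ltW// ltr_norml cx xc.
apply: (@le_lt_trans _ _ (\sum_(i < n) (c ^+ 2 + c ^+ 2))).
  apply: ler_sum => i _; have [rez imz] := zc i.
  by rewrite lerD//; apply: sq.
rewrite sumr_const card_ord -mulr2n -mulrnA -mulr_natl /c exprVn.
rewrite ltr_pdivrMr ?exprn_gt0 ?mulr_gt0// mul1r -natrM -natrX ltr_nat.
apply: (@leq_trans (2 * n.+1)); first by rewrite ltn_pmul2l.
by rewrite -[leqLHS]expn1 leq_pexp2l// muln_gt0.
Qed.

Lemma lebesgue_unit_ball_lty : (lebesgue_Cn R n unit_ball < +oo)%E.
Proof.
apply: (@le_lt_trans _ _ (lebesgue_Cn R n (cube 1))); last first.
  by rewrite lebesgue_cube// ltry.
apply: le_measure; rewrite ?inE//; first exact: measurable_unit_ball.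
move=> z; rewrite /unit_ball/= enormE -[X in _ < X]sqrtr1 ltr_sqrt// => z1 i.
have sq (x : R) : x ^+ 2 < 1 -> `]-1, 1[%classic x.
  by rewrite -(real_normK (num_real x)) expr_lt1// ltr_norml /= in_itv.
have {}z1 : complex.Re (tnth z i) ^+ 2 + complex.Im (tnth z i) ^+ 2 < 1.
  apply: le_lt_trans z1; rewrite (bigD1 i)//= lerDl sumr_ge0// => j _.
  by rewrite addr_ge0// sqr_ge0.
by split; apply: sq; apply: le_lt_trans z1; rewrite ?lerDl ?lerDr sqr_ge0.
Qed.

Lemma dv_unit_ball : dv unit_ball = 1%E.
Proof.
transitivity ((fine (lebesgue_Cn R n unit_ball))^-1%:E *
  lebesgue_Cn R n (unit_ball `&` unit_ball))%E; first by [].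
rewrite setIid.
have fin : lebesgue_Cn R n unit_ball \is a fin_num.
  by rewrite ge0_fin_numE// lebesgue_unit_ball_lty.
rewrite -[X in (_ * X)%E](fineK fin) -EFinM mulVf//.
by rewrite gt_eqF// fine_gt0// lebesgue_unit_ball_gt0 lebesgue_unit_ball_lty.
Qed.

(* Functions on the ball are represented by total functions on C^n; their
   values outside the ball are never used. *)
Definition Lp_norm (p : \bar R) (f : n.-tuple R[i] -> R[i]) : \bar R :=
  'N[dv]_p[EFin \o ((@normc R \o f) \_ unit_ball)].

Definition Lp (p : \bar R) : set (n.-tuple R[i] -> R[i]) :=
  [set f | measurable_fun unit_ball f /\ (Lp_norm p f < +oo)%E].

Definition cintegral (g : n.-tuple R[i] -> R[i]) : R[i] :=
  (\int[dv]_(w in unit_ball) complex.Re (g w))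
  +i* (\int[dv]_(w in unit_ball) complex.Im (g w)).

Definition berezin (f : n.-tuple R[i] -> R[i]) (z : n.-tuple R[i]) : R[i] :=
  cintegral (fun w =>
    ((1 - enorm z ^+ 2) ^+ n.+1 / @normc R (1 - inner z w) ^+ (2 * n + 2))%:C * f w).

End unit_ball.

Arguments Lp_norm R n p f : clear implicits.
Arguments Lp R n p : clear implicits.
Arguments berezin R n f z : clear implicits.

Definition operator_norm (R : realType) (X Y : Type) (domX : set X)
    (normX : X -> \bar R) (normY : Y -> \bar R) (T : X -> Y) : \bar R :=
  ereal_sup [set normY (T x) | x in [set x | domX x /\ (normX x <= 1)%E]].

(* Main.v *)
(** Expanding (1 - <z, w>)^(- n - 1) in powers of <z, w>, which are orthogonal for rotation
    invariant measures, and computing the moments of |<z, w>|^2 by induction on n, one finds that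
    the integral over the ball of (1 - |w|^2)^(- a) |1 - <z, w>|^(- 2n - 2) equals
    (1 - |z|^2)^(- (n + 1 + a)) I_a(|z|^2), where I_a is a one-variable integral with
    I_a(x) <= c_a = I_a(1) and, for 0 <= a < 1, I_a(x) >= x c_a. Here c_a is (n + 1) times the beta
    integral of t^(- a) (1 - t)^(n + a). Schur's test with the weight (1 - |w|^2)^(- 1/p) then
    bounds the norm on L^p by c_(1/p), because c_a is invariant under a -> - (n + a). Conversely,
    the transform multiplies (1 - |w|^2)^(- t) by I_t(|w|^2), and this family is asymptotically
    extremal as t increases to 1/p. The beta recurrences and Euler's reflection formula evaluate
    c_(1/p), and a = 0 gives the case of L^infinity. *)
From HB Require Import structures.
Require Import Defs.
From mathcomp Require Import all_boot all_order all_algebra.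
From mathcomp Require Import all_classical all_reals all_analysis.
From mathcomp Require Import complex measurable_realfun ess_sup_inf ring lra.
Set Implicit Arguments.
Unset Strict Implicit.
Unset Printing Implicit Defensive.
Import Order.TTheory GRing.Theory Num.Theory.
Import numFieldNormedType.Exports.
Import ComplexField.Normc.
Local Open Scope classical_set_scope.
Local Open Scope ring_scope.

(** * Integrals over the unit interval *)

(** Most integrals below are of nonnegative functions with values in [\bar R]. Tonelli, monotone
    convergence and integration by parts then apply before any integrability is known; negative
    terms are moved to the other side of an identity.

    I_a arises from the density [kappa] by the involution t -> (1 - t) / (1 - x t) of the interval,
    which frees the power of 1 - |z|^2. The bound I_a(x) <= c_a is not pointwise: the integrands at
    1 and at x differ by [gdef], which is nonnegative, up to an exact derivative. An upper bound for
    the integral of [gdef] gives I_a(x) >= x c_a.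

    The exponent 1/p is critical: (1 - |w|^2)^(- t) lies in L^p exactly for t < 1/p. The Schur
    weight is thus the limit of the test functions, which is why the two bounds meet.

    Euler's formula comes from comparing B(m + 1 - s, m + 1 + s) with Cauchy's integral of cos^(2m)
    x cos(2 s x). Their product obeys a recurrence free of s, so its ratio to the value at s = 0
    does not depend on m; it is evaluated at m = 0 and for large m. *)

Section ftc_open.
Context {R : realType}.
Local Notation mu := (@lebesgue_measure R).

Lemma open_itv_measurable_fun (a b : R) (h : R -> R) :
  {in `]a, b[, continuous h} -> measurable_fun `]a, b[ h.
Proof.
move=> ch; apply: open_continuous_measurable_fun => //.
by move=> x /set_mem; apply: ch.
Qed.

Lemma itv_cc_in_oo (a b c d x : R) : a < c -> d < b -> x \in `[c, d] -> x \in `]a, b[.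
Proof. by move=> ac db; rewrite !in_itv/= => /andP[cx xd]; apply/andP; split; lra. Qed.

Lemma continuous_FTC2_oo (a b c d : R) (H h : R -> R) : a < c -> c < d -> d < b ->
  {in `]a, b[, continuous h} -> (forall x, x \in `]a, b[ -> is_derive x 1 H (h x)) ->
  (\int[mu]_(x in `[c, d]) (h x)%:E = (H d)%:E - (H c)%:E)%E.
Proof.
move=> ac cd db ch dH.
have sub x : x \in `[c, d] -> x \in `]a, b[ by exact: itv_cc_in_oo.
have cH x : x \in `[c, d] -> {for x, continuous H}.
  move=> /sub /dH [dx _]; apply: differentiable_continuous; exact/derivable1_diffP.
apply: continuous_FTC2 => //.
- apply: continuous_in_subspaceT => x /set_mem /sub; exact: ch.
- split.
  + by move=> x xcd; have [|] := dH x => //; apply: sub; apply: subset_itv_oo_cc.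
  + by apply: cvg_at_right_filter; apply: cH; rewrite in_itv/= lexx ltW.
  + by apply: cvg_at_left_filter; apply: cH; rewrite in_itv/= lexx ltW.
- move=> x xcd; rewrite derive1E; have [|_ ->//] := dH x.
  by apply: sub; apply: subset_itv_oo_cc.
Qed.

(** The margin is at most (b - a) / 3, so every closed interval is nondegenerate, as
    [continuous_FTC2_oo] requires. *)
Lemma itv_oo_bigcup (a b : R) : a < b -> `]a, b[%classic = \bigcup_n
   (`[a + (b - a) / n.+3%:R, b - (b - a) / n.+3%:R]%classic : set R).
Proof.
move=> ab; have ba : 0 < b - a by rewrite subr_gt0.
have dn0 n : 0 < (b - a) / n.+3%:R by rewrite divr_gt0.
apply/seteqP; split => x /=.
  rewrite in_itv/= => /andP[ax xb].
  have m0 : 0 < Num.min (x - a) (b - x) by rewrite lt_min !subr_gt0 ax.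
  have [N] : exists N : nat, (b - a) / Num.min (x - a) (b - x) < N%:R.
    by exists (Num.bound ((b - a) / Num.min (x - a) (b - x)));
       apply: archi_boundP; rewrite divr_ge0 ?ltW.
  rewrite ltr_pdivrMr// => hN.
  have : (b - a) / N.+3%:R <= Num.min (x - a) (b - x).
    rewrite ler_pdivrMr// mulrC; apply: (le_trans (ltW hN)).
    by rewrite ler_pM2r// ler_nat; do 3 apply: leqW.
  rewrite le_min => /andP[h1 h2].
  exists N => //=; rewrite in_itv/=.
  by move: (_ / N.+3%:R) h1 h2 => e h1 h2; apply/andP; split; lra.
move=> [n _ /=]; rewrite !in_itv/= => /andP[h1 h2]; have := dn0 n.
by move: (_ / n.+3%:R) h1 h2 => e h1 h2 ?; apply/andP; split; lra.
Qed.

Lemma itv_oo_homo (a b : R) : a < b ->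
  {homo (fun n => `[a + (b - a) / n.+3%:R, b - (b - a) / n.+3%:R]%classic : set R) :
    n m / (n <= m)%N >-> (n <= m)%O}.
Proof.
move=> ab n m nm; apply/subsetPset => x /=; rewrite !in_itv/= => /andP[h1 h2].
have : (b - a) / m.+3%:R <= (b - a) / n.+3%:R.
  by rewrite ler_pM2l ?subr_gt0// lef_pV2 ?posrE// ler_nat.
by move: (_ / n.+3%:R) (_ / m.+3%:R) h1 h2 => e f h1 h2 ?; apply/andP; split; lra.
Qed.

Lemma integral_oo_cvg (a b : R) (h : R -> R) : a < b ->
  {in `]a, b[, continuous h} -> (forall x, x \in `]a, b[ -> 0 <= h x) ->
  (\int[mu]_(x in `[(a + (b - a) / n.+3%:R)%R, (b - (b - a) / n.+3%:R)%R]) (h x)%:E)%E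
  @[n --> \oo] --> (\int[mu]_(x in `]a, b[) (h x)%:E)%E.
Proof.
move=> ab ch h0.
have dn0 n : 0 < (b - a) / n.+3%:R by rewrite divr_gt0// subr_gt0.
rewrite itv_oo_bigcup//; apply: ge0_nondecreasing_set_cvg_integral.
- exact: itv_oo_homo.
- by move=> n; exact: measurable_itv.
- move=> n; apply/measurable_EFinP.
  apply: (measurable_funS (measurable_itv `]a, b[)) => [x|].
    by apply: itv_cc_in_oo; have := dn0 n; move: (_ / n.+3%:R) => e; lra.
  exact: open_itv_measurable_fun.
- move=> n x /= xn; rewrite lee_fin h0//.
  by apply: itv_cc_in_oo xn; have := dn0 n; move: (_ / n.+3%:R) => e; lra.
Qed.

(** The derivative is a difference of nonnegative functions and each side of the conclusion carries
    one of them, so both integrals may be infinite. On compact subintervals this is the usual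
    theorem; monotone convergence passes to the open interval. *)
Lemma ge0_FTC_oo (a b la lb : R) (H h1 h2 : R -> R) : a < b ->
  {in `]a, b[, continuous h1} -> {in `]a, b[, continuous h2} ->
  (forall x, x \in `]a, b[ -> 0 <= h1 x) -> (forall x, x \in `]a, b[ -> 0 <= h2 x) ->
  (forall x, x \in `]a, b[ -> is_derive x 1 H (h1 x - h2 x)) ->
  H x @[x --> a^'+] --> la -> H x @[x --> b^'-] --> lb ->
  (\int[mu]_(x in `]a, b[) (h1 x)%:E + la%:E =
   \int[mu]_(x in `]a, b[) (h2 x)%:E + lb%:E)%E.
Proof.
move=> ab c1 c2 p1 p2 dH Ha Hb.
have ba : 0 < b - a by rewrite subr_gt0.
pose u n : R := (b - a) / n.+3%:R.
have u0 n : 0 < u n by rewrite divr_gt0.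
have ucvg : u n @[n --> \oo] --> (0 : R).
  rewrite -(mulr0 (b - a)); apply: cvgM; first exact: cvg_cst.
  have := @cvg_harmonic R; rewrite -(cvg_shiftn 2).
  by under eq_fun do rewrite addn2.
have key n : (\int[mu]_(x in `[(a + u n)%R, (b - u n)%R]) (h1 x)%:E + (H (a + u n))%:E =
    \int[mu]_(x in `[(a + u n)%R, (b - u n)%R]) (h2 x)%:E + (H (b - u n))%:E)%E.
  have un : a + u n < b - u n.
    have : u n < (b - a) / 2 by rewrite ltr_pM2l// ltf_pV2 ?posrE// ltr_nat.
    by move: (u n) => e; lra.
  have ci h : {in `]a, b[, continuous h} ->
      mu.-integrable `[a + u n, b - u n] (EFin \o h).
    move=> ch; apply: continuous_compact_integrable; first exact: segment_compact.
    apply: continuous_in_subspaceT => x /set_mem xn; apply: ch.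
    by apply: itv_cc_in_oo xn; have := u0 n; move: (u n) => e; lra.
  have : (\int[mu]_(x in `[(a + u n)%R, (b - u n)%R]) (h1 x - h2 x)%:E =
      (H (b - u n))%:E - (H (a + u n))%:E)%E.
    apply: (@continuous_FTC2_oo a b) => //.
    - by rewrite ltrDl.
    - by rewrite ltrBlDr ltrDl.
    - by move=> x xab; apply: cvgB; [exact: c1|exact: c2].
  under eq_integral do rewrite EFinB.
  rewrite integralB//; [|exact: ci|exact: ci].
  have fi h : {in `]a, b[, continuous h} ->
      (\int[mu]_(x in `[(a + u n)%R, (b - u n)%R]) (h x)%:E)%E \is a fin_num.
    by move=> ch; apply: integrable_fin_num => //; exact: ci.
  have := fi _ c2; have := fi _ c1.
  case: (integral _ _ _) => //= ? _; case: (integral _ _ _) => //= ? _ [] ?.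
  by rewrite -!EFinD; congr (_%:E); lra.
have L1 : (\int[mu]_(x in `[(a + u n)%R, (b - u n)%R]) (h1 x)%:E + (H (a + u n))%:E @[n --> \oo] -->
    \int[mu]_(x in `]a, b[) (h1 x)%:E + la%:E)%E.
  apply: cvgeD; [by rewrite fin_num_adde_defl|exact: integral_oo_cvg|].
  apply: cvg_EFin; first by near=> n.
  apply: ((cvg_at_rightP _ _ _).1 Ha); split; first by move=> n; rewrite ltrDl.
  by rewrite -[X in _ --> X]addr0; apply: cvgD; [exact: cvg_cst|].
have L2 : (\int[mu]_(x in `[(a + u n)%R, (b - u n)%R]) (h1 x)%:E + (H (a + u n))%:E @[n --> \oo] -->
    \int[mu]_(x in `]a, b[) (h2 x)%:E + lb%:E)%E.
  under eq_fun do rewrite key.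
  apply: cvgeD; [by rewrite fin_num_adde_defl|exact: integral_oo_cvg|].
  apply: cvg_EFin; first by near=> n.
  apply: ((cvg_at_leftP _ _ _).1 Hb); split; first by move=> n; rewrite ltrBlDr ltrDl.
  by rewrite -[X in _ --> X]subr0; apply: cvgB; [exact: cvg_cst|].
exact: (cvg_unique _ L1 L2).
Unshelve. all: by end_near. Qed.
End ftc_open.

(** * Real powers and Bernoulli's inequalities *)

Section powR_calculus.
Context {R : realType}.
Implicit Types a b s x : R.

Lemma is_derive_powR (f : R -> R) a x df : 0 < f x -> is_derive x 1 f df ->
  is_derive x 1 (fun y => f y `^ a) (a * f x `^ (a - 1) * df).
Proof.
move=> fx0 hf.
have hp : is_derive (f x) 1 (fun y => y `^ a) (a * f x `^ (a - 1)).
  apply: DeriveDef; first by apply: derivable_powR; rewrite in_itv/= fx0.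
  by rewrite -derive1E powR_derive1// in_itv/= fx0.
exact: is_derive1_comp.
Qed.

Lemma is_derive_onem x k : is_derive x 1 (fun y : R => 1 - k * y) (- k).
Proof. by apply: is_derive_eq; rewrite add0r mul1r /GRing.scale/= mulr1. Qed.

Lemma is_derive_powR_id a x : 0 < x -> is_derive x 1 (fun y : R => y `^ a) (a * x `^ (a - 1)).
Proof. by move=> x0; rewrite -[X in is_derive _ _ _ X]mulr1; exact: (@is_derive_powR id). Qed.

Lemma is_derive_powR_onem a x : x < 1 ->
  is_derive x 1 (fun y : R => (1 - y) `^ a) (- (a * (1 - x) `^ (a - 1))).
Proof.
move=> x1; have := @is_derive_onem x 1; under eq_fun do rewrite mul1r.
move=> d; have x1' : 0 < 1 - x by rewrite subr_gt0.
by apply: (is_derive_eq (@is_derive_powR (fun y => 1 - y) a x _ x1' d)); rewrite mulrN1.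
Qed.

Lemma is_derive_continuous (f : R -> R) x df : is_derive x 1 f df -> {for x, continuous f}.
Proof. by case=> d _; apply: differentiable_continuous; exact/derivable1_diffP. Qed.

Lemma continuous_powR_pos a x : 0 < x -> {for x, continuous (fun y : R => y `^ a)}.
Proof. by move=> x0; exact: (is_derive_continuous (is_derive_powR_id a x0)). Qed.

(** Concavity of [ln]: let y be the mean of 1 and a with weights 1 - s and s. The tangent at y
    bounds ln 1 and ln a from above, and the weighted sum of the two bounds on ln 1 - ln y and ln a
    - ln y is zero. *)
Lemma powR_le_Bernoulli a s : 0 < a -> 0 <= s <= 1 -> a `^ s <= 1 + s * (a - 1).
Proof.
move=> a0 /andP[s0 s1]; have y0 : 0 < 1 + s * (a - 1).
  have -> : 1 + s * (a - 1) = (1 - s) + s * a by ring.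
  have := s0; rewrite le_eqVlt => /predU1P[<-|s0']; first by rewrite mul0r; lra.
  by rewrite ltr_wpDl ?subr_ge0// mulr_gt0.
set y := 1 + _ in y0 *.
rewrite /powR gt_eqF// -[leRHS]lnK ?posrE// ler_expR.
have h u : 0 < u -> ln u - ln y <= u / y - 1.
  move=> u0; rewrite -ln_div ?posrE//; have := @le_ln1Dx R (u / y - 1).
  by rewrite addrCA subrr addr0; apply; rewrite ltrBDr addrC subrr divr_gt0.
have := h _ a0; have := h _ ltr01; rewrite ln1 => h1 ha.
have : s * (ln a - ln y) + (1 - s) * (0 - ln y) <= s * (a / y - 1) + (1 - s) * (1 / y - 1).
  by rewrite lerD// ler_wpM2l// subr_ge0.
have -> : s * (a / y - 1) + (1 - s) * (1 / y - 1) = 0.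
  by rewrite /y; field; rewrite -/y gt_eqF.
by move=> H; rewrite -subr_le0; apply: le_trans H; lra.
Qed.

(** From exp u >= 1 + u and ln a <= a - 1. This is the counterpart for negative exponents, a lower
    bound. *)
Lemma powRN_ge_Bernoulli a s : 0 < a -> 0 <= s -> 1 - s * (a - 1) <= a `^ (- s).
Proof.
move=> a0 s0; rewrite /powR gt_eqF//; apply: le_trans (expR_ge1Dx _).
rewrite lerD2l mulNr lerN2 ler_wpM2l//.
have := @le_ln1Dx R (a - 1); rewrite addrCA subrr addr0; apply.
by rewrite ltrBDr addrC subrr.
Qed.

Lemma powRD1 x a : 0 < x -> x `^ (a + 1) = x `^ a * x.
Proof.
move=> x0; rewrite powRD; first by rewrite powRr1// ltW.
by rewrite (gt_eqF x0) implybT.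
Qed.

End powR_calculus.

(** * Integrals over (0, 1) with values in [\bar R] *)

Definition I01 {R : realType} (h : R -> R) : \bar R :=
  (\int[@lebesgue_measure R]_(x in `]0%R, 1%R[) (h x)%:E)%E.

Definition cont01 {R : realType} (h : R -> R) := {in `]0%R, 1%R[, continuous h}.

Section integral01.
Context {R : realType}.
Implicit Types (h g : R -> R).

Lemma in01P (x : R) : x \in `]0%R, 1%R[ -> 0 < x /\ 0 < 1 - x.
Proof. by rewrite in_itv/= subr_gt0 => /andP[]. Qed.

Lemma cont01_measurable h : cont01 h -> measurable_fun (`]0, 1[%classic : set R) (EFin \o h).
Proof. by move=> ch; apply/measurable_EFinP; exact: open_itv_measurable_fun. Qed.

Lemma eq_I01 h g : (forall x, 0 < x -> 0 < 1 - x -> h x = g x) -> I01 h = I01 g.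
Proof. by move=> hg; apply: eq_integral => x /set_mem/= /in01P[x0 x1]; rewrite hg. Qed.

Lemma le_I01 h g : cont01 h -> cont01 g ->
  (forall x, 0 < x -> 0 < 1 - x -> 0 <= h x <= g x) -> (I01 h <= I01 g)%E.
Proof.
move=> ch cg hg; apply: ge0_le_integral => //.
- by move=> x /= /in01P[x0 x1]; rewrite lee_fin; have /andP[] := hg _ x0 x1.
- exact: cont01_measurable.
- exact: cont01_measurable.
- by move=> x /= /in01P[x0 x1]; rewrite lee_fin; have /andP[] := hg _ x0 x1.
Qed.

Lemma I01_ge0 h : (forall x, 0 < x -> 0 < 1 - x -> 0 <= h x) -> (0 <= I01 h)%E.
Proof. by move=> h0; apply: integral_ge0 => x /= /in01P[x0 x1]; rewrite lee_fin h0. Qed.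

Lemma I01Z h k : cont01 h -> (forall x, 0 < x -> 0 < 1 - x -> 0 <= h x) -> 0 <= k ->
  I01 (fun x => k * h x) = (k%:E * I01 h)%E.
Proof.
move=> ch h0 k0; rewrite /I01 -ge0_integralZl_EFin//.
- by move=> x /= /in01P[x0 x1]; rewrite lee_fin h0.
- exact: cont01_measurable.
Qed.

Lemma I01D h g : cont01 h -> cont01 g -> (forall x, 0 < x -> 0 < 1 - x -> 0 <= h x) ->
  (forall x, 0 < x -> 0 < 1 - x -> 0 <= g x) ->
  I01 (fun x => h x + g x) = (I01 h + I01 g)%E.
Proof.
move=> ch cg h0 g0; rewrite /I01 -ge0_integralD//.
- by move=> x /= /in01P[x0 x1]; rewrite lee_fin h0.
- exact: cont01_measurable.
- by move=> x /= /in01P[x0 x1]; rewrite lee_fin g0.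
- exact: cont01_measurable.
Qed.

Lemma I01_FTC (H h1 h2 : R -> R) (l0 l1 : R) : cont01 h1 -> cont01 h2 ->
  (forall x, 0 < x -> 0 < 1 - x -> 0 <= h1 x) ->
  (forall x, 0 < x -> 0 < 1 - x -> 0 <= h2 x) ->
  (forall x : R, 0 < x -> 0 < 1 - x -> is_derive x 1 H (h1 x - h2 x)) ->
  H x @[x --> (0 : R)^'+] --> l0 -> H x @[x --> (1 : R)^'-] --> l1 ->
  (I01 h1 + l0%:E = I01 h2 + l1%:E)%E.
Proof.
move=> c1 c2 p1 p2 dH H0 H1; apply: (@ge0_FTC_oo _ _ _ _ _ H) => //.
- by move=> x /in01P[x0 x1]; exact: p1.
- by move=> x /in01P[x0 x1]; exact: p2.
- by move=> x /in01P[x0 x1]; exact: dH.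
Qed.

Lemma I01_FTC0 (H h1 h2 : R -> R) : cont01 h1 -> cont01 h2 ->
  (forall x, 0 < x -> 0 < 1 - x -> 0 <= h1 x) ->
  (forall x, 0 < x -> 0 < 1 - x -> 0 <= h2 x) ->
  (forall x : R, 0 < x -> 0 < 1 - x -> is_derive x 1 H (h1 x - h2 x)) ->
  H x @[x --> (0 : R)^'+] --> (0 : R) -> H x @[x --> (1 : R)^'-] --> (0 : R) ->
  I01 h1 = I01 h2.
Proof.
move=> c1 c2 p1 p2 dH H0 H1.
by have := I01_FTC c1 c2 p1 p2 dH H0 H1; rewrite !adde0.
Qed.

Lemma cont01M h g : cont01 h -> cont01 g -> cont01 (fun x => h x * g x).
Proof. by move=> ch cg x x01; apply: cvgM; [exact: ch|exact: cg]. Qed.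

Lemma cont01D h g : cont01 h -> cont01 g -> cont01 (fun x => h x + g x).
Proof. by move=> ch cg x x01; apply: cvgD; [exact: ch|exact: cg]. Qed.

Lemma cont01B h g : cont01 h -> cont01 g -> cont01 (fun x => h x - g x).
Proof. by move=> ch cg x x01; apply: cvgB; [exact: ch|exact: cg]. Qed.

Lemma cont01N h : cont01 h -> cont01 (fun x => - h x).
Proof. by move=> ch x x01; apply: cvgN; exact: ch. Qed.

Lemma cont01_cst k : cont01 (fun=> k : R).
Proof. by move=> x _; exact: cvg_cst. Qed.

Lemma cont01_id : cont01 (fun x : R => x).
Proof. by move=> x _; exact: cvg_id. Qed.

Lemma cont01_powR h a : cont01 h -> (forall x, 0 < x -> 0 < 1 - x -> 0 < h x) ->
  cont01 (fun x => h x `^ a).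
Proof.
move=> ch h0 x x01; have [x0 x1] := in01P x01.
have := @continuous_comp _ _ _ h (fun y : R => y `^ a) x; apply.
  exact: ch.
by apply: continuous_powR_pos; exact: h0.
Qed.

Lemma cont01_exp h n : cont01 h -> cont01 (fun x => h x ^+ n).
Proof.
move=> ch; elim: n => [|n IH].
  by under [X in cont01 X]eq_fun do rewrite expr0; exact: cont01_cst.
under [X in cont01 X]eq_fun do rewrite exprS.
exact: cont01M.
Qed.

Lemma cont01_inv h : cont01 h -> (forall x, 0 < x -> 0 < 1 - x -> 0 < h x) ->
  cont01 (fun x => (h x)^-1).
Proof.
move=> ch h0 x x01; have [x0 x1] := in01P x01.
by apply: cvgV; [rewrite gt_eqF// h0|exact: ch].
Qed.

End integral01.

(** The goals it leaves are the positivity, inside (0, 1), of bases of [powR] and of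
    denominators. *)
Ltac cont01_tac := repeat match goal with
  | |- cont01 (fun _ => ?c) => exact: cont01_cst
  | |- cont01 (fun x => x) => exact: cont01_id
  | |- cont01 (fun x => GRing.add (@?f x) (GRing.opp (@?g x))) => apply: (@cont01B _ f g)
  | |- cont01 (fun x => GRing.add (@?f x) (@?g x)) => apply: (@cont01D _ f g)
  | |- cont01 (fun x => GRing.opp (@?f x)) => apply: (@cont01N _ f)
  | |- cont01 (fun x => GRing.mul (@?f x) (@?g x)) => apply: (@cont01M _ f g)
  | |- cont01 (fun x => GRing.exp (@?f x) ?n) => apply: (@cont01_exp _ f n)
  | |- cont01 (fun x => powR (@?f x) ?a) => apply: (@cont01_powR _ f a)
  | |- cont01 (fun x => GRing.inv (@?f x)) => apply: (@cont01_inv _ f)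
  end; try by [].

(** * Beta integrals and their recurrences *)

Definition beta01 {R : realType} (a b : R) : \bar R :=
  I01 (fun x => x `^ a * (1 - x) `^ b).

Section beta.
Context {R : realType}.
Implicit Types a b : R.

Lemma beta01_cont a b : cont01 (fun x : R => x `^ a * (1 - x) `^ b).
Proof. cont01_tac. Qed.

Lemma beta01_integrand_ge0 a b (x : R) : 0 <= x `^ a * (1 - x) `^ b.
Proof. by rewrite mulr_ge0// powR_ge0. Qed.

Lemma beta01_ge0 a b : (0 <= beta01 a b)%E.
Proof. by apply: I01_ge0 => *; exact: beta01_integrand_ge0. Qed.

Lemma cvg_powR_onem0 a : (1 - x) `^ a @[x --> (0 : R)^'+] --> (1 : R).
Proof.
apply: cvg_at_right_filter; have /= := is_derive_continuous (is_derive_powR_onem a ltr01).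
by rewrite /prop_for /continuous_at subr0 powR1.
Qed.

Lemma cvg_powR1 a : x `^ a @[x --> (1 : R)^'-] --> (1 : R).
Proof.
apply: cvg_at_left_filter; have := @continuous_powR_pos R a 1 ltr01.
by rewrite /prop_for /continuous_at powR1.
Qed.

Lemma cvg_powR_onem1 a : 0 < a -> (1 - x) `^ a @[x --> (1 : R)^'-] --> (0 : R).
Proof.
move=> a0; apply/cvg_at_leftP => u [u1 uc].
apply: ((cvg_at_rightP (fun x : R => x `^ a) 0 0).1 (powR_cvg0 a0) (fun n => 1 - u n)).
split; first by move=> n; rewrite subr_gt0.
by rewrite -[X in _ --> X](subrr (1 : R)); apply: cvgB => //; exact: cvg_cst.
Qed.

Lemma beta01Z k a b : 0 <= k ->
  I01 (fun x => k * (x `^ a * (1 - x) `^ b)) = (k%:E * beta01 a b)%E.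
Proof.
move=> k0; rewrite /beta01 -I01Z//; first exact: beta01_cont.
by move=> *; exact: beta01_integrand_ge0.
Qed.

(** Integration by parts: x^(a+1) (1 - x)^(b+1) vanishes at both ends because a and b exceed -1. *)
Lemma beta01_rec a b : -1 < a -> -1 < b ->
  ((a + 1)%:E * beta01 a (b + 1) = (b + 1)%:E * beta01 (a + 1) b)%E.
Proof.
move=> a1 b1; have a0 : 0 < a + 1 by lra.
have b0 : 0 < b + 1 by lra.
rewrite -(beta01Z _ _ (ltW a0)) -(beta01Z _ _ (ltW b0)).
apply: (@I01_FTC0 _ (fun x => x `^ (a + 1) * (1 - x) `^ (b + 1))).
- by cont01_tac.
- by cont01_tac.
- by move=> x _ _; rewrite mulr_ge0 ?beta01_integrand_ge0// ltW.
- by move=> x _ _; rewrite mulr_ge0 ?beta01_integrand_ge0// ltW.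
- move=> x x0 x1; rewrite subr_gt0 in x1.
  apply: (is_derive_eq (is_deriveM (is_derive_powR_id _ x0) (is_derive_powR_onem _ x1))).
  by rewrite /GRing.scale/= !addrK; ring.
- rewrite -[X in _ --> X](mul0r (1 : R)).
  by apply: cvgM; [exact: powR_cvg0|exact: cvg_powR_onem0].
- rewrite -[X in _ --> X](mulr0 (1 : R)).
  by apply: cvgM; [exact: cvg_powR1|exact: cvg_powR_onem1].
Qed.

(** Insert x + (1 - x) = 1. The identity also holds between infinite values, so [beta01_fin] may use
    it. *)
Lemma beta01_split a b : beta01 a b = (beta01 (a + 1) b + beta01 a (b + 1))%E.
Proof.
rewrite /beta01 -I01D; [|exact: beta01_cont|exact: beta01_cont|..];
  [|by move=> *; exact: beta01_integrand_ge0..].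
apply: eq_I01 => x x0 x1; rewrite !powRD1//; ring.
Qed.

Lemma beta010 b : -1 < b -> beta01 0 b = ((b + 1)^-1)%:E.
Proof.
move=> b1; have b0 : 0 < b + 1 by lra.
have -> : beta01 0 b = I01 (fun x => (1 - x) `^ b).
  by apply: eq_I01 => x _ _; rewrite powRr0 mul1r.
have : (I01 (fun x : R => (1 - x) `^ b)%R + (- (b + 1)^-1)%:E = I01 (fun=> 0 : R)%R + 0%:E)%E.
  apply: (@I01_FTC _ (fun x => - (b + 1)^-1 * (1 - x) `^ (b + 1))).
  - by cont01_tac.
  - by cont01_tac.
  - by move=> x _ _; exact: powR_ge0.
  - by [].
  - move=> x x0 x1; rewrite subr_gt0 in x1.
    apply: (is_derive_eq (is_deriveZ _ (is_derive_powR_onem _ x1))).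
    rewrite addrK subr0 /GRing.scale/=; field.
    by rewrite gt_eqF.
  - rewrite -[X in _ --> X]mulr1; apply: cvgM; [exact: cvg_cst|exact: cvg_powR_onem0].
  - rewrite -[X in _ --> X](mulr0 (- (b + 1)^-1)).
    by apply: cvgM; [exact: cvg_cst|exact: cvg_powR_onem1].
have -> : I01 (fun=> 0 : R) = 0%E by exact: integral0.
case: (I01 _) => [r||]//=; rewrite -!EFinD => -[] h; congr (_%:E); lra.
Qed.

Lemma beta01b0 a : -1 < a -> beta01 a 0 = ((a + 1)^-1)%:E.
Proof.
move=> a1; have a0 : 0 < a + 1 by lra.
have -> : beta01 a 0 = I01 (fun x => x `^ a).
  by apply: eq_I01 => x _ _; rewrite powRr0 mulr1.
have : (I01 (fun x : R => x `^ a)%R + 0%:E = I01 (fun=> 0 : R)%R + ((a + 1)^-1)%:E)%E.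
  apply: (@I01_FTC _ (fun x => (a + 1)^-1 * x `^ (a + 1))).
  - by cont01_tac.
  - by cont01_tac.
  - by move=> x _ _; exact: powR_ge0.
  - by [].
  - move=> x x0 x1; apply: (is_derive_eq (is_deriveZ _ (is_derive_powR_id _ x0))).
    rewrite addrK subr0 /GRing.scale/=; field.
    by rewrite gt_eqF.
  - rewrite -[X in _ --> X](mulr0 (a + 1)^-1).
    by apply: cvgM; [exact: cvg_cst|exact: powR_cvg0].
  - rewrite -[X in _ --> X]mulr1; apply: cvgM; [exact: cvg_cst|exact: cvg_powR1].
by have -> : I01 (fun=> 0 : R) = 0%E; [exact: integral0|rewrite adde0 add0e].
Qed.

(** After [beta01_split], each term has a nonnegative exponent at one end; replacing that exponent
    by 0 leaves an explicit integral. *)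
Lemma beta01_fin a b : -1 < a -> -1 < b -> beta01 a b \is a fin_num.
Proof.
move=> a1 b1; rewrite ge0_fin_numE ?beta01_ge0// beta01_split; apply: lte_add_pinfty.
  apply: (@le_lt_trans _ _ (beta01 0 b)); last by rewrite beta010// ltry.
  apply: le_I01; [exact: beta01_cont|exact: beta01_cont|].
  move=> x x0 x1; rewrite beta01_integrand_ge0/= ler_wpM2r ?powR_ge0//.
  by apply: ger_powR; [rewrite x0/=|]; lra.
apply: (@le_lt_trans _ _ (beta01 a 0)); last by rewrite beta01b0// ltry.
apply: le_I01; [exact: beta01_cont|exact: beta01_cont|].
move=> x x0 x1; rewrite beta01_integrand_ge0/= ler_wpM2l ?powR_ge0//.
by apply: ger_powR; [rewrite x1/=|]; lra.
Qed.

(** Euler's B(a + 1, b + 1) when a and b exceed -1; [fine] gives 0 if the integral is infinite. *)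
Definition betaR a b : R := fine (beta01 a b).

Lemma betaRE a b : -1 < a -> -1 < b -> beta01 a b = (betaR a b)%:E.
Proof. by move=> a1 b1; rewrite fineK// beta01_fin. Qed.

Lemma betaR_ge0 a b : 0 <= betaR a b.
Proof. by rewrite fine_ge0// beta01_ge0. Qed.

Lemma betaR_rec a b : -1 < a -> -1 < b -> (a + 1) * betaR a (b + 1) = (b + 1) * betaR (a + 1) b.
Proof.
move=> a1 b1; have := beta01_rec a1 b1.
by rewrite !betaRE; [|lra..]; move=> -[].
Qed.

Lemma betaR_split a b : -1 < a -> -1 < b -> betaR a b = betaR (a + 1) b + betaR a (b + 1).
Proof.
move=> a1 b1; have := beta01_split a b.
by rewrite !betaRE; [|lra..]; move=> -[].
Qed.

Lemma betaR_recr a b : -1 < a -> -1 < b -> (b + 1) * betaR a b = (a + b + 2) * betaR a (b + 1).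
Proof.
move=> a1 b1; rewrite betaR_split// mulrDr -betaR_rec//; ring.
Qed.

Lemma betaR_recl a b : -1 < a -> -1 < b -> (a + 1) * betaR a b = (a + b + 2) * betaR (a + 1) b.
Proof.
move=> a1 b1; rewrite betaR_split// mulrDr betaR_rec//; ring.
Qed.

Lemma betaR00 : betaR 0 0 = 1.
Proof. by rewrite /betaR beta010 ?ltrN10// add0r invr1. Qed.

End beta.

(** * The function I_a and its bounds *)

Section gker.
Context {R : realType}.
Implicit Types a x t : R.

Lemma onem_mul_gt0 x t : 0 <= x -> x <= 1 -> 0 < t -> 0 < 1 - t -> 0 < 1 - x * t.
Proof.
move=> x0 x1 t0 t1; apply: (lt_le_trans t1).
by rewrite lerD2l lerN2 -[leRHS]mul1r ler_wpM2r// ltW.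
Qed.

(* The radial integrand left by the substitution [mobius] in [I01_kappa]; at [x = 1]
   it is a beta integrand. *)
Definition gker (m : nat) a x t : R :=
  t `^ (- a) * (1 - x * t) `^ a * (1 - t) ^+ m * (m.+1%:R * (1 - x * t) + x * (1 - t)).

(* By [is_derive_gker_aux], [gker m a 1 - gker m a x - gdef m a x] has a primitive that
   vanishes at both ends of [0, 1]. *)
Definition gdef (m : nat) a x t : R :=
  t `^ (- a - 1) * (1 - t) ^+ m.+1 * (a * ((1 - x * t) `^ a - (1 - t) `^ a)).

Lemma cont01_gker m a x : 0 <= x -> x <= 1 -> cont01 (gker m a x).
Proof.
move=> x0 x1; rewrite /gker; cont01_tac.
by move=> t t0 t1; exact: onem_mul_gt0.
Qed.

Lemma cont01_gdef m a x : 0 <= x -> x <= 1 -> cont01 (gdef m a x).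
Proof.
move=> x0 x1; rewrite /gdef; cont01_tac.
by move=> t t0 t1; exact: onem_mul_gt0.
Qed.

Lemma gker_ge0 m a x t : 0 <= x -> x <= 1 -> 0 < t -> 0 < 1 - t -> 0 <= gker m a x t.
Proof.
move=> x0 x1 t0 t1; have p := onem_mul_gt0 x0 x1 t0 t1.
rewrite /gker !mulr_ge0 ?powR_ge0 ?exprn_ge0 ?(ltW t1)// addr_ge0// mulr_ge0//; exact: ltW.
Qed.

(** From 1 - t <= 1 - x t: the power with exponent a is increasing for a >= 0 and decreasing for a <
    0, and the factor a restores the sign. Negative a is the case of the dual estimate in the Schur
    test. *)
Lemma gdef_ge0 m a x t : 0 <= x -> x <= 1 -> 0 < t -> 0 < 1 - t -> 0 <= gdef m a x t.
Proof.
move=> x0 x1 t0 t1; have p := onem_mul_gt0 x0 x1 t0 t1.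
have tx : 1 - t <= 1 - x * t.
  by rewrite lerD2l lerN2 -[leRHS]mul1r ler_wpM2r// ltW.
rewrite /gdef mulr_ge0//; first by rewrite mulr_ge0 ?powR_ge0// exprn_ge0// ltW.
have [a0|a0] := leP 0 a.
  by rewrite mulr_ge0// subr_ge0 ge0_ler_powR// nnegrE; exact: ltW.
rewrite nmulr_rge0// subr_le0 -[a in leLHS]opprK -[a in leRHS]opprK !(powRN _ (- a)).
rewrite lef_pV2 ?posrE ?powR_gt0// ge0_ler_powR ?nnegrE ?(ltW t1) ?(ltW p)//.
by rewrite oppr_ge0 ltW.
Qed.

(** It supplies the boundary value at 0 in [I01_gker_gdef], where a first-order zero has to absorb a
    blowing-up power. *)
Lemma cvg_quot0 (K : R -> R) d : is_derive (0 : R) 1 K d -> K 0 = 0 ->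
  K t / t @[t --> (0 : R)^'+] --> d.
Proof.
move=> [dK <-] K0; apply: cvg_dnbhs_at_right.
have := dK; rewrite /derivable /derive => /cvg_ex[l hl].
have /cvg_lim -> // := hl.
move: hl; rewrite K0; under eq_fun do rewrite subr0 /= addr0 /GRing.scale/= mulr1 mulrC.
by [].
Qed.

Lemma is_derive_pow_onem_mul x a t : 0 < 1 - x * t ->
  is_derive t 1 (fun u => (1 - x * u) `^ a) (- (x * a * (1 - x * t) `^ (a - 1))).
Proof.
move=> p; apply: (is_derive_eq (@is_derive_powR _ (fun y => 1 - x * y) a t _ p (is_derive_onem t x))).
by ring.
Qed.

Lemma is_derive_exp_onem (n : nat) t :
  is_derive t 1 (fun u : R => (1 - u) ^+ n.+1) (- (n.+1%:R * (1 - t) ^+ n)).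
Proof.
have d : is_derive t 1 (fun u : R => 1 - u) (- 1).
  by have := @is_derive_onem R t 1; under eq_fun do rewrite mul1r.
have := is_deriveX n.+1 d; rewrite exprfctE => h; apply: (is_derive_eq h).
by rewrite /GRing.scale/=; ring.
Qed.

(** Since (1 - x u) + x u = 1, the derivative of u^(-a) (1 - u)^(m+1) (1 - x u)^(a+1) is -
    [gker m a x] minus a u^(-a-1) (1 - u)^(m+1) (1 - x u)^a. Subtracting the same identity at x = 1
    turns the second terms into [gdef]. An exact derivative is called for because [gker m a 1] and
    [gker m a x] are not comparable pointwise: at x = 0 and a >= 0, say, the first is larger near t
    = 0 and smaller near t = 1. *)
Lemma is_derive_gker_aux m a x t : 0 <= x -> x <= 1 -> 0 < t -> 0 < 1 - t ->
  is_derive t 1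
    (fun u => u `^ (- a) * (1 - u) ^+ m.+1 * ((1 - x * u) `^ (a + 1) - (1 - u) `^ (a + 1)))
    (gker m a 1 t - (gker m a x t + gdef m a x t)).
Proof.
move=> x0 x1 t0 t1; have p := onem_mul_gt0 x0 x1 t0 t1.
have t1' : t < 1 by rewrite -subr_gt0.
apply: (is_derive_eq (is_deriveM (is_deriveM (is_derive_powR_id _ t0) (is_derive_exp_onem _ _))
  (is_deriveB (is_derive_pow_onem_mul _ p) (is_derive_powR_onem _ t1')))).
rewrite /GRing.scale/= /gker /gdef !fctE !mul1r !addrK.
have eT : t `^ (- a) = t `^ (- a - 1) * t by rewrite -powRD1// subrK.
rewrite eT !powRD1// exprS -natr1.
by ring.
Qed.

Lemma I01_gker_gdef m a x : 0 <= x -> x < 1 -> a < 1 -> 0 < m.+1%:R + a + 1 ->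
  (I01 (gker m a 1) = I01 (gker m a x) + I01 (gdef m a x))%E.
Proof.
move=> x0 x1 a1 ma; have x1' := ltW x1.
rewrite -I01D; [|exact: cont01_gker|exact: cont01_gdef|..]; last 2 first.
  by move=> *; exact: gker_ge0.
  by move=> *; exact: gdef_ge0.
apply: (I01_FTC0 (H := fun u => u `^ (- a) * (1 - u) ^+ m.+1 *
   ((1 - x * u) `^ (a + 1) - (1 - u) `^ (a + 1)))).
- exact: cont01_gker.
- by apply: cont01D; [exact: cont01_gker|exact: cont01_gdef].
- by move=> *; exact: gker_ge0.
- by move=> *; rewrite addr_ge0// ?gker_ge0// gdef_ge0.
- by move=> *; exact: is_derive_gker_aux.
(* At 0 the factor u^(-a) may blow up, but the difference of powers is O(u); what remains is
   u^(1-a), which tends to 0 because a < 1. *)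
- pose K u : R := (1 - x * u) `^ (a + 1) - (1 - u) `^ (a + 1).
  have p0 : 0 < 1 - x * 0 :> R by rewrite mulr0 subr0.
  have dK := is_deriveB (is_derive_pow_onem_mul (a + 1) p0)
    (is_derive_powR_onem (a + 1) (@ltr01 R)).
  have K0 : K 0 = 0 by rewrite /K mulr0 subrr.
  have Kq := @cvg_quot0 K _ dK K0.
  have L : u `^ (- a + 1) * (1 - u) ^+ m.+1 * (K u / u) @[u --> (0 : R)^'+] --> (0 : R).
    rewrite -[X in _ --> X](mul0r (- (x * (a + 1) * (1 - x * 0) `^ (a + 1 - 1)) -
      - ((a + 1) * (1 - 0) `^ (a + 1 - 1)))).
    apply: cvgM => //.
    rewrite -[X in _ --> X](mul0r (1 : R)); apply: cvgM.
      by apply: powR_cvg0; lra.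
    have := @cvg_powR_onem0 R m.+1%:R; apply: cvg_trans; apply: near_eq_cvg; near=> u.
    by rewrite powR_mulrn// subr_ge0; near: u; apply: nbhs_right_le.
  apply: cvg_trans L; apply: near_eq_cvg; near=> u; rewrite /K.
  have u0 : 0 < u by near: u; exact: nbhs_right_gt.
  rewrite (powRD1 _ u0); field.
  by rewrite gt_eqF.
(* At 1 the powers of 1 - u are recombined: a + 1 alone may be negative, but m + 1 + a + 1 is
   positive by hypothesis, and x < 1 keeps 1 - x u away from 0. *)
- have L : u `^ (- a) * ((1 - u) `^ m.+1%:R * (1 - x * u) `^ (a + 1) -
      (1 - u) `^ (m.+1%:R + a + 1)) @[u --> (1 : R)^'-] --> (0 : R).
    rewrite -[X in _ --> X](mulr0 (1 : R)); apply: cvgM; first exact: cvg_powR1.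
    rewrite -[X in _ --> X](subr0 (0 : R)); apply: cvgB; last exact: cvg_powR_onem1.
    rewrite -[X in _ --> X](mul0r ((1 - x * 1) `^ (a + 1))); apply: cvgM.
      exact: cvg_powR_onem1.
    have p1 : 0 < 1 - x * 1 by rewrite mulr1 subr_gt0.
    apply: cvg_at_left_filter.
    exact: (is_derive_continuous (is_derive_pow_onem_mul (a + 1) p1)).
  apply: cvg_trans L; apply: near_eq_cvg; near=> u.
  have u1 : 0 < 1 - u by rewrite subr_gt0; near: u; exact: nbhs_left_lt.
  rewrite -mulrA; congr (_ * _); rewrite mulrBr -powR_mulrn ?(ltW u1)// -addrA.
  by rewrite (powRD (r := m.+1%:R))//; rewrite (gt_eqF u1) implybT.
Unshelve. all: by end_near. Qed.

Lemma I01_gker1 m a : I01 (gker m a 1) = I01 (fun t => m.+2%:R * (t `^ (- a) * (1 - t) `^ (m.+1%:R + a))).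
Proof.
apply: eq_I01 => t t0 t1; rewrite /gker !mul1r.
rewrite powRD; last by rewrite (gt_eqF t1) implybT.
rewrite powR_mulrn ?(ltW t1)// exprS -(natr1 m.+1); ring.
Qed.

(** The constant c_a in dimension n = [m.+1]; thus [m.+2] stands for n + 1 here and below. *)
Definition gconst m a : R := m.+2%:R * betaR (- a) (m.+1%:R + a).

Lemma gconst_ge0 m a : 0 <= gconst m a.
Proof. by rewrite mulr_ge0// betaR_ge0. Qed.

Lemma I01_gker1E m a : a < 1 -> 0 < m.+1%:R + a + 1 -> I01 (gker m a 1) = (gconst m a)%:E.
Proof.
by move=> a1 ma; rewrite I01_gker1 beta01Z// betaRE//; lra.
Qed.

Lemma I01_gker_le m a x : 0 <= x -> x < 1 -> a < 1 -> 0 < m.+1%:R + a + 1 ->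
  (I01 (gker m a x) <= (gconst m a)%:E)%E.
Proof.
move=> x0 x1 a1 ma; rewrite -I01_gker1E// (I01_gker_gdef x0 x1)// leeDl//.
by apply: I01_ge0 => *; rewrite gdef_ge0// ltW.
Qed.

(** For a = 0 [gdef] vanishes, so the integral does not depend on x. This says that the transform
    reproduces constants, and it also yields the volume of the ball in [volE]. *)
Lemma I01_gker0 m x : 0 <= x -> x < 1 -> I01 (gker m 0 x) = 1%E.
Proof.
move=> x0 x1; have m1 : 0 < m.+1%:R + 0 + 1 :> R by rewrite addr0 addr_gt0.
have := I01_gker_gdef x0 x1 (@ltr01 R) m1.
have -> : I01 (gdef m 0 x) = I01 (fun=> 0 : R).
  by apply: eq_I01 => t _ _; rewrite /gdef mul0r mulr0.
have -> : I01 (fun=> 0 : R) = 0%E by exact: integral0.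
rewrite adde0 => <-; rewrite I01_gker1E//; congr (_%:E).
rewrite /gconst /betaR oppr0 addr0 beta010/=; last by rewrite (@lt_trans _ _ 0)// ltrN10.
by rewrite -(natr1 m.+1) mulfV// gt_eqF// addr_gt0.
Qed.

(** With y = (1 - x t) / (1 - t), Bernoulli gives y^a - 1 <= a (y - 1), and (1 - t) (y - 1) = (1 -
    x) t. This produces the factor 1 - x and a factor t that lowers the singularity t^(-a-1) to
    t^(-a). *)
Lemma I01_gdef_le m a x : 0 <= x -> x < 1 -> 0 <= a -> a < 1 ->
  (I01 (gdef m a x) <= ((1 - x) * gconst m a)%:E)%E.
Proof.
move=> x0 x1 a0 a1; have m0 : 0 < m.+1%:R :> R by [].
have k0 : 0 <= a ^+ 2 * (1 - x) by rewrite mulr_ge0// ?sqr_ge0// subr_ge0 ltW.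
apply: (@le_trans _ _ (I01 (fun t => a ^+ 2 * (1 - x) * (t `^ (- a) * (1 - t) `^ (m%:R + a))))).
  apply: le_I01.
  - by apply: cont01_gdef => //; exact: ltW.
  - by cont01_tac.
  - move=> t t0 t1; rewrite gdef_ge0//=; last exact: ltW.
    have p := onem_mul_gt0 x0 (ltW x1) t0 t1.
    pose y := (1 - x * t) / (1 - t).
    have y0 : 0 < y by rewrite divr_gt0.
    have eT : t `^ (- a) = t `^ (- a - 1) * t by rewrite -powRD1// subrK.
    have e1 : (1 - x * t) `^ a = y `^ a * (1 - t) `^ a.
      by rewrite -powRM ?ltW// /y divfK// gt_eqF.
    have := @powR_le_Bernoulli _ y a y0; rewrite a0 ltW// => /(_ isT) B.
    have -> : a ^+ 2 * (1 - x) * (t `^ (- a) * (1 - t) `^ (m%:R + a)) =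
        t `^ (- a - 1) * (1 - t) ^+ m.+1 * (a * ((1 - t) `^ a * (a * (y - 1)))).
      rewrite powRD; last by rewrite (gt_eqF t1) implybT.
      rewrite powR_mulrn ?(ltW t1)// eT [(1 - t) ^+ m.+1]exprS.
      have ey : (1 - t) * (y - 1) = (1 - x) * t by rewrite /y; field; rewrite gt_eqF.
      transitivity (t `^ (- a - 1) * (1 - t) ^+ m * a ^+ 2 * (1 - t) `^ a *
        ((1 - t) * (y - 1))); last by ring.
      by rewrite ey; ring.
    rewrite /gdef; apply: ler_wpM2l; first by rewrite mulr_ge0 ?powR_ge0// exprn_ge0// ltW.
    apply: ler_wpM2l => //.
    rewrite e1 -{2}(mul1r ((1 - t) `^ a)) -mulrBl [leRHS]mulrC ler_wpM2r ?powR_ge0//.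
    by rewrite lerBlDl.
rewrite beta01Z// betaRE; [|lra|]; last by rewrite ltr_wpDl// ?ler0n//; lra.
rewrite lee_fin /gconst.
have [am1 ma1] : -1 < - a /\ -1 < m%:R + a by have := ler0n R m; split; lra.
have ma0 : 0 < m.+1%:R + a by rewrite ltr_wpDr.
(* The recurrence rewrites [gconst m a] as (m + 1 + a) times the beta value on the left, so that
   only a^2 <= 1 <= m + 1 + a remains. *)
have := betaR_recr am1 ma1.
have -> : m%:R + a + 1 = m.+1%:R + a by rewrite -natr1; ring.
have -> : - a + (m%:R + a) + 2 = m.+2%:R by rewrite -!natr1; ring.
move=> <-.
have -> : a ^+ 2 * (1 - x) * betaR (- a) (m%:R + a) =
  (1 - x) * (a ^+ 2 * betaR (- a) (m%:R + a)) by ring.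
apply: ler_wpM2l; first by rewrite subr_ge0 ltW.
apply: ler_wpM2r; first exact: betaR_ge0.
apply: (@le_trans _ _ 1); first by rewrite exprn_ile1// ltW.
by rewrite -natr1 -addrA [1 + a]addrC addrA lerDr addr_ge0// ler0n.
Qed.

Lemma I01_gker_ge m a x : 0 <= x -> x < 1 -> 0 <= a -> a < 1 ->
  ((x * gconst m a)%:E <= I01 (gker m a x))%E.
Proof.
move=> x0 x1 a0 a1; have ma : 0 < m.+1%:R + a + 1 by rewrite !ltr_wpDr.
have := I01_gker_gdef x0 x1 a1 ma; rewrite I01_gker1E//.
have := I01_gker_le x0 x1 a1 ma.
have := I01_gdef_le m x0 x1 a0 a1.
have : (0 <= I01 (gdef m a x))%E by apply: I01_ge0 => *; rewrite gdef_ge0// ltW.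
have : (0 <= I01 (gker m a x))%E by apply: I01_ge0 => *; rewrite gker_ge0// ltW.
case: (I01 (gker m a x)) => [g||]//; case: (I01 (gdef m a x)) => [d||]//.
by rewrite -EFinD !lee_fin => _ _ h1 h2 [] h3; lra.
Qed.

End gker.

(** * The substitution t -> (1 - t) / (1 - x t) *)

Section mobius.
Context {R : realType}.
Local Notation mu := (@lebesgue_measure R).

(** For 0 <= x < 1 this is an order-reversing involution of (0, 1). At x = 0 it is t -> 1 - t, which
    gives the symmetry of the beta integral. *)
Definition mobius (x t : R) : R := (1 - t) / (1 - x * t).

Lemma is_derive_mobius (x t : R) : 0 < 1 - x * t ->
  is_derive t 1 (mobius x) (- ((1 - x) / (1 - x * t) ^+ 2)).
Proof.
move=> p; have n0 : 1 - x * t != 0 by rewrite gt_eqF.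
have d1 : is_derive t 1 (fun u : R => 1 - u) (- 1).
  by have := @is_derive_onem R t 1; under eq_fun do rewrite mul1r.
have dV := @is_deriveV _ (fun u => 1 - x * u) _ _ _ n0 (is_derive_onem t x).
have := is_deriveM d1 dV.
move=> h; apply: (is_derive_eq h).
by rewrite /GRing.scale/=; field.
Qed.

Variable x : R.
Hypothesis x01 : 0 <= x < 1.
Let x0 : 0 <= x. Proof. by case/andP: x01. Qed.
Let x1 : x < 1. Proof. by case/andP: x01. Qed.
Let p t : 0 < t -> 0 < 1 - t -> 0 < 1 - x * t.
Proof. by move=> ? ?; apply: onem_mul_gt0 => //; exact: ltW. Qed.

Lemma onem_mobius t : 0 < t -> 0 < 1 - t -> 1 - mobius x t = t * (1 - x) / (1 - x * t).
Proof. by move=> t0 t1; have h := p t0 t1; rewrite /mobius; field; rewrite gt_eqF. Qed.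

Lemma onem_mul_mobius t : 0 < t -> 0 < 1 - t -> 1 - x * mobius x t = (1 - x) / (1 - x * t).
Proof. by move=> t0 t1; have h := p t0 t1; rewrite /mobius; field; rewrite gt_eqF. Qed.

Lemma mobius_gt0 t : 0 < t -> 0 < 1 - t -> 0 < mobius x t.
Proof. by move=> t0 t1; rewrite divr_gt0// p. Qed.

Lemma onem_mobius_gt0 t : 0 < t -> 0 < 1 - t -> 0 < 1 - mobius x t.
Proof.
move=> t0 t1; rewrite onem_mobius// divr_gt0 ?p// mulr_gt0// subr_gt0//.
Qed.

Lemma mobiusK t : 0 < t -> 0 < 1 - t -> mobius x (mobius x t) = t.
Proof.
move=> t0 t1; rewrite {1}/mobius onem_mobius// onem_mul_mobius//.
have h := p t0 t1; field; rewrite (gt_eqF h)/= subr_eq0 gt_eqF//.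
Qed.

Lemma mobius_decr s t : 0 < s -> 0 < 1 - t -> s < t -> mobius x t < mobius x s.
Proof.
move=> s0 t1 st; have t0 : 0 < t by exact: lt_trans st.
have s1 : 0 < 1 - s by apply: (lt_trans t1); rewrite ltrD2l ltrN2.
rewrite /mobius ltr_pdivrMr ?p// mulrAC ltr_pdivlMr ?p//.
rewrite -subr_gt0.
have -> : (1 - s) * (1 - x * t) - (1 - t) * (1 - x * s) = (t - s) * (1 - x) by ring.
by rewrite mulr_gt0// subr_gt0.
Qed.

Lemma cont01_mobius : cont01 (mobius x).
Proof.
by move=> t /in01P[t0 t1]; exact: (is_derive_continuous (is_derive_mobius (p t0 t1))).
Qed.

Lemma mobius_substitution (h : R -> R) (c d : R) : 0 < c -> c < d -> 0 < 1 - d -> cont01 h ->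
  (\int[mu]_(r in `[mobius x d, mobius x c]) (h r)%:E =
   \int[mu]_(t in `[c, d]) (h (mobius x t) * ((1 - x) / (1 - x * t) ^+ 2))%:E)%E.
Proof.
move=> c0 cd d1 ch.
have cd01 t : t \in `[c, d] -> 0 < t /\ 0 < 1 - t.
  by rewrite in_itv/= => /andP[ct td]; split; lra.
have D (t : R) : 0 < t -> 0 < 1 - t -> (mobius x)^`()%classic t = - ((1 - x) / (1 - x * t) ^+ 2).
  by move=> t0 t1; rewrite derive1E; have [_ ->] := is_derive_mobius (p t0 t1).
have cD : cont01 (mobius x)^`()%classic.
  move=> t t01; have [t0 t1] := in01P t01.
  have cf : {for t, continuous (fun t => - ((1 - x) / (1 - x * t) ^+ 2))}.
    have : cont01 (fun t => - ((1 - x) / (1 - x * t) ^+ 2)).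
      cont01_tac; move=> u u0 u1; exact/exprn_gt0/p.
    exact.
  move: cf; rewrite /prop_for /continuous_at -D//; apply: cvg_trans.
  apply: near_eq_cvg; near=> u; have /in01P[u0 u1] : u \in `]0, 1[.
    by near: u; apply: near_in_itvoo.
  by rewrite D.
have c1 : 0 < 1 - c by apply: (lt_trans d1); rewrite ltrD2l ltrN2.
have d0 : 0 < d by exact: lt_trans cd.
have c01 : c \in `]0, 1[ by rewrite in_itv/= c0 -subr_gt0.
have d01 : d \in `]0, 1[ by rewrite in_itv/= d0 -subr_gt0.
rewrite integration_by_substitution_decreasing//.
- apply: eq_integral => t /set_mem/= /cd01[t0 t1].
  by rewrite !fctE/= D// opprK.
- exact: ltW.
- move=> s t /cd01[s0 s1] /cd01[t0 t1] st.
  exact: mobius_decr.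
- move=> t tcd; apply: cD; have [|t0 t1] := cd01 t; first exact: subset_itv_oo_cc.
  by rewrite in_itv/= t0 -subr_gt0.
- by apply/cvg_ex; exists ((mobius x)^`()%classic c); apply: cvg_at_right_filter; exact: cD.
- by apply/cvg_ex; exists ((mobius x)^`()%classic d); apply: cvg_at_left_filter; exact: cD.
- split.
  + move=> t tcd; have [|t0 t1] := cd01 t; first exact: subset_itv_oo_cc.
    by have [] := is_derive_mobius (p t0 t1).
  + by apply: cvg_at_right_filter; exact: cont01_mobius.
  + by apply: cvg_at_left_filter; exact: cont01_mobius.
- apply: continuous_in_subspaceT => t /set_mem/=; rewrite in_itv/= => /andP[h1 h2].
  apply: ch; rewrite in_itv/=.
  rewrite (lt_le_trans _ h1) ?mobius_gt0//= (le_lt_trans h2)// -subr_gt0.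
  exact: onem_mobius_gt0.
Unshelve. all: by end_near. Qed.

(** The compact intervals [c n, d n] increase to (0, 1), and so do their images, because the map is
    a decreasing involution ([ME]). The substitution is made on each of them and monotone
    convergence is applied on both sides. *)
Lemma I01_mobius (h : R -> R) : cont01 h -> (forall t, 0 < t -> 0 < 1 - t -> 0 <= h t) ->
  I01 h = I01 (fun t => h (mobius x t) * ((1 - x) / (1 - x * t) ^+ 2)).
Proof.
move=> ch h0.
have M01 t : t \in `]0, 1[ -> mobius x t \in `]0, 1[.
  move=> /in01P[t0 t1]; rewrite in_itv/= mobius_gt0//= -subr_gt0.
  exact: onem_mobius_gt0.
have ch2 : cont01 (fun t => h (mobius x t) * ((1 - x) / (1 - x * t) ^+ 2)).
  apply: cont01M.
    move=> t t01; have := @continuous_comp _ _ _ (mobius x) h t; apply.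
      exact: cont01_mobius.
    by apply: ch; exact: M01.
  by cont01_tac; move=> t t0 t1; exact/exprn_gt0/p.
have nn2 t : t \in `]0, 1[ -> 0 <= h (mobius x t) * ((1 - x) / (1 - x * t) ^+ 2).
  move=> t01; have [t0 t1] := in01P t01; have [m0 m1] := in01P (M01 _ t01).
  rewrite mulr_ge0 ?h0// divr_ge0//; first by rewrite subr_ge0 ltW.
  exact/exprn_ge0/ltW/p.
have L := @integral_oo_cvg R 0 1 _ ltr01 ch2 nn2.
pose c n : R := 0 + (1 - 0) / n.+3%:R; pose d n : R := 1 - (1 - 0) / n.+3%:R.
have c0 n : 0 < c n by rewrite /c add0r subr0 divr_gt0.
have d1 n : 0 < 1 - d n by rewrite /d subr0 opprB addrCA subrr addr0 divr_gt0.
have cd n : c n < d n.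
  rewrite /c /d add0r !subr0 !div1r ltrBrDr -mulr2n -[_ *+ 2]mulr_natl.
  by rewrite ltr_pdivrMr// mul1r ltr_nat.
have c1 n : 0 < 1 - c n by apply: (lt_trans (d1 n)); rewrite ltrD2l ltrN2.
have d0 n : 0 < d n by exact: lt_trans (cd n).
have ME t n : 0 < t -> 0 < 1 - t ->
    (t \in `[mobius x (d n), mobius x (c n)]) = (mobius x t \in `[c n, d n]).
  move=> t0 t1.
  have mono u v : 0 < u -> 0 < 1 - u -> 0 < v -> 0 < 1 - v ->
      (mobius x u <= mobius x v) = (v <= u).
    move=> u0 u1 v0 v1; case: (ltgtP u v) => [uv|vu|->]; last exact: lexx.
      by apply/negbTE; rewrite -ltNge; exact: mobius_decr.
    by rewrite ltW// mobius_decr.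
  rewrite !in_itv/= -{1 2}(mobiusK t0 t1) andbC.
  by rewrite !mono// ?mobius_gt0// ?onem_mobius_gt0.
have L2 : (\int[mu]_(r in `[mobius x (d n), mobius x (c n)]) (h r)%:E)%E @[n --> \oo] -->
    I01 h.
  rewrite /I01 (_ : `]0, 1[%classic = \bigcup_n `[mobius x (d n), mobius x (c n)]%classic).
    apply: ge0_nondecreasing_set_cvg_integral.
    - move=> n m nm; apply/subsetPset => t /= tn.
      have [t0 t1] : 0 < t /\ 0 < 1 - t.
        move: tn; rewrite in_itv/= => /andP[h1 h2]; split.
          by apply: lt_le_trans h1; exact: mobius_gt0.
        apply: (@lt_le_trans _ _ (1 - mobius x (c n))); first exact: onem_mobius_gt0.
        by rewrite lerD2l lerN2.
      move: tn; rewrite !ME//.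
      by have /subsetPset := @itv_oo_homo R 0 1 ltr01 _ _ nm; apply.
    - by move=> n; exact: measurable_itv.
    - move=> n; apply/measurable_EFinP.
      apply: (measurable_funS (measurable_itv `]0, 1[)); last exact: open_itv_measurable_fun.
      move=> t /=; apply: itv_cc_in_oo; first exact: mobius_gt0.
      by rewrite -subr_gt0; exact: onem_mobius_gt0.
    - move=> n t /= tn; rewrite lee_fin.
      have /in01P[t0 t1] : t \in `]0, 1[.
        apply: itv_cc_in_oo tn; first exact: mobius_gt0.
        by rewrite -subr_gt0; exact: onem_mobius_gt0.
      exact: h0.
  apply/seteqP; split => t /=.
    move=> t01; have [t0 t1] := in01P t01.
    have : [set` `]0, 1[] (mobius x t) by exact: M01.
    rewrite (@itv_oo_bigcup R 0 1 ltr01) => -[n _ /= tn]; exists n => //=.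
    by rewrite ME.
  move=> [n _ /=]; apply: itv_cc_in_oo; first exact: mobius_gt0.
  by rewrite -subr_gt0; exact: onem_mobius_gt0.
apply: (cvg_unique _ L2); first exact: ereal_hausdorff.
apply: cvg_trans L; apply: near_eq_cvg; near=> n.
by rewrite mobius_substitution.
Unshelve. all: by end_near. Qed.

End mobius.

(** * The reflection formula *)

Lemma beta01C {R : realType} (a b : R) : beta01 a b = beta01 b a.
Proof.
have x01 : (0 : R) <= 0 < (1 : R) by rewrite lexx ltr01.
rewrite {1}/beta01 (I01_mobius x01).
- apply: eq_I01 => t t0 t1; rewrite /mobius !mul0r !subr0 !divr1 expr1n divr1 mulr1.
  by rewrite opprB addrCA subrr addr0 mulrC.
- exact: beta01_cont.
- by move=> *; exact: beta01_integrand_ge0.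
Qed.

(** * Cauchy's cosine integrals *)

Section trig_integrals.
Context {R : realType}.
Implicit Types (s x : R) (f g F : R -> R).
Local Notation mu := (@lebesgue_measure R).

Definition Jint f : R := \int[mu]_(x in `[0, pi / 2]) f x.

Lemma pihalf_gt0 : 0 < pi / 2 :> R.
Proof. by rewrite divr_gt0// pi_gt0. Qed.

Lemma Jint_integrable f : continuous f -> mu.-integrable `[0, pi / 2] (EFin \o f).
Proof.
move=> cf; apply: continuous_compact_integrable; first exact: segment_compact.
exact: continuous_subspaceT.
Qed.

Lemma JintB f g : continuous f -> continuous g ->
  Jint (fun x => f x - g x) = Jint f - Jint g.
Proof. by move=> cf cg; rewrite /Jint RintegralB//; exact: Jint_integrable. Qed.

Lemma JintZ k f : continuous f -> Jint (fun x => k * f x) = k * Jint f.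
Proof. by move=> cf; rewrite /Jint RintegralZl//; exact: Jint_integrable. Qed.

Lemma le_Jint f g : continuous f -> continuous g ->
  (forall x, 0 <= x -> x <= pi / 2 -> f x <= g x) -> Jint f <= Jint g.
Proof.
move=> cf cg fg; apply: le_Rintegral => //; try exact: Jint_integrable.
by move=> x /=; rewrite in_itv/= => /andP[]; exact: fg.
Qed.

Lemma Jint_FTC F f : continuous f -> (forall x, is_derive x 1 F (f x)) ->
  Jint f = F (pi / 2) - F 0.
Proof.
move=> cf dF; rewrite /Jint /Rintegral (@continuous_FTC2 _ _ F)//.
- exact: pihalf_gt0.
- exact: continuous_subspaceT.
- split.
  + by move=> x _; have [] := dF x.
  + by apply: cvg_at_right_filter; exact: (is_derive_continuous (dF 0)).
  + by apply: cvg_at_left_filter; exact: (is_derive_continuous (dF (pi / 2))).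
- by move=> x _; rewrite derive1E; have [] := dF x.
Qed.

Lemma is_derive_scale k x : is_derive x 1 (fun y => k * y) k.
Proof. by apply: is_derive_eq; rewrite /GRing.scale/= mulr1. Qed.

Lemma is_derive_cosZ k x : is_derive x 1 (fun y => cos (k * y)) (- (k * sin (k * x))).
Proof.
apply: (is_derive_eq (@is_derive1_comp _ cos (fun y => k * y) x _ _
  (is_derive_cos _) (is_derive_scale k x))).
by rewrite mulNr mulrC.
Qed.

Lemma is_derive_sinZ k x : is_derive x 1 (fun y => sin (k * y)) (k * cos (k * x)).
Proof.
apply: (is_derive_eq (@is_derive1_comp _ sin (fun y => k * y) x _ _
  (is_derive_sin _) (is_derive_scale k x))).
by rewrite mulrC.
Qed.

Lemma is_derive_cosX n x :
  is_derive x 1 (fun y => cos y ^+ n.+1) (- (n.+1%:R * cos x ^+ n * sin x)).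
Proof.
have := is_deriveX n.+1 (is_derive_cos x); rewrite exprfctE => h; apply: (is_derive_eq h).
by rewrite /GRing.scale/= mulrN.
Qed.

(** Its integral over [0, pi / 2] is Cauchy's, equal to pi Gamma(2m + 1) / (2^(2m+1) Gamma(m + 1 +
    s) Gamma(m + 1 - s)): up to a factor independent of s, the reciprocal of B(m + 1 - s, m + 1 +
    s). *)
Definition cosker m s x : R := cos x ^+ (2 * m) * cos (2 * s * x).

Lemma continuous_cosZ k : continuous (fun x => cos (k * x) : R).
Proof. by move=> x; exact: (is_derive_continuous (is_derive_cosZ k x)). Qed.

Lemma continuous_cosX n : continuous (fun x => cos x ^+ n : R).
Proof.
case: n => [|n] x; last exact: (is_derive_continuous (is_derive_cosX n x)).
by under eq_fun do rewrite expr0; exact: cvg_cst.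
Qed.

Lemma continuous_cosker m s : continuous (cosker m s).
Proof. by move=> x; apply: cvgM; [exact: continuous_cosX|exact: continuous_cosZ]. Qed.

Lemma continuous_fctZ k f : continuous f -> continuous (fun x => k * f x).
Proof. by move=> cf x; apply: cvgM; [exact: cvg_cst|exact: cf]. Qed.

Definition cosint m s : R := Jint (cosker m s).

Lemma cosint_rec m s :
  4 * (m.+1%:R ^+ 2 - s ^+ 2) * cosint m.+1 s = (2 * m.+1)%:R * (2 * m + 1)%:R * cosint m s.
Proof.
apply/eqP; rewrite -subr_eq0 /cosint -!JintZ; [|exact: continuous_cosker..].
rewrite -JintB; [|by apply: continuous_fctZ; exact: continuous_cosker..].
(* Two integrations by parts in one primitive. The coefficients make the terms in sin x sin(2 s x)
   cancel in the derivative; the boundary values vanish since sin 0 = 0 and cos(pi / 2) = 0. *)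
pose F x := (2 * m.+1)%:R * (cos x ^+ (2 * m).+1 * sin x * cos (2 * s * x))
  - 2 * s * (cos x ^+ (2 * m).+2 * sin (2 * s * x)).
transitivity (F (pi / 2) - F 0 == 0); last first.
  have -> : F 0 = 0 by rewrite /F !mulr0 !sin0; ring.
  have -> : F (pi / 2) = 0 by rewrite /F cos_pihalf !expr0n/=; ring.
  by rewrite subrr eqxx.
congr (_ == 0); apply: Jint_FTC.
- move=> x; apply: cvgB; apply: continuous_fctZ; exact: continuous_cosker.
- move=> x.
  have d1 := is_deriveZ (2 * m.+1)%:R (is_deriveM (is_deriveM (is_derive_cosX (2 * m) x)
    (is_derive_sin x)) (is_derive_cosZ (2 * s) x)).
  have d2 := is_deriveZ (2 * s) (is_deriveM (is_derive_cosX (2 * m).+1 x)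
    (is_derive_sinZ (2 * s) x)).
  apply: (is_derive_eq (is_deriveB d1 d2)).
  rewrite /GRing.scale/= !fctE /cosker.
  have -> : (2 * m.+1 = (2 * m).+2)%N by rewrite mulnS.
  have e : sin x ^+ 2 = 1 - cos x ^+ 2 by rewrite sin2cos2.
  by rewrite !exprS !expr0 !mulr1; ring: e.
Qed.

Lemma cosint00 : cosint 0 0 = pi / 2.
Proof.
have -> : cosint 0 0 = 1 * (pi / 2) - 1 * 0.
  apply: Jint_FTC; first exact: continuous_cosker.
  move=> x; apply: (is_derive_eq (is_derive_scale 1 x)).
  by rewrite /cosker muln0 expr0 mulr0 mul0r cos0 mulr1.
by rewrite mul1r mulr0 subr0.
Qed.

Lemma cosint0 s : s != 0 -> cosint 0 s = sin (pi * s) / (2 * s).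
Proof.
move=> s0.
have -> : cosint 0 s = (2 * s)^-1 * sin (2 * s * (pi / 2)) - (2 * s)^-1 * sin (2 * s * 0).
  apply: (@Jint_FTC (fun x => (2 * s)^-1 * sin (2 * s * x))); first exact: continuous_cosker.
  move=> x; apply: (is_derive_eq (is_deriveZ _ (is_derive_sinZ (2 * s) x))).
  by rewrite /cosker muln0 expr0 /GRing.scale/=; field.
by rewrite mulr0 sin0 mulr0 subr0 mulrC; congr (sin _ / _); field.
Qed.

Lemma cosint_le m s : cosint m s <= cosint m 0.
Proof.
apply: le_Jint; [exact: continuous_cosker..|].
move=> x _ _; rewrite /cosker mulr0 mul0r cos0; apply: ler_wpM2l; last exact: cos_le1.
by rewrite exprM exprn_ge0// sqr_ge0.
Qed.

Lemma cosint_gt0 m : 0 < cosint m 0.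
Proof.
elim: m => [|m IH]; first by rewrite cosint00 pihalf_gt0.
have := cosint_rec m 0; rewrite expr0n subr0 => e.
have : 0 < 4 * m.+1%:R ^+ 2 * cosint m.+1 0 by rewrite e !mulr_gt0.
by rewrite pmulr_rgt0// mulr_gt0// exprn_gt0.
Qed.

Lemma sin_le_id x : 0 <= x -> sin x <= x.
Proof.
move=> x0; rewrite -subr_ge0.
have d (y : R) : is_derive y 1 (fun y => y - sin y) (1 - cos y) by exact: is_deriveB.
have := @ger0_derive1_ndecr R (fun y => y - sin y) 0 x _ _ _ 0 x (lexx _) x0 (lexx _).
rewrite sin0 subr0; apply.
- by move=> y _; have [] := d y.
- by move=> y _; rewrite derive1E; have [_ ->] := d y; rewrite subr_ge0 cos_le1.
- by apply: continuous_subspaceT => y; exact: (is_derive_continuous (d y)).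
Qed.

Lemma sqr_sin_le x : sin x ^+ 2 <= x ^+ 2.
Proof.
have h (y : R) : 0 <= y -> sin y ^+ 2 <= y ^+ 2.
  move=> y0; rewrite -ler_sqrt ?sqr_ge0// !sqrtr_sqr (ger0_norm y0) ler_norml sin_le_id// andbT.
  have [y1|y1] := leP y 1; last by rewrite (le_trans _ (sin_geN1 y))// lerN2 ltW.
  apply: (@le_trans _ _ 0); first by rewrite oppr_le0.
  by apply: sin_ge0_pi; rewrite y0 (le_trans y1)// (le_trans _ (pi_ge2 R))// ler1n.
by have [|] := leP 0 x => [/h//|x0]; rewrite -sqrrN -[leRHS]sqrrN -sinN h// oppr_ge0 ltW.
Qed.

Lemma mul_cos_le_sin x : 0 <= x -> x <= pi / 2 -> x * cos x <= sin x.
Proof.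
move=> x0 x1; rewrite -subr_ge0.
have d (y : R) : is_derive y 1 (fun y => sin y - y * cos y) (y * sin y).
  apply: (is_derive_eq (is_deriveB (is_derive_sin y) (is_deriveM (is_derive_id y 1) (is_derive_cos y)))).
  by rewrite /GRing.scale/=; ring.
have := @ger0_derive1_ndecr R (fun y => sin y - y * cos y) 0 x _ _ _ 0 x (lexx _) x0 (lexx _).
rewrite sin0 mul0r subr0; apply.
- by move=> y _; have [] := d y.
- move=> y; rewrite in_itv/= => /andP[y0 yx]; rewrite derive1E; have [_ ->] := d y.
  rewrite mulr_ge0 ?(ltW y0)// sin_ge0_pi// (ltW y0)/=.
  by rewrite (le_trans (ltW yx))// (le_trans x1)// ler_pdivrMr// ler_peMr ?pi_ge0// ler1n.
- by apply: continuous_subspaceT => y; exact: (is_derive_continuous (d y)).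
Qed.

(** Since 1 - cos(2 s x) = 2 sin^2(s x) <= 2 s^2 x^2 and x cos x <= sin x, the loss against s = 0 is
    at most 2 s^2 cos^(2m) x sin^2 x. The integral of cos^(2m) x sin^2 x is a difference of two
    consecutive integrals at s = 0, known from [cosint_rec]. *)
Lemma cosint_ge m s : cosint m.+1 0 * (1 - 2 * s ^+ 2 / (2 * m + 1)%:R) <= cosint m.+1 s.
Proof.
have n0 : (2 * m + 1)%:R != 0 :> R by rewrite pnatr_eq0 addn1.
have e : cosint m 0 - cosint m.+1 0 = cosint m.+1 0 / (2 * m + 1)%:R.
  have := cosint_rec m 0; rewrite expr0n subr0 natrM => h.
  have {h} : 2 * m.+1%:R * cosint m.+1 0 = (2 * m + 1)%:R * cosint m 0.
    have k0 : 2 * m.+1%:R != 0 :> R by rewrite mulf_neq0// pnatr_eq0.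
    by apply: (mulfI k0); rewrite [RHS]mulrA -h; ring.
  move=> h; have -> : cosint m 0 = 2 * m.+1%:R * cosint m.+1 0 / (2 * m + 1)%:R by rewrite h mulrC mulKf.
  by field.
have -> : cosint m.+1 0 * (1 - 2 * s ^+ 2 / (2 * m + 1)%:R) =
    cosint m.+1 0 - 2 * s ^+ 2 * (cosint m 0 - cosint m.+1 0) by rewrite e; ring.
rewrite lerBlDr -lerBlDl /cosint -JintB; [|exact: continuous_cosker..].
rewrite -JintB; [|exact: continuous_cosker..].
have cc t u : continuous (fun x => cosker t u x - cosker m.+1 s x).
  by move=> x; apply: cvgB; exact: continuous_cosker.
rewrite -JintZ; last by move=> x; apply: cvgB; exact: continuous_cosker.
apply: le_Jint.
- exact: cc.
- by apply: continuous_fctZ => x; apply: cvgB; exact: continuous_cosker.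
move=> x x0 x1; rewrite /cosker !mulr0 !mul0r cos0 !mulr1.
have -> : 2 * s * x = (s * x) *+ 2 by rewrite -mulrA mulr_natl.
rewrite cos_mulr2n.
have e2 : cos (s * x) ^+ 2 = 1 - sin (s * x) ^+ 2 by rewrite cos2sin2.
rewrite e2 (mulnS 2) (exprD _ 2) [cos x ^+ 2]expr2.
have c0 : 0 <= cos x ^+ (2 * m) by rewrite exprM exprn_ge0// sqr_ge0.
have -> : cos x * cos x * cos x ^+ (2 * m) - cos x * cos x * cos x ^+ (2 * m) *
  ((1 - sin (s * x) ^+ 2) *+ 2 - 1) =
  cos x ^+ (2 * m) * (2 * sin (s * x) ^+ 2 * cos x ^+ 2) by ring.
have -> : 2 * s ^+ 2 * (cos x ^+ (2 * m) - cos x * cos x * cos x ^+ (2 * m)) =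
  cos x ^+ (2 * m) * (2 * s ^+ 2 * (1 - cos x ^+ 2)) by ring.
apply: ler_wpM2l => //; rewrite -sin2cos2 -(mulrA 2) -(mulrA 2) ler_pM2l//.
apply: (@le_trans _ _ ((s * x) ^+ 2 * cos x ^+ 2)); first by apply: ler_wpM2r; [exact: sqr_ge0|exact: sqr_sin_le].
have -> : (s * x) ^+ 2 * cos x ^+ 2 = s ^+ 2 * (x * cos x) ^+ 2 by ring.
apply: ler_wpM2l; first exact: sqr_ge0.
rewrite lerXn2r ?nnegrE ?mul_cos_le_sin//.
  by rewrite mulr_ge0// cos_ge0_pihalf// x1 andbT (le_trans _ x0)// oppr_le0 ltW// pihalf_gt0.
by rewrite (le_trans _ (mul_cos_le_sin x0 x1))// mulr_ge0// cos_ge0_pihalf// x1 andbT (le_trans _ x0)// oppr_le0 ltW// pihalf_gt0.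
Qed.

End trig_integrals.

Lemma ltrN1_nat {R : numDomainType} k : -1 < k%:R :> R.
Proof. by apply: lt_le_trans (ler0n R k); rewrite ltrN10. Qed.

(** * Comparison of beta and cosine integrals *)

Section reflection.
Context {R : realType}.
Implicit Types s : R.

(* [F m s] and [cosint m s] satisfy inverse recurrences in [m], so that
   [F m s * cosint m s / (F m 0 * cosint m 0)] does not depend on [m]; it tends to 1. *)
Let F m s : R := betaR (m%:R - s) (m%:R + s).

Lemma betaR_diag_rec m s : 0 <= s < 1 ->
  (2 * m.+1)%:R * (2 * m + 3)%:R * F m.+1 s = (m.+1%:R ^+ 2 - s ^+ 2) * F m s.
Proof.
move=> /andP[s0 s1]; have m0 := ler0n R m.
have a1 : -1 < m%:R - s by lra.
have b1 : -1 < m%:R + s by lra.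
have a1' : -1 < m%:R - s + 1 by lra.
have := betaR_recl a1 b1; have := betaR_recr a1' b1.
have -> : m%:R - s + 1 = m.+1%:R - s by rewrite -natr1; ring.
have -> : m%:R + s + 1 = m.+1%:R + s by rewrite -natr1; ring.
have -> : m%:R - s + (m%:R + s) + 2 = (2 * m.+1)%:R by rewrite natrM -natr1; ring.
have -> : m.+1%:R - s + (m%:R + s) + 2 = (2 * m + 3)%:R by rewrite natrD natrM -natr1; ring.
rewrite -/(F m s) -/(F m.+1 s) => h1 h2.
rewrite -mulrA -h1 mulrCA -h2; ring.
Qed.

Lemma beta_cosint_rec m s : 0 <= s < 1 ->
  4 * (2 * m + 3)%:R * (F m.+1 s * cosint m.+1 s) = (2 * m + 1)%:R * (F m s * cosint m s).
Proof.
move=> s01; have h1 := betaR_diag_rec m s01; have h2 := cosint_rec m s.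
have k0 : (m.+1%:R ^+ 2 - s ^+ 2) != 0 :> R.
  move: s01 => /andP[s0 s1]; rewrite subr_sqr; apply: mulf_neq0.
    by rewrite gt_eqF// subr_gt0; apply: (lt_le_trans s1); rewrite ler1n.
  by rewrite gt_eqF//; apply: ltr_wpDr.
have k1 : (2 * m.+1)%:R != 0 :> R by rewrite pnatr_eq0.
apply: (mulfI k0); apply: (mulfI k1).
transitivity ((2 * m.+1)%:R * (2 * m + 3)%:R * F m.+1 s *
  (4 * (m.+1%:R ^+ 2 - s ^+ 2) * cosint m.+1 s)); first by ring.
by rewrite h1 h2; ring.
Qed.

Lemma beta_cosint_ratio m s : 0 <= s < 1 ->
  F m s * cosint m s * (pi / 2) = F 0 s * cosint 0 s * (F m 0 * cosint m 0).
Proof.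
move=> s01; have z01 : (0 : R) <= 0 < (1 : R) by rewrite lexx ltr01.
elim: m => [|m IH]; first by rewrite cosint00 /F mulr0n subr0 addr0 betaR00 mul1r.
have k0 : 4 * (2 * m + 3)%:R != 0 :> R by rewrite mulf_neq0// pnatr_eq0 addn3.
have h1 := beta_cosint_rec m s01; have h2 := beta_cosint_rec m z01.
apply: (mulfI k0).
transitivity (4 * (2 * m + 3)%:R * (F m.+1 s * cosint m.+1 s) * (pi / 2)); first by ring.
transitivity (F 0 s * cosint 0 s * (4 * (2 * m + 3)%:R * (F m.+1 0 * cosint m.+1 0)));
  last by ring.
rewrite h1 h2; transitivity ((2 * m + 1)%:R * (F m s * cosint m s * (pi / 2))); first by ring.
by rewrite IH; ring.
Qed.

Lemma betaR_diag_gt0 m : 0 < F m 0.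
Proof.
have z01 : (0 : R) <= 0 < (1 : R) by rewrite lexx ltr01.
elim: m => [|m IH]; first by rewrite /F mulr0n subr0 addr0 betaR00.
have := betaR_diag_rec m z01; rewrite expr0n subr0 => e.
have : 0 < (2 * m.+1)%:R * (2 * m + 3)%:R * F m.+1 0 by rewrite e mulr_gt0// exprn_gt0.
by rewrite pmulr_rgt0// mulr_gt0// ltr0n addn3.
Qed.

Lemma I01_beta_comb (a b c d k l : R) : 0 <= k -> 0 <= l ->
  I01 (fun t : R => k * (t `^ a * (1 - t) `^ b) + l * (t `^ c * (1 - t) `^ d)) =
  (k%:E * beta01 a b + l%:E * beta01 c d)%E.
Proof.
move=> k0 l0; rewrite -!beta01Z// -I01D//; try by cont01_tac.
  by move=> *; exact: (mulr_ge0 k0 (beta01_integrand_ge0 _ _ _)).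
by move=> *; exact: (mulr_ge0 l0 (beta01_integrand_ge0 _ _ _)).
Qed.

Lemma I01_diag_comb m (k l : R) : 0 <= k -> 0 <= l ->
  I01 (fun t : R => k * (t `^ (m.+1%:R) * (1 - t) `^ (m.+1%:R)) +
     l * (t `^ (m%:R) * (1 - t) `^ (m.+2%:R))) =
  ((k + l * (m.+2%:R / m.+1%:R)) * F m.+1 0)%:E.
Proof.
move=> k0 l0; rewrite I01_beta_comb// !betaRE; [|by rewrite ltrN1_nat..].
rewrite -!EFinM -EFinD /F subr0 addr0; congr (_%:E).
have := @betaR_rec R m%:R m.+1%:R; rewrite !natr1 => h.
have {}h : m.+1%:R * betaR m%:R m.+2%:R = m.+2%:R * betaR m.+1%:R m.+1%:R :> R.
  by apply: h; rewrite ltrN1_nat.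
have -> : betaR m%:R m.+2%:R = m.+2%:R / m.+1%:R * betaR m.+1%:R m.+1%:R :> R.
  have m0 : m.+1%:R != 0 :> R by rewrite pnatr_eq0.
  by apply: (mulfI m0); rewrite h [RHS]mulrA [m.+1%:R * _]mulrC divfK.
by ring.
Qed.

(** Write the integrand as its value at s = 0 times ((1 - t) / t)^s and bound this power by
    Bernoulli. Both resulting integrals are multiples of [F m.+1 0] by [I01_diag_comb]. *)
Lemma betaR_diag_le m s : 0 <= s < 1 -> F m.+1 s <= F m.+1 0 * (1 + s / m.+1%:R).
Proof.
move=> /andP[s0 s1]; have m0 := ler0n R m.
rewrite -lee_fin.
have -> : (F m.+1 0 * (1 + s / m.+1%:R))%:E =
    I01 (fun t : R => (1 - s) * (t `^ (m.+1%:R) * (1 - t) `^ (m.+1%:R)) +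
     s * (t `^ (m%:R) * (1 - t) `^ (m.+2%:R))).
  rewrite I01_diag_comb// ?subr_ge0 ?(ltW s1)//; congr (_%:E).
  by rewrite mulrC; congr (_ * _); rewrite -!natr1; field.
rewrite /F -betaRE; [|by rewrite -natr1; lra..].
apply: le_I01; [exact: beta01_cont|by cont01_tac|].
move=> t t0 t1; rewrite beta01_integrand_ge0/=.
have y0 : 0 < (1 - t) / t by rewrite divr_gt0.
have := @powR_le_Bernoulli _ ((1 - t) / t) s y0; rewrite s0 (ltW s1) => /(_ isT) B.
have k0 : 0 <= t `^ m.+1%:R * (1 - t) `^ m.+1%:R by exact: beta01_integrand_ge0.
have := ler_wpM2l k0 B.
have -> : t `^ m.+1%:R * (1 - t) `^ m.+1%:R * ((1 - t) / t) `^ s =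
    t `^ (m.+1%:R - s) * (1 - t) `^ (m.+1%:R + s).
  rewrite powRM ?(ltW t1) ?invr_ge0 ?(ltW t0)// -powR_inv1 ?(ltW t0)// -powRrM mulN1r.
  rewrite !(@powRD _ _ m.+1%:R); [|by rewrite (gt_eqF t1) implybT|by rewrite (gt_eqF t0) implybT].
  by ring.
move=> /le_trans; apply; rewrite le_eqVlt; apply/orP; left; apply/eqP.
rewrite -!natr1 !powRD1//; field; by rewrite gt_eqF.
Qed.

Lemma betaR_diag_ge m s : 0 <= s < 1 -> F m.+1 0 * (1 - s / m.+1%:R) <= F m.+1 s.
Proof.
move=> /andP[s0 s1]; have m0 := ler0n R m.
have am : -1 < m.+1%:R - s by rewrite -natr1; lra.
have bm : -1 < m.+1%:R + s by rewrite -natr1; lra.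
(* Here the factor is (t / (1 - t))^(-s), bounded below by [powRN_ge_Bernoulli]; the negative term
   of that bound goes to the right-hand side, so that both integrands are nonnegative. *)
have key : (((1 + s) * F m.+1 0)%:E <= I01 (fun t : R => 1 * (t `^ (m.+1%:R - s) * (1 - t) `^ (m.+1%:R + s)) +
     s * (t `^ (m.+2%:R) * (1 - t) `^ (m%:R)))%R)%E.
  have -> : ((1 + s) * F m.+1 0)%:E = I01 (fun t : R => (1 + s) * (t `^ (m.+1%:R) * (1 - t) `^ (m.+1%:R))).
    by rewrite beta01Z ?addr_ge0// /F subr0 addr0 betaRE// ltrN1_nat.
  apply: le_I01; [by cont01_tac..|].
  move=> t t0 t1; rewrite mulr_ge0 ?beta01_integrand_ge0 ?addr_ge0//=.
  have y0 : 0 < t / (1 - t) by rewrite divr_gt0.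
  have B := @powRN_ge_Bernoulli _ (t / (1 - t)) s y0 s0.
  have k0 : 0 <= t `^ m.+1%:R * (1 - t) `^ m.+1%:R by exact: beta01_integrand_ge0.
  have := ler_wpM2l k0 B.
  have -> : t `^ m.+1%:R * (1 - t) `^ m.+1%:R * (t / (1 - t)) `^ (- s) =
      t `^ (m.+1%:R - s) * (1 - t) `^ (m.+1%:R + s).
    rewrite powRM ?(ltW t0) ?invr_ge0 ?(ltW t1)// -(powR_inv1 (ltW t1)) -powRrM mulN1r opprK.
    rewrite !(@powRD _ _ m.+1%:R); [|by rewrite (gt_eqF t1) implybT|by rewrite (gt_eqF t0) implybT].
    by ring.
  rewrite mul1r => H; rewrite -lerBlDr; apply: le_trans H.
  rewrite le_eqVlt; apply/orP; left; apply/eqP.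
  rewrite -!natr1 !powRD1//; field; by rewrite gt_eqF.
move: key; rewrite I01_beta_comb// (beta01C m.+2%:R) mul1e.
rewrite !betaRE//; [|by rewrite ltrN1_nat..].
rewrite -EFinM -EFinD lee_fin -/(F m.+1 s).
have := @betaR_rec R m%:R m.+1%:R; rewrite !natr1 => h.
have {}h : m.+1%:R * betaR m%:R m.+2%:R = m.+2%:R * F m.+1 0 :> R.
  by rewrite /F subr0 addr0; apply: h; rewrite ltrN1_nat.
have -> : betaR m%:R m.+2%:R = m.+2%:R / m.+1%:R * F m.+1 0 :> R.
  have m1 : m.+1%:R != 0 :> R by rewrite pnatr_eq0.
  by apply: (mulfI m1); rewrite h [RHS]mulrA [m.+1%:R * _]mulrC divfK.
rewrite -lerBlDr; apply: le_trans; rewrite le_eqVlt; apply/orP; left; apply/eqP.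
by rewrite -(natr1 m.+1); field.
Qed.

Lemma betaR_reflection s : 0 < s < 1 -> betaR (- s) s = pi * s / sin (pi * s).
Proof.
move=> /andP[s0 s1]; have s01 : 0 <= s < 1 by rewrite (ltW s0).
have sn0 : 0 < sin (pi * s).
  by rewrite sin_gt0_pi// mulr_gt0 ?pi_gt0//= gtr_pMr ?pi_gt0.
have p2 := @pihalf_gt0 R.
pose P : R := F 0 s * cosint 0 s.
pose T := P / (pi / 2).
have TE m : F m s * cosint m s = T * (F m 0 * cosint m 0).
  have k0 : pi / 2 != 0 :> R by rewrite gt_eqF.
  apply: (mulIf k0); rewrite beta_cosint_ratio// -/P /T.
  by rewrite [RHS]mulrAC (divfK k0).
(* [T] does not depend on m, so a bound tending to 0 forces T = 1. Of the constant 3, the beta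
   estimates account for 1 and the cosine estimate for 2. *)
have bd m : `|T - 1| <= 3 / m.+2%:R.
  have F0 := betaR_diag_gt0 m.+2; have C0 := @cosint_gt0 R m.+2.
  have Fle := betaR_diag_le m.+1 s01; have Fge := betaR_diag_ge m.+1 s01.
  have Cle := cosint_le m.+2 s; have Cge := cosint_ge m.+1 s.
  have N0 : 0 < m.+2%:R :> R by [].
  have sN : s / m.+2%:R <= 1 / m.+2%:R by rewrite ler_pM2r ?invr_gt0// ltW.
  have sN0 : 0 <= s / m.+2%:R by rewrite divr_ge0// ltW.
  have N1 : 1 / m.+2%:R <= 1 / 2 :> R by rewrite ler_pM2l// lef_pV2 ?posrE// ler_nat.
  have s2 : s ^+ 2 <= 1 by rewrite exprn_ile1// ltW.
  have q0 : 0 <= 2 * s ^+ 2 / (2 * m.+1 + 1)%:R by rewrite divr_ge0// mulr_ge0// sqr_ge0.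
  have qN : 2 * s ^+ 2 / (2 * m.+1 + 1)%:R <= 2 * (1 / m.+2%:R).
    rewrite -mulrA; apply: ler_wpM2l => //; apply: ler_pM => //; first exact: sqr_ge0.
    rewrite lef_pV2 ?posrE ?ltr0n ?addn1// ler_nat.
    by rewrite mul2n -addnn -addnS leq_addl.
  rewrite ler_norml; apply/andP; split.
    rewrite -lerBlDr opprK.
    have H : (1 - s / m.+2%:R) * (1 - 2 * s ^+ 2 / (2 * m.+1 + 1)%:R) <= T.
      rewrite -(ler_pM2r (mulr_gt0 F0 C0)) -TE.
      have -> : forall u v a b : R, u * v * (a * b) = (a * u) * (b * v) by move=> *; ring.
      apply: ler_pM => //; apply: mulr_ge0; try exact: ltW.
        by rewrite subr_ge0 (le_trans sN)// (le_trans N1)// ler_pdivrMr// mul1r ler1n.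
      move: (2 * s ^+ 2 / _) (1 / m.+2%:R) qN N1 => u v qN N1; lra.
    apply: le_trans H.
    have -> : 3 / m.+2%:R = 3 * (1 / m.+2%:R) :> R by rewrite mulrA mulr1.
    move: (s / m.+2%:R) (1 / m.+2%:R) (2 * s ^+ 2 / _) sN sN0 N1 q0 qN => u v w *.
    rewrite -subr_ge0; have : 0 <= u * w by rewrite mulr_ge0.
    by nra.
  rewrite lerBlDr; apply: (@le_trans _ _ (1 + s / m.+2%:R)).
    rewrite -(ler_pM2r (mulr_gt0 F0 C0)) -TE.
    have -> : forall u a b : R, u * (a * b) = (a * u) * b by move=> *; ring.
    apply: (@le_trans _ _ (F m.+2 s * cosint m.+2 0)).
      by apply: ler_wpM2l => //; exact: betaR_ge0.
    by rewrite ler_pM2r.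
  rewrite addrC lerD2r (le_trans sN)// ler_pM2r ?invr_gt0// ler1n//.
have T1 : T = 1.
  apply/eqP; rewrite -subr_eq0 -normr_le0 leNgt; apply/negP => e0.
  have := archi_boundP (ltW (divr_gt0 (ltr0n R 3) e0)).
  move: (Num.bound _) => N; rewrite ltr_pdivrMr// => hN.
  have := bd N; rewrite ler_pdivlMr// leNgt => /negP; apply.
  rewrite mulrC; apply: (lt_le_trans hN); rewrite ler_pM2r// ler_nat.
  by do 2 apply: leqW.
have pn : pi / 2 != 0 :> R by rewrite gt_eqF.
have : P = pi / 2 by rewrite -(divfK pn P) -/T T1 mul1r.
rewrite /P cosint0 ?gt_eqF// /F mulr0n sub0r add0r => h.
have e : betaR (- s) s * sin (pi * s) = pi * s.
  transitivity ((pi / 2) * (2 * s)); last by field.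
  by rewrite -h; field; rewrite gt_eqF.
by rewrite -[X in X / _]e mulfK// gt_eqF.
Qed.

(** By [rec], [gconst m s] is (m + 1 + s) / (m + 1) times the constant of the next lower dimension;
    the chain ends at B(1 - s, 1 + s), the reflection formula. *)
Lemma gconstE m s : 0 < s < 1 ->
  gconst m s = (\prod_(1 <= k < m.+2) (1 + s / k%:R)) * (pi * s / sin (pi * s)).
Proof.
move=> s01; rewrite -(betaR_reflection s01); have /andP[s0 s1] := s01.
rewrite /gconst.
have rec k : k.+2%:R * betaR (- s) (k.+1%:R + s) = (k.+1%:R + s) * betaR (- s) (k%:R + s).
  have k0 := ler0n R k.
  have /betaR_recr h : -1 < - s by lra.
  have := h (k%:R + s); have -> : k%:R + s + 1 = k.+1%:R + s by rewrite -natr1; ring.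
  have -> : - s + (k%:R + s) + 2 = k.+2%:R by rewrite -!natr1; ring.
  by move=> ->//; lra.
have base : betaR (- s) s = 1%:R * betaR (- s) (0%:R + s) by rewrite mul1r add0r.
elim: m => [|m IH].
  rewrite big_nat1 rec base add0r mul1r; congr (_ * _); rewrite divr1//.
rewrite big_nat_recr; last by [].
rewrite mulrAC -IH rec.
have k0 : m.+2%:R != 0 :> R by rewrite pnatr_eq0.
by field.
Qed.

Lemma gconst_dual m s : gconst m (- (m.+1%:R + s)) = gconst m s.
Proof.
rewrite /gconst opprK; congr (_ * _).
have -> : m.+1%:R + - (m.+1%:R + s) = - s by ring.
by rewrite /betaR beta01C.
Qed.

End reflection.

(** * The radial density of the kernel *)

Section kappa.
Context {R : realType}.
Implicit Types a x t : R.

(* The sum of [(n + k) * 'C(n + k, n) * x ^+ k * t ^+ (n + k - 1)] over [k], with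
   [n = m.+1]: the density of [|w|^2] under [|1 - <z, w>|^(- 2n - 2) dv(w)] if [x = |z|^2]. *)
Definition kappa (m : nat) x t : R := t ^+ m * (m.+1%:R + x * t) / (1 - x * t) ^+ m.+3.

Lemma cont01_kappa m x : 0 <= x -> x <= 1 -> cont01 (kappa m x).
Proof.
move=> x0 x1; rewrite /kappa; cont01_tac.
by move=> t t0 t1; apply/exprn_gt0; exact: onem_mul_gt0.
Qed.

Lemma kappa_ge0 m x t : 0 <= x -> x <= 1 -> 0 < t -> 0 < 1 - t -> 0 <= kappa m x t.
Proof.
move=> x0 x1 t0 t1; have p := onem_mul_gt0 x0 x1 t0 t1.
by rewrite divr_ge0 ?exprn_ge0 ?(ltW p)// mulr_ge0 ?exprn_ge0 ?(ltW t0)// addr_ge0// mulr_ge0// ltW.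
Qed.

(** Under [mobius], the factor (1 - t)^(-a) contributes (1 - x)^(-a), the denominator of [kappa]
    contributes (1 - x)^(-(m+3)) and the Jacobian 1 - x. The rest is [gker]. *)
Lemma I01_kappa m a x : 0 <= x < 1 ->
  I01 (fun t => (1 - t) `^ (- a) * kappa m x t) =
  (((1 - x) `^ (- (m.+2%:R + a)))%:E * I01 (gker m a x))%E.
Proof.
move=> x01; have /andP[x0 x1] := x01; have x1' := ltW x1.
have q0 : 0 < 1 - x by rewrite subr_gt0.
rewrite -I01Z ?powR_ge0//; last 2 first.
  exact: cont01_gker.
  by move=> *; exact: gker_ge0.
rewrite (I01_mobius x01).
- apply: eq_I01 => t t0 t1; have p := onem_mul_gt0 x0 x1' t0 t1.
  rewrite /kappa /gker onem_mobius// onem_mul_mobius// /mobius.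
  have qn : 1 - x != 0 by rewrite gt_eqF.
  have pn : 1 - x * t != 0 by rewrite gt_eqF.
  have -> : (t * (1 - x) / (1 - x * t)) `^ (- a) = t `^ (- a) * (1 - x) `^ (- a) * (1 - x * t) `^ a.
    rewrite powRM ?invr_ge0 ?mulr_ge0 ?(ltW t0) ?(ltW q0) ?(ltW p)//.
    rewrite powRM ?(ltW t0) ?(ltW q0)//.
    by rewrite -(powR_inv1 (ltW p)) -powRrM mulN1r opprK.
  have -> : (1 - x) `^ (- (m.+2%:R + a)) = (1 - x) `^ (- a) / (1 - x) ^+ m.+2.
    have -> : - (m.+2%:R + a) = - a + - m.+2%:R by ring.
    rewrite powRD; last by rewrite (gt_eqF q0) implybT.
    by rewrite (powRN _ m.+2%:R) powR_mulrn ?(ltW q0).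
  rewrite !expr_div_n !exprS.
  by field; rewrite qn pn !expf_neq0.
- by apply: cont01M; [cont01_tac|exact: cont01_kappa].
- by move=> t t0 t1; rewrite mulr_ge0 ?powR_ge0// kappa_ge0.
Qed.

End kappa.

(** * Integrals over C^n *)

Section image_measure.
Context d1 d2 (T1 : measurableType d1) (T2 : measurableType d2) (R : realType).
Variables (mu : {measure set T1 -> \bar R}) (f : T1 -> T2).

(** In contrast to [pushforward_iso] it accepts maps that are not injective, such as [sqn]. The
    measurability proof is a parameter so that the measure structure can be inferred from it. *)
Definition image_measure of measurable_fun setT f : set T2 -> \bar R := pushforward mu f.

Variable mf : measurable_fun setT f.
Local Notation nu := (image_measure mf).

Let nu0 : nu set0 = 0%E.
Proof. by rewrite /image_measure /pushforward preimage_set0 measure0. Qed.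

Let nu_ge0 A : (0 <= nu A)%E. Proof. exact: measure_ge0. Qed.

Let nu_sigma_additive : semi_sigma_additive nu.
Proof.
move=> F mF tF mUF; rewrite /image_measure /pushforward preimage_bigcup.
apply: measure_semi_sigma_additive.
- by move=> n; rewrite -[X in measurable X]setTI; exact: mf.
- apply/trivIsetP => /= i j _ _ ij; rewrite -preimage_setI.
  by move/trivIsetP : tF => /(_ _ _ _ _ ij) ->//; rewrite preimage_set0.
- by rewrite -preimage_bigcup -[X in measurable X]setTI; exact: mf.
Qed.

HB.instance Definition _ := isMeasure.Build _ _ _ nu nu0 nu_ge0 nu_sigma_additive.

Lemma ge0_integral_image_measure (g : T2 -> \bar R) : measurable_fun setT g ->
  (forall y, 0 <= g y)%E -> (\int[nu]_y g y = \int[mu]_x g (f x))%E.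
Proof.
move=> mg g0; have := @ge0_integral_pushforward _ _ _ _ _ _ mf mu setT g measurableT mg.
by rewrite preimage_setT => <-.
Qed.

End image_measure.

(** * Affine changes of variable on the line *)

Section affine_lebesgue.
Context {R : realType}.
Local Notation mu := (@lebesgue_measure R).

Lemma measurable_affine (k c : R) :
  measurable_fun setT (fun x : measurableTypeR R => k * x + c : measurableTypeR R).
Proof. by apply: measurable_funD => //; exact: measurable_funM. Qed.

Lemma lebesgue_measure_affine (k c : R) (A : set (measurableTypeR R)) (k0 : 0 < k) : measurable A ->
  mu A = mscale (NngNum (ltW k0)) (image_measure mu (measurable_affine k c)) A.
Proof.
move=> mA; apply: lebesgue_measure_unique => // X [[a b] _ <-].
change (mu `]a, b] = k%:E * mu ((fun x : R => k * x + c)%R @^-1` `]a, b]))%E.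
have -> : (fun x : R => k * x + c) @^-1` `]a, b] = `](a - c) / k, (b - c) / k]%classic.
  apply/seteqP; split=> x /=; rewrite !in_itv/= ltr_pdivrMr// ler_pdivlMr// ltrBlDr lerBrDr mulrC//.
rewrite !lebesgue_measure_itv/= !lte_fin ltr_pM2r ?invr_gt0// ltrD2r.
case: ifPn => // _; last by rewrite mule0.
by rewrite -!EFinD -EFinM; congr (_%:E); field; rewrite gt_eqF.
Qed.

Lemma ge0_integral_affine (k c : R) (f : R -> \bar R) : 0 < k -> measurable_fun setT f ->
  (forall x, 0 <= f x)%E -> (\int[mu]_x f x = k%:E * \int[mu]_x f (k * x + c)%R)%E.
Proof.
move=> k0 mf f0.
rewrite (eq_measure_integral (mscale (NngNum (ltW k0)) (image_measure mu (measurable_affine k c)))).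
  by rewrite ge0_integral_mscale// ge0_integral_image_measure.
by move=> A mA _; exact: lebesgue_measure_affine.
Qed.

Lemma ge0_integral_translation (c : R) (f : R -> \bar R) : measurable_fun setT f ->
  (forall x, 0 <= f x)%E -> (\int[mu]_x f (x + c)%R = \int[mu]_x f x)%E.
Proof.
move=> mf f0; rewrite [RHS](@ge0_integral_affine 1 c)// mul1e.
by under [RHS]eq_integral do rewrite mul1r.
Qed.

End affine_lebesgue.

Section tonelli.
Context d1 d2 (T1 : measurableType d1) (T2 : measurableType d2) (R : realType).
Variables (m1 : {sigma_finite_measure set T1 -> \bar R}) (m2 : {sigma_finite_measure set T2 -> \bar R}).
Variable f : T1 * T2 -> \bar R.
Hypotheses (mf : measurable_fun setT f) (f0 : forall z, (0 <= f z)%E).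

Lemma prod_measure_tonelli1 :
  (\int[prod_measure m1 m2]_z f z = \int[m1]_x \int[m2]_y f (x, y))%E.
Proof. exact: fubini_tonelli1. Qed.

Lemma prod_measure_tonelli2 :
  (\int[prod_measure m1 m2]_z f z = \int[m2]_y \int[m1]_x f (x, y))%E.
Proof. by rewrite prod_measure_tonelli1; exact: fubini_tonelli. Qed.

End tonelli.

(** * Rotations of the complex plane *)

Section complex_lebesgue.
Context {R : realType}.
Local Notation mu := (@lebesgue_measure R).
Local Notation mu2 := (prod_measure mu mu).
Implicit Types (g : measurableTypeR R * measurableTypeR R -> \bar R) (f : R[i] -> \bar R).

Lemma ge0_integral_shear1 (a : R) g : measurable_fun setT g -> (forall z, 0 <= g z)%E ->
  (\int[mu2]_z g (z.1 + a * z.2, z.2)%R = \int[mu2]_z g z)%E.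
Proof.
move=> mg g0.
have ms : measurable_fun setT (fun z : measurableTypeR R * measurableTypeR R =>
   (z.1 + a * z.2, z.2) : measurableTypeR R * measurableTypeR R).
  apply: measurable_fun_pair => //; apply: measurable_funD => //.
  by apply: measurable_funM.
rewrite prod_measure_tonelli2//; last exact: measurableT_comp.
rewrite [RHS]prod_measure_tonelli2//; apply: eq_integral => y _ /=.
apply: (@ge0_integral_translation _ (a * y) (fun x => g (x, y))) => //.
exact: measurableT_comp.
Qed.

Lemma ge0_integral_shear2 (a : R) g : measurable_fun setT g -> (forall z, 0 <= g z)%E ->
  (\int[mu2]_z g (z.1, z.2 + a * z.1)%R = \int[mu2]_z g z)%E.
Proof.
move=> mg g0.
have ms : measurable_fun setT (fun z : measurableTypeR R * measurableTypeR R =>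
   (z.1, z.2 + a * z.1) : measurableTypeR R * measurableTypeR R).
  apply: measurable_fun_pair => //; apply: measurable_funD => //.
  by apply: measurable_funM.
rewrite prod_measure_tonelli1//; last exact: measurableT_comp.
rewrite [RHS]prod_measure_tonelli1//; apply: eq_integral => x _ /=.
apply: (@ge0_integral_translation _ (a * x) (fun y => g (x, y))) => //.
exact: measurableT_comp.
Qed.

(* A rotation is a product of three shears, the half-turn [c = -1] excepted. *)
Lemma ge0_integral_rotation2 (c s : R) g : c ^+ 2 + s ^+ 2 = 1 -> c != -1 ->
  measurable_fun setT g -> (forall z, 0 <= g z)%E ->
  (\int[mu2]_z g (c * z.1 - s * z.2, s * z.1 + c * z.2)%R = \int[mu2]_z g z)%E.
Proof.
(* The tangent of the half-angle: the shears with coefficients - t, s, - t compose to the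
   rotation. *)
move=> cs c1 mg g0; pose t := s / (1 + c).
have c1' : 1 + c != 0 by rewrite addrC addr_eq0.
have m1 a h : measurable_fun setT h -> measurable_fun setT
    (fun z : measurableTypeR R * measurableTypeR R => h (z.1 + a * z.2, z.2) : \bar R).
  move=> mh; apply: measurableT_comp => //; apply: measurable_fun_pair => //.
  by apply: measurable_funD => //; apply: measurable_funM.
have m2 a h : measurable_fun setT h -> measurable_fun setT
    (fun z : measurableTypeR R * measurableTypeR R => h (z.1, z.2 + a * z.1) : \bar R).
  move=> mh; apply: measurableT_comp => //; apply: measurable_fun_pair => //.
  by apply: measurable_funD => //; apply: measurable_funM.
have := ge0_integral_shear1 (- t) mg g0.
have := ge0_integral_shear2 s (m1 (- t) _ mg) (fun z => g0 _).
have := ge0_integral_shear1 (- t) (m2 s _ (m1 (- t) _ mg)) (fun z => g0 _).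
move=> /= h1 h2 h3; rewrite -h3 -h2 -h1; apply: eq_integral => -[x y] _ /=.
have st : s * t = 1 - c.
  apply: (mulIf c1'); rewrite /t mulrA divfK//.
  have -> : s * s = 1 - c ^+ 2 by rewrite -cs; ring.
  by ring.
have tc : t * (1 + c) = s by rewrite /t divfK.
have e : s * (x + - t * y) = s * x - (1 - c) * y by rewrite -st; ring.
congr (g (_, _)); last by rewrite e; ring.
transitivity ((1 - s * t) * x - (t * (1 + c)) * y); first by rewrite st tc; ring.
by rewrite e; ring.
Qed.

Lemma integral_complexE f : measurable_fun setT f -> (forall w, 0 <= f w)%E ->
  (\int[lebesgue_complex R]_w f w = \int[mu2]_z f (z.1 +i* z.2)%C)%E.
Proof.
move=> mf f0.
rewrite (eq_measure_integral (image_measure mu2 (@measurable_complex_of_pair R))); last by [].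
by rewrite ge0_integral_image_measure.
Qed.

Lemma measurable_complexP d (T : measurableType d) (h : T -> R[i]) :
  measurable_fun setT (fun t => complex.Re (h t)) -> measurable_fun setT (fun t => complex.Im (h t)) ->
  measurable_fun setT h.
Proof.
move=> mr mi; have -> : h = @complex_of_pair R \o (fun t => (complex.Re (h t), complex.Im (h t))).
  by apply/funext => t /=; rewrite /complex_of_pair/=; case: (h t).
apply: (measurableT_comp (@measurable_complex_of_pair R)).
exact: measurable_fun_pair.
Qed.

Lemma measurable_mulC d (T : measurableType d) (h k : T -> R[i]) :
  measurable_fun setT h -> measurable_fun setT k -> measurable_fun setT (fun t => h t * k t).
Proof.
move=> mh mk.
have [hr hi] := (measurableT_comp (@measurable_complexRe R) mh, measurableT_comp (@measurable_complexIm R) mh).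
have [kr ki] := (measurableT_comp (@measurable_complexRe R) mk, measurableT_comp (@measurable_complexIm R) mk).
apply: measurable_complexP.
  have -> : (fun t => complex.Re (h t * k t)) = (fun t => complex.Re (h t) * complex.Re (k t) -
    complex.Im (h t) * complex.Im (k t)).
    by apply/funext => t; case: (h t) => a b; case: (k t).
  by apply: measurable_funB; exact: measurable_funM.
have -> : (fun t => complex.Im (h t * k t)) = (fun t => complex.Re (h t) * complex.Im (k t) +
    complex.Im (h t) * complex.Re (k t)).
  by apply/funext => t; case: (h t) => a b; case: (k t).
by apply: measurable_funD; exact: measurable_funM.
Qed.

Lemma measurable_addC d (T : measurableType d) (h k : T -> R[i]) :
  measurable_fun setT h -> measurable_fun setT k -> measurable_fun setT (fun t => h t + k t).
Proof.
move=> mh mk.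
have [hr hi] := (measurableT_comp (@measurable_complexRe R) mh, measurableT_comp (@measurable_complexIm R) mh).
have [kr ki] := (measurableT_comp (@measurable_complexRe R) mk, measurableT_comp (@measurable_complexIm R) mk).
apply: measurable_complexP.
  have -> : (fun t => complex.Re (h t + k t)) = (fun t => complex.Re (h t) + complex.Re (k t)).
    by apply/funext => t; case: (h t) => a b; case: (k t).
  exact: measurable_funD.
have -> : (fun t => complex.Im (h t + k t)) = (fun t => complex.Im (h t) + complex.Im (k t)).
  by apply/funext => t; case: (h t) => a b; case: (k t).
exact: measurable_funD.
Qed.

Lemma ge0_integral_rotation (u : R[i]) f : complex.Re u ^+ 2 + complex.Im u ^+ 2 = 1 ->
  complex.Re u != -1 -> measurable_fun setT f -> (forall w, 0 <= f w)%E ->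
  (\int[lebesgue_complex R]_w f (u * w)%R = \int[lebesgue_complex R]_w f w)%E.
Proof.
case: u => c s /= cs c1 mf f0.
have mr : measurable_fun setT (fun w => f ((c +i* s)%C * w)).
  by apply: measurableT_comp => //; apply: measurable_mulC => //; exact: measurable_cst.
rewrite !integral_complexE//.
rewrite -[RHS](ge0_integral_rotation2 cs c1)//.
  apply: eq_integral => -[x y] _ /=; congr (f _).
  by apply/eqP; rewrite eq_complex/= eqxx/= addrC eqxx.
exact: (measurableT_comp mf (@measurable_complex_of_pair R)).
Qed.

End complex_lebesgue.

(** * Radial integrals in the plane *)

Section radial.
Context {R : realType}.
Local Notation mu := (@lebesgue_measure R).
Local Notation mu2 := (prod_measure mu mu).
Local Notation muC := (lebesgue_complex R).

(** The squared modulus is preferred to the modulus: the area of a disc is linear in the squared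
    radius, so the image of planar Lebesgue measure is a multiple of Lebesgue measure on the
    half-line, with no density to carry along. *)
Definition sqn (w : R[i]) : R := complex.Re w ^+ 2 + complex.Im w ^+ 2.

Lemma sqn_ge0 w : 0 <= sqn w.
Proof. by rewrite addr_ge0// sqr_ge0. Qed.

Lemma measurable_sqn : measurable_fun setT sqn.
Proof.
apply: measurable_funD; apply: measurable_funX.
- exact: measurable_complexRe.
- exact: measurable_complexIm.
Qed.

Let disc (r : R) : set R[i] := sqn @^-1` `]-oo, r].

Let measurable_disc r : measurable (disc r).
Proof. by rewrite -[X in measurable X]setTI; exact: measurable_sqn. Qed.

Let square (c : R) : set R[i] := [set w | `[-c, c]%classic (complex.Re w) /\ `[-c, c]%classic (complex.Im w)].

Let measurable_square c : measurable (square c).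
Proof.
have -> : square c = @pair_of_complex R @^-1` (`[-c, c] `*` `[-c, c]) by [].
rewrite -[X in measurable X]setTI; apply: measurable_pair_of_complex => //.
exact: measurableX.
Qed.

Let lebesgue_square c : 0 <= c -> muC (square c) = ((2 * c) ^+ 2)%:E.
Proof.
move=> c0; transitivity (mu2 (`[-c, c] `*` `[-c, c])); first by [].
rewrite /prod_measure product_measure1E//= lebesgue_measure_itv/= lte_fin.
case: ifPn => [cc|].
  by rewrite -EFinD -EFinM; congr (_%:E); ring.
rewrite -leNgt => h; have -> : c = 0 by apply/eqP; rewrite eq_le c0 andbT; lra.
by rewrite mulr0 mule0 expr0n.
Qed.

(* Its value [pi] is not needed: it cancels in the normalization of [dv]. *)
Definition disc_area : R := fine (muC (disc 1)).

Let disc1E : muC (disc 1) = disc_area%:E.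
Proof.
rewrite fineK// ge0_fin_numE//; apply: (@le_lt_trans _ _ (muC (square 1))).
  apply: le_measure; rewrite ?inE//= => w; rewrite /disc/square/sqn/= !in_itv/= => h.
  have k (a : R) : a ^+ 2 <= 1 -> -1 <= a <= 1.
    by move=> a1; rewrite -ler_norml -(@ler_pXn2r _ 2)// ?nnegrE// real_normK ?num_real// expr1n.
  split; rewrite ?in_itv/=; apply: k; apply: le_trans h; rewrite ?lerDl ?lerDr sqr_ge0//.
by rewrite lebesgue_square// ltry.
Qed.

Lemma disc_area_gt0 : 0 < disc_area.
Proof.
rewrite -lte_fin -disc1E; apply: (@lt_le_trans _ _ (muC (square 2^-1))).
  by rewrite lebesgue_square// lte_fin exprn_gt0// mulfV.
apply: le_measure; rewrite ?inE//= => w; rewrite /disc/square/sqn/= !in_itv/= => -[h1 h2].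
have k (a : R) : -2^-1 <= a <= 2^-1 -> a ^+ 2 <= 2^-1.
  rewrite -ler_norml => h; rewrite -(real_normK (num_real a)) expr2.
  apply: (@le_trans _ _ (2^-1 * 1)); last by rewrite mulr1.
  apply: ler_pM => //; apply: (le_trans h); rewrite invf_le1// ler1n//.
have -> : 1 = 2^-1 + 2^-1 :> R by field.
by apply: lerD; apply: k.
Qed.

Lemma ge0_integral_scale2 (k : R) (g : measurableTypeR R * measurableTypeR R -> \bar R) :
  0 < k -> measurable_fun setT g -> (forall z, 0 <= g z)%E ->
  (\int[mu2]_z g z = (k ^+ 2)%:E * \int[mu2]_z g (k * z.1, k * z.2)%R)%E.
Proof.
move=> k0 mg g0.
have mk : measurable_fun setT (fun z : measurableTypeR R * measurableTypeR R =>
   (k * z.1, k * z.2) : measurableTypeR R * measurableTypeR R).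
  by apply: measurable_fun_pair; apply: measurable_funM.
have mk2 : measurable_fun setT (fun y : measurableTypeR R => k * y : measurableTypeR R).
  exact: measurable_funM.
rewrite prod_measure_tonelli1// [in RHS]prod_measure_tonelli1//; last exact: measurableT_comp.
pose G x : \bar R := (\int[mu]_y g (x, y))%E.
have mG : measurable_fun setT G by exact: measurable_fun_fubini_tonelli_F.
have G0 x : (0 <= G x)%E by exact: integral_ge0.
rewrite (@ge0_integral_affine _ k 0 G)// expr2 EFinM -muleA; congr (_ * _)%E.
rewrite -ge0_integralZl_EFin//; last 3 first.
- by move=> x _; exact: integral_ge0.
- apply: (@measurable_fun_fubini_tonelli_F _ _ _ _ _ mu (fun z => g (k * z.1, k * z.2)%R)) => //.
  exact: measurableT_comp.
- exact: ltW.
apply: eq_integral => x _; rewrite addr0 /G.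
rewrite (@ge0_integral_affine _ k 0 (fun y => g (k * x, y)%R))//; last exact: measurableT_comp.
by under [in LHS]eq_integral do rewrite addr0.
Qed.

Let disc_scale r : 0 < r -> muC (disc r) = (r * disc_area)%:E.
Proof.
(* Dilation by the square root of r multiplies both [sqn] and the area by r. *)
move=> r0; have k0 : 0 < Num.sqrt r by rewrite sqrtr_gt0.
have mi s : measurable_fun setT (fun w => (\1_(disc s) w)%:E : \bar R).
  by apply/measurable_EFinP; exact: measurable_indic.
have E s : muC (disc s) = (\int[mu2]_z (\1_(disc s) (z.1 +i* z.2)%C)%:E)%E.
  by rewrite -(@integral_complexE _ (fun w => (\1_(disc s) w)%:E))// integral_indic// setIT.
rewrite E (ge0_integral_scale2 k0); last 2 first.
- exact: (measurableT_comp (mi r) (@measurable_complex_of_pair R)).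
- by move=> z; rewrite lee_fin.
rewrite sqr_sqrtr ?(ltW r0)// EFinM -disc1E E; congr (_ * _)%E.
apply: eq_integral => -[x y] _ /=; congr (_%:E); rewrite !indicE; congr (_%:R).
congr nat_of_bool; apply: asbool_equiv_eq.
rewrite /disc /sqn /= !in_itv/= !exprMn -mulrDr sqr_sqrtr ?(ltW r0)//.
by rewrite -{2}(mulr1 r) ler_pM2l.
Qed.

Let disc0 : muC (disc 0) = 0%E.
Proof.
rewrite (_ : disc 0 = square 0); first by rewrite lebesgue_square// mulr0 expr0n.
apply/seteqP; split => w; rewrite /disc/square/sqn/= !in_itv/= oppr0.
  move=> h; have : complex.Re w ^+ 2 + complex.Im w ^+ 2 == 0 by rewrite eq_le h addr_ge0// sqr_ge0.
  by rewrite paddr_eq0 ?sqr_ge0// !sqrf_eq0 => /andP[/eqP-> /eqP->]; rewrite lexx.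
by move=> [h1 h2]; rewrite -!eq_le in h1 h2; rewrite -(eqP h1) -(eqP h2) expr0n addr0.
Qed.

Let nu : {measure set (measurableTypeR R) -> \bar R} :=
  image_measure muC (measurable_sqn : measurable_fun setT (sqn : R[i] -> measurableTypeR R)).

Let nu_itvNy r : nu `]-oo, r]%classic = (Num.max r 0 * disc_area)%:E.
Proof.
change (muC (disc r) = (Num.max r 0 * disc_area)%:E).
have [r0|r0|->] := ltgtP r 0.
- rewrite mul0r (_ : disc r = set0) ?measure0//; apply/seteqP; split => // w.
  rewrite /disc/= in_itv/= => wr; have := le_lt_trans (le_trans (sqn_ge0 w) wr) r0.
  by rewrite ltxx.
- exact: disc_scale.
- by rewrite mul0r disc0.
Qed.

Let nu_itv a b : a < b -> nu `]a, b]%classic = ((Num.max b 0 - Num.max a 0) * disc_area)%:E.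
Proof.
move=> ab; rewrite (_ : `]a, b]%classic = `]-oo, b]%classic `\` `]-oo, a]%classic); last first.
  apply/seteqP; split => x /=; rewrite !in_itv/=.
    by move=> /andP[ax ->]; split => //; apply/negP; rewrite -ltNge.
  by move=> [-> /negP]; rewrite -ltNge => ->.
have mI r : measurable (`]-oo, r]%classic : set (measurableTypeR R)) by exact: measurable_itv.
rewrite (measureD (mI b) (mI a)); last by apply: (le_lt_trans (y := (Num.max b 0 * disc_area)%:E)); [rewrite -nu_itvNy|exact: ltry].
rewrite (_ : `]-oo, b]%classic `&` `]-oo, a]%classic = `]-oo, a]%classic); last first.
  by apply: setIidr => x /=; rewrite !in_itv/= => /le_trans; apply; exact: ltW.
rewrite [X in (X - _)%E]nu_itvNy [X in (_ - X)%E]nu_itvNy -EFinB mulrBl//.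
Qed.

Let Vge0 : 0 <= disc_area^-1. Proof. by rewrite invr_ge0 ltW// disc_area_gt0. Qed.

Let mneg : measurable (`]-oo, 0]%classic : set (measurableTypeR R)).
Proof. exact: measurable_itv. Qed.

(* [nu] is [disc_area] times Lebesgue measure on the half-line; Lebesgue measure on the other
   half-line is added because [lebesgue_measure_unique] is about measures on the whole line. *)
Let lebesgue_decomposition A : measurable A ->
  mu A = measure_add (mscale (NngNum Vge0) nu) (mrestr mu mneg) A.
Proof.
move=> mA; apply: lebesgue_measure_unique => // X [[a b] _ <-].
refine (etrans _ (esym (measure_addE (mscale (NngNum Vge0) nu) (mrestr mu mneg) _))).
have [ab|ba] := ltP a b; last first.
  by rewrite set_itv_ge ?measure0 ?adde0// bnd_simp -leNgt.
change (mu `]a, b] = (disc_area^-1)%:E * nu `]a, b]%classic + mu (`]a, b] `&` `]-oo, (0 : R)%R]))%E.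
rewrite nu_itv// -EFinM mulrCA mulVf ?gt_eqF ?disc_area_gt0// mulr1.
have -> : `]a, b] `&` `]-oo, 0] = `]a, Num.min b 0]%classic.
  apply/seteqP; split => x /=; rewrite !in_itv/= le_min.
    by move=> [/andP[-> ->] ->].
  by move=> /and3P[-> -> ->].
rewrite !lebesgue_measure_itv/= !lte_fin ab lt_min ab/=.
rewrite /Num.max /Num.min.
case: (ltP a 0) => a0; case: (ltP b 0) => b0; rewrite -?EFinD; try (congr (_%:E)); try lra.
Qed.

Lemma ge0_integral_radial (g : R -> \bar R) : measurable_fun setT g -> (forall r, 0 <= g r)%E ->
  (\int[muC]_w g (sqn w) = disc_area%:E * \int[mu]_(r in `]0%R, +oo[) g r)%E.
Proof.
move=> mg g0.
have -> : (\int[muC]_w g (sqn w) = \int[nu]_y g y)%E.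
  exact/esym/(@ge0_integral_image_measure _ _ _ _ _ muC _
    (measurable_sqn : measurable_fun setT (sqn : R[i] -> measurableTypeR R)) g).
have TE : [set: R] = `]-oo, 0]%classic `|` `]0, +oo[%classic.
  by apply/seteqP; split => x //= _; rewrite !in_itv/= andbT; case: (leP x 0); [left|right].
have mi1 : measurable (`]-oo, 0]%classic : set (measurableTypeR R)) by exact: measurable_itv.
have mi2 : measurable (`]0, +oo[%classic : set (measurableTypeR R)) by exact: measurable_itv.
have mgS (A : set (measurableTypeR R)) : measurable_fun A (g : measurableTypeR R -> \bar R).
  exact: measurable_funS mg.
rewrite TE ge0_integral_setU//; last first.
  apply/disj_setPLR => x /=; rewrite !in_itv/= => x0.
  by rewrite andbT => /(le_lt_trans x0); rewrite ltxx.
rewrite [X in (X + _)%E](_ : _ = 0%E) ?add0e; last first.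
  apply: null_set_integral => //.
have V0 : 0 <= disc_area by exact: ltW disc_area_gt0.
rewrite (eq_measure_integral (mscale (NngNum V0) mu)); first by rewrite ge0_integral_mscale.
move=> A mA A0; have : mu A = (disc_area^-1%:E * nu A + mu (A `&` `]-oo, (0 : R)%R]))%E.
  exact: (etrans (lebesgue_decomposition mA) (measure_addE _ _ _)).
have -> : A `&` `]-oo, (0 : R)] = set0.
  apply/seteqP; split => // x [/A0 /=]; rewrite !in_itv/= andbT => x0 /(lt_le_trans x0).
  by rewrite ltxx.
rewrite measure0 adde0 => h.
change (nu A = disc_area%:E * mu A)%E.
by rewrite h muleA -EFinM mulfV ?mul1e// gt_eqF// disc_area_gt0.
Qed.

End radial.

(** * Roots of unity and a discrete Parseval identity *)

Section roots_of_unity.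
Context {R : realType}.
Implicit Types (z w : R[i]).

Lemma sqnE z : (sqn z)%:C%C = z * z^*%C.
Proof.
by case: z => a b; apply/eqP; rewrite eq_complex/= /sqn/= !expr2 mulrN opprK eqxx/= mulrN mulrC addrC subrr.
Qed.

Lemma sqnM z w : sqn (z * w) = sqn z * sqn w.
Proof. by case: z w => a b [c d]; rewrite /sqn/=; ring. Qed.

Lemma sqn1 : sqn (1 : R[i]) = 1.
Proof. by rewrite /sqn/= expr1n expr0n addr0. Qed.

Lemma sqnX z k : sqn (z ^+ k) = sqn z ^+ k.
Proof. by elim: k => [|k IH]; rewrite ?expr0 ?sqn1// !exprS sqnM IH. Qed.

Lemma sqn_conj z : sqn z^*%C = sqn z.
Proof. by case: z => a b; rewrite /sqn/= sqrrN. Qed.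

Definition cis (t : R) : R[i] := (cos t +i* sin t)%C.

Lemma cisD s t : cis (s + t) = cis s * cis t.
Proof. by apply/eqP; rewrite eq_complex/= cosD sinD eqxx/= addrC eqxx. Qed.

Lemma cis0 : cis 0 = 1.
Proof. by rewrite /cis cos0 sin0. Qed.

Lemma cisX t k : cis t ^+ k = cis (k%:R * t).
Proof.
elim: k => [|k IH]; first by rewrite mul0r cis0 expr0.
by rewrite exprS IH -cisD -natr1; congr cis; ring.
Qed.

Lemma sqn_cis t : sqn (cis t) = 1.
Proof. by rewrite /sqn/= cos2Dsin2. Qed.

Lemma cis_neq1 t : 0 < t < 2 * pi -> cis t != 1.
Proof.
move=> /andP[t0 t1]; apply/eqP => /(congr1 (@complex.Re R))/= c1.
have : 0 < sin (t / 2) by apply: sin_gt0_pi; rewrite divr_gt0//= ltr_pdivrMr// mulrC.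
have e : cos (t / 2 + t / 2) = 1 by rewrite -splitr.
move: e; rewrite cosD -!expr2 => e s0.
have := cos2Dsin2 (t / 2) => e2.
have : sin (t / 2) ^+ 2 == 0 by apply/eqP; lra.
by rewrite sqrf_eq0 gt_eqF.
Qed.

Lemma cis_conj t : (cis t)^*%C * cis t = 1.
Proof. by rewrite mulrC -sqnE sqn_cis. Qed.

Let N_gt0 N : (0 < N.+3%:R :> R). Proof. by []. Qed.

(* The order is at least 3 in order to exclude the half-turn. *)
Definition root1 N : R[i] := cis (2 * pi / N.+3%:R).

Lemma root1X N : root1 N ^+ N.+3 = 1.
Proof.
rewrite cisX mulrC divfK ?gt_eqF//.
by rewrite /cis mulr_natl cos2pi sin2pi.
Qed.

Lemma root1_neq1 N k : (0 < k < N.+3)%N -> root1 N ^+ k != 1.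
Proof.
move=> /andP[k0 kN]; rewrite cisX; apply: cis_neq1.
rewrite mulrA -(mulrC (2 * pi)) -mulrA; apply/andP; split.
  by rewrite !mulr_gt0 ?pi_gt0// ?divr_gt0 ?ltr0n.
by rewrite gtr_pMr ?mulr_gt0 ?pi_gt0// ltr_pdivrMr// mul1r ltr_nat.
Qed.

Lemma root1_inj N j k : (j < k)%N -> (k < N.+3)%N -> root1 N ^+ j != root1 N ^+ k.
Proof.
move=> jk kN; have u0 : root1 N ^+ j != 0.
  apply/eqP => /(congr1 (@sqn R)); rewrite sqnX sqn_cis expr1n /sqn/= expr0n addr0.
  by apply/eqP; rewrite oner_eq0.
rewrite -(subnK (ltnW jk)) exprD -[X in X != _]mul1r; apply: contraNneq (@root1_neq1 N (k - j) _).
  by move=> /(mulIf u0) <-.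
by rewrite subn_gt0 jk/= (leq_ltn_trans (leq_subr _ _)).
Qed.

Lemma sum_root1 N j k : (j < N.+3)%N -> (k < N.+3)%N ->
  \sum_(l < N.+3) (root1 N ^+ j * (root1 N)^*%C ^+ k) ^+ l = if j == k then N.+3%:R else 0.
Proof.
move=> jN kN; case: eqP => [->|/eqP jk].
  rewrite -exprMn mulrC cis_conj expr1n.
  by under eq_bigr do rewrite expr1n; rewrite sumr_const card_ord.
set rho := _ * _.
have c1 : (root1 N)^*%C ^+ N.+3 = 1 by rewrite -rmorphXn/= root1X rmorph1.
have rN : rho ^+ N.+3 = 1.
  by rewrite /rho exprMn -!exprM mulnC exprM root1X expr1n mul1r mulnC exprM c1 expr1n.
have r1 : rho != 1.
  apply/eqP => h; have e : root1 N ^+ k = root1 N ^+ j.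
    by rewrite -[LHS]mul1r -h /rho -mulrA -exprMn cis_conj expr1n mulr1.
  have [jk'|kj|/eqP] := ltngtP j k; last by rewrite (negPf jk).
    by have := root1_inj jk' kN; rewrite e eqxx.
  by have := root1_inj kj jN; rewrite e eqxx.
apply/eqP; have := subrX1 rho N.+3; rewrite rN subrr => /esym/eqP.
by rewrite mulf_eq0 subr_eq0 (negPf r1).
Qed.

(** Parseval for the cyclic group of order [N.+3]. Expanding the squares, the sum over l kills every
    pair of distinct exponents, provided that exponents stay below the order, whence the bound on
    S. *)
Lemma sum_sqn_root1 N S (c : nat -> R[i]) (v : R[i]) : (S <= N.+3)%N ->
  \sum_(l < N.+3) sqn (\sum_(j < S) c j * (root1 N ^+ l * v) ^+ j) =
  N.+3%:R * \sum_(j < S) sqn (c j) * sqn v ^+ j.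
Proof.
move=> SN; apply: (@complexI R); rewrite raddf_sum rmorphM rmorph_nat raddf_sum/=.
pose a j := c j * v ^+ j.
transitivity (\sum_(l < N.+3) \sum_(j < S) \sum_(k < S)
    a j * (a k)^*%C * (root1 N ^+ j * (root1 N)^*%C ^+ k) ^+ l).
  apply: eq_bigr => l _; rewrite sqnE rmorph_sum/= mulr_suml; apply: eq_bigr => j _.
  rewrite mulr_sumr; apply: eq_bigr => k _.
  rewrite /a !rmorphM/= !rmorphXn/= rmorphM/= rmorphXn/=.
  by rewrite !exprMn -!exprM (mulnC l) (mulnC l); ring.
rewrite exchange_big/= mulr_sumr; apply: eq_bigr => j _.
rewrite exchange_big/= (bigD1 j)//= [X in _ + X]big1 ?addr0; last first.
  move=> k kj; rewrite -mulr_sumr sum_root1 ?(leq_trans (ltn_ord _))//.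
  by rewrite eq_sym (inj_eq val_inj) (negPf kj) mulr0.
rewrite -mulr_sumr sum_root1 ?(leq_trans (ltn_ord _))// eqxx mulrC; congr (_ * _).
by rewrite -sqnE /a sqnM sqnX.
Qed.

End roots_of_unity.

(** * Orthogonality of powers under rotation invariance *)

Section orthogonality.
Context {R : realType}.

Lemma measurable_expC d (T : measurableType d) (h : T -> R[i]) k :
  measurable_fun setT h -> measurable_fun setT (fun t => h t ^+ k).
Proof.
move=> mh; elim: k => [|k IH].
  by under eq_fun do rewrite expr0; exact: measurable_cst.
by under eq_fun do rewrite exprS; exact: measurable_mulC.
Qed.

Lemma measurable_sumC d (T : measurableType d) (I : Type) (s : seq I) (h : I -> T -> R[i]) :
  (forall i, measurable_fun setT (h i)) -> measurable_fun setT (fun t => \sum_(i <- s) h i t).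
Proof.
move=> mh; elim: s => [|i s IH].
  by under eq_fun do rewrite big_nil; exact: measurable_cst.
by under eq_fun do rewrite big_cons; exact: measurable_addC.
Qed.

Lemma measurable_polyC d (T : measurableType d) (V : T -> R[i]) (S : nat) (c : nat -> R[i]) :
  measurable_fun setT V -> measurable_fun setT (fun t => \sum_(j < S) c j * V t ^+ j).
Proof.
move=> mV; apply: (@measurable_sumC _ _ _ _ (fun (j : 'I_S) t => c j * V t ^+ j)) => j.
by apply: measurable_mulC; [exact: measurable_cst|exact: measurable_expC].
Qed.

(* Averaging over the rotations by the roots of unity removes the cross terms, without any
   integrability assumption. *)
Lemma ge0_integral_ortho d (T : measurableType d) (m : {measure set T -> \bar R})
    (V : T -> R[i]) (g : T -> R) :
  measurable_fun setT V -> measurable_fun setT g -> (forall t, 0 <= g t) ->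
  (forall u (F : R[i] -> R), sqn u = 1 -> complex.Re u != -1 -> measurable_fun setT F ->
    (forall w, 0 <= F w) ->
    (\int[m]_t (F (u * V t)%R * g t)%:E = \int[m]_t (F (V t) * g t)%:E)%E) ->
  forall S (c : nat -> R[i]),
  (\int[m]_t (sqn (\sum_(j < S) c j * V t ^+ j)%R * g t)%:E =
   \sum_(j < S) (sqn (c j))%:E * \int[m]_t (sqn (V t) ^+ j * g t)%:E)%E.
Proof.
move=> mV mg g0 H S c.
pose F w : R := sqn (\sum_(j < S) c j * w ^+ j).
have mF : measurable_fun setT F.
  by apply: (measurableT_comp measurable_sqn); exact: measurable_polyC.
have F0 w : 0 <= F w by exact: sqn_ge0.
have rotation1 : complex.Re (root1 S) != -1 :> R.
  apply/eqP => e; have := sqn_cis (2 * pi / S.+3%:R : R).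
  rewrite -/(root1 S) /sqn e sqrrN expr1n => e2.
  have : sin (2 * pi / S.+3%:R) ^+ 2 == 0 :> R by apply/eqP; move: e2; rewrite /root1/=; lra.
  rewrite sqrf_eq0 gt_eqF// sin_gt0_pi// divr_gt0 ?mulr_gt0 ?pi_gt0//=.
  by rewrite ltr_pdivrMr// mulrC ltr_pM2l ?pi_gt0// ltr_nat.
have rot l : (\int[m]_t (F (root1 S ^+ l * V t)%R * g t)%:E = \int[m]_t (F (V t) * g t)%:E)%E.
  elim: l => [|l IH]; first by under eq_integral do rewrite expr0 mul1r.
  rewrite -IH; under eq_integral do rewrite exprSr -mulrA.
  have mFl : measurable_fun setT (fun w => F (root1 S ^+ l * w)).
    apply: (measurableT_comp mF); apply: measurable_mulC; first exact: measurable_cst.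
    exact: measurable_id.
  exact: (H (root1 S) (fun w => F (root1 S ^+ l * w)) (sqn_cis _) rotation1 mFl (fun w => F0 _)).
have mFl l : measurable_fun setT (fun t => (F (root1 S ^+ l * V t) * g t)%:E : \bar R).
  apply/measurable_EFinP; apply: measurable_funM => //; apply: measurableT_comp => //.
  by apply: measurable_mulC => //; exact: measurable_cst.
have N0 : S.+3%:R != 0 :> R by rewrite pnatr_eq0.
have key : (S.+3%:R%:E * \int[m]_t (F (V t) * g t)%:E = \int[m]_t (\sum_(l < S.+3) (F (root1 S ^+ l * V t)%R * g t)%:E))%E.
  rewrite ge0_integral_sum//; last by move=> l t _; rewrite lee_fin mulr_ge0.
  under eq_bigr do rewrite rot.
  rewrite mule_natl big_const_ord.
  by elim: S.+3 => // k IH; rewrite muleS IH.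
have : (\int[m]_t (F (V t) * g t)%:E = (S.+3%:R^-1)%:E * (S.+3%:R%:E * \int[m]_t (F (V t) * g t)%:E))%E.
  by rewrite muleA -EFinM mulVf// mul1e.
rewrite key => ->.
have mt j : measurable_fun setT (fun t => (sqn (c j) * (sqn (V t) ^+ j * g t))%:E : \bar R).
  apply/measurable_EFinP; apply: measurable_funM => //; apply: measurable_funM => //.
  apply: measurable_funX; exact: (measurableT_comp measurable_sqn mV).
have t0 j t : 0 <= sqn (c j) * (sqn (V t) ^+ j * g t).
  by rewrite mulr_ge0 ?sqn_ge0// mulr_ge0// exprn_ge0// sqn_ge0.
have E t : (\sum_(l < S.+3) (F (root1 S ^+ l * V t)%R * g t)%:E =
    S.+3%:R%:E * \sum_(j < S) (sqn (c j) * (sqn (V t) ^+ j * g t))%:E)%E.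
  rewrite !sumEFin -mulr_suml sum_sqn_root1; last by do 3 apply: leqW.
  rewrite -EFinM; congr (_%:E); rewrite -mulrA mulr_suml; congr (_ * _).
  by apply: eq_bigr => j _; rewrite mulrA.
under eq_integral do rewrite E.
rewrite ge0_integralZl_EFin//; last 2 first.
- by move=> t _; apply: sume_ge0 => j _; rewrite lee_fin.
- by apply: emeasurable_sum => j; exact: mt.
rewrite muleA -EFinM mulVf// mul1e ge0_integral_sum//; last by move=> j t _; rewrite lee_fin.
apply: eq_bigr => j _; under eq_integral do rewrite EFinM.
rewrite ge0_integralZl_EFin// ?sqn_ge0//.
- by move=> t _; rewrite lee_fin mulr_ge0// exprn_ge0// sqn_ge0.
- apply/measurable_EFinP; apply: measurable_funM => //; apply: measurable_funX.
  exact: (measurableT_comp measurable_sqn mV).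
Qed.

End orthogonality.

(** * Convolution of powers on the half-line *)

Section power_convolution.
Context {R : realType}.
Local Notation mu := (@lebesgue_measure R).

Lemma is_derive_expr j (s : R) : is_derive s 1 (fun u => u ^+ j.+1) (j.+1%:R * s ^+ j).
Proof.
have := is_deriveX j.+1 (is_derive_id s 1); rewrite exprfctE => h; apply: (is_derive_eq h).
by rewrite /GRing.scale/= mulr1.
Qed.

Lemma is_derive_expr_sub l (v s : R) :
  is_derive s 1 (fun u => (v - u) ^+ l.+1) (- (l.+1%:R * (v - s) ^+ l)).
Proof.
have d : is_derive s 1 (fun u : R => v - u) (- 1).
  by apply: (is_derive_eq (is_deriveB (is_derive_cst v s 1) (is_derive_id s 1))); rewrite sub0r.
have := is_deriveX l.+1 d; rewrite exprfctE => h; apply: (is_derive_eq h).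
by rewrite /GRing.scale/= mulrN1.
Qed.

Lemma continuous_expr_sub (v : R) l : continuous (fun s : R => (v - s) ^+ l).
Proof.
case: l => [|l] s; last exact: (is_derive_continuous (is_derive_expr_sub l v s)).
by under eq_fun do rewrite expr0; exact: cvg_cst.
Qed.

Lemma continuous_expr j : continuous (fun s : R => s ^+ j).
Proof.
case: j => [|j] s; last exact: (is_derive_continuous (is_derive_expr j s)).
by under eq_fun do rewrite expr0; exact: cvg_cst.
Qed.

(** Euler's beta integral with integer exponents, rescaled to (0, v). Integration by parts lowers l
    and raises j, so the induction hypothesis is needed for all j. *)
Lemma integral_power_product j l (v : R) : 0 < v ->
  (\int[mu]_(s in `]0%R, v[) (s ^+ j * (v - s) ^+ l)%:E =
   (v ^+ (j + l).+1 * (j`!%:R * l`!%:R / (j + l).+1`!%:R))%:E)%E.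
Proof.
move=> v0.
have c (f : R -> R) : continuous f -> {in `]0, v[, continuous f} by move=> cf x _; exact: cf.
have cp a b : continuous (fun s : R => s ^+ a * (v - s) ^+ b).
  by move=> s; apply: cvgM; [exact: continuous_expr|exact: continuous_expr_sub].
have p0 a b s : s \in `]0, v[ -> 0 <= s ^+ a * (v - s) ^+ b.
  rewrite in_itv/= => /andP[s0 sv]; rewrite mulr_ge0 ?exprn_ge0 ?(ltW s0)//.
  by rewrite subr_ge0 ltW.
have cZ (k : R) a b : continuous (fun s : R => k * (s ^+ a * (v - s) ^+ b)).
  by move=> s; apply: cvgM; [exact: cvg_cst|exact: cp].
elim: l j => [|l IH] j.
  have fj : j.+1%:R != 0 :> R by rewrite pnatr_eq0.
  have : (\int[mu]_(s in `]0%R, v[) (s ^+ j * (v - s) ^+ 0)%:E + 0%:E =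
      \int[mu]_(s in `]0%R, v[) (0 : R)%:E + (v ^+ j.+1 / j.+1%:R)%:E)%E.
    apply: (@ge0_FTC_oo R 0 v 0 (v ^+ j.+1 / j.+1%:R) (fun s => j.+1%:R^-1 * s ^+ j.+1)) => //.
    - by apply: c => x; exact: cvg_cst.
    - by move=> s; exact: p0.
    - move=> s _; apply: (is_derive_eq (is_deriveZ _ (is_derive_expr j s))).
      by rewrite /GRing.scale/= mulKf// expr0 mulr1 subr0.
    - have := @continuous_fctZ R (j.+1%:R^-1) _ (@continuous_expr j.+1) 0.
      by rewrite /continuous_at expr0n mulr0; exact: cvg_at_right_filter.
    - have := @continuous_fctZ R (j.+1%:R^-1) _ (@continuous_expr j.+1) v.
      by rewrite /continuous_at mulrC; exact: cvg_at_left_filter.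
  have -> : (\int[mu]_(s in `]0%R, v[) (0 : R)%:E = 0)%E by exact: integral0.
  rewrite adde0 add0e => ->.
  by rewrite addn0 fact0 mulr1 factS natrM; congr (_%:E); field; rewrite ?nat1r ?pnatr_eq0 -?lt0n ?fact_gt0.
have fj : j.+1%:R != 0 :> R by rewrite pnatr_eq0.
have Z (k : R) a b : 0 <= k -> (\int[mu]_(s in `]0%R, v[) (k * (s ^+ a * (v - s) ^+ b))%:E =
    k%:E * \int[mu]_(s in `]0%R, v[) (s ^+ a * (v - s) ^+ b)%:E)%E.
  move=> k0; rewrite -ge0_integralZl_EFin//.
  - by move=> s /= sv; rewrite lee_fin p0.
  - by apply/measurable_EFinP; apply: open_itv_measurable_fun; exact: c.
have h : (j.+1%:R%:E * \int[mu]_(s in `]0%R, v[) (s ^+ j * (v - s) ^+ l.+1)%:E =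
    l.+1%:R%:E * (v ^+ (j.+1 + l).+1 * (j.+1`!%:R * l`!%:R / (j.+1 + l).+1`!%:R))%:E)%E.
  rewrite -IH -Z// -Z// -[LHS]adde0 -[RHS]adde0.
  apply: (@ge0_FTC_oo R 0 v 0 0 (fun s => s ^+ j.+1 * (v - s) ^+ l.+1) _ _ v0 (c _ (cZ _ _ _)) (c _ (cZ _ _ _))).
  - by move=> s sv; rewrite mulr_ge0// p0.
  - by move=> s sv; rewrite mulr_ge0// p0.
  - move=> s _; apply: (is_derive_eq (is_deriveM (is_derive_expr j s) (is_derive_expr_sub l v s))).
    by rewrite /GRing.scale/= !exprS; ring.
  - by have := cp j.+1 l.+1 0; rewrite /continuous_at expr0n mul0r; exact: cvg_at_right_filter.
  - by have := cp j.+1 l.+1 v; rewrite /continuous_at subrr expr0n mulr0; exact: cvg_at_left_filter.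
have -> : (\int[mu]_(s in `]0%R, v[) (s ^+ j * (v - s) ^+ l.+1)%:E =
  (j.+1%:R^-1)%:E * (j.+1%:R%:E * \int[mu]_(s in `]0%R, v[) (s ^+ j * (v - s) ^+ l.+1)%:E))%E.
  by rewrite muleA -EFinM mulVf// mul1e.
rewrite h -!EFinM addSnnS; congr (_%:E).
rewrite (factS j) (factS l) !natrM.
have E (X D a b L J : R) : J != 0 -> J^-1 * (L * (X * (J * a * b * D))) = X * (a * (L * b) * D).
  by move=> J0; field.
exact: E.
Qed.

(** Powers extended by 0 to the whole line, so that convolutions can use translation invariance. In
    particular [ppow 0] is the indicator of the positive numbers. *)
Definition ppow k (r : R) : R := if 0 < r then r ^+ k else 0.

Lemma ppow_ge0 k r : 0 <= ppow k r.
Proof. by rewrite /ppow; case: ifPn => // r0; rewrite exprn_ge0// ltW. Qed.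

Lemma measurable_ppow k : measurable_fun setT (ppow k).
Proof.
rewrite /ppow; apply: measurable_fun_ifT.
- exact: measurable_fun_ltr.
- exact: measurable_funX.
- exact: measurable_cst.
Qed.

Lemma integral_ppow k (f : R -> \bar R) :
  (\int[mu]_r ((ppow k r)%:E * f r) = \int[mu]_(r in `]0%R, +oo[) ((r ^+ k)%:E * f r))%E.
Proof.
rewrite [RHS]integral_mkcond; apply: eq_integral => r _.
rewrite patchE /ppow; case: (ltP 0 r) => r0.
  by rewrite mem_set//= in_itv/= r0.
by rewrite memNset ?mul0e//= in_itv/= andbT; apply/negP; rewrite -leNgt.
Qed.

Lemma ppow_conv j l (v : R) :
  (\int[mu]_s (ppow j s * ppow l (v - s))%:E =
   (ppow (j + l).+1 v * (j`!%:R * l`!%:R / (j + l).+1`!%:R))%:E)%E.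
Proof.
rewrite {3}/ppow; case: ifPn => [v0|]; last first.
  rewrite -leNgt => v0; rewrite mul0r; apply: integral0_eq => s _.
  rewrite /ppow; case: ifPn => s0; last by rewrite mul0r.
  by rewrite ifN ?mulr0// -leNgt; lra.
rewrite -integral_power_product// [RHS]integral_mkcond; apply: eq_integral => s _.
rewrite patchE /ppow; case: (ltP 0 s) => s0; last first.
  by rewrite mul0r memNset//= in_itv/= => /andP[]; rewrite ltNge s0.
rewrite subr_gt0; case: (ltP s v) => sv; first by rewrite mem_set//= in_itv/= s0.
by rewrite mulr0 memNset//= in_itv/= => /andP[_]; rewrite ltNge sv.
Qed.

(** Put v = s + r and exchange the integrals; the inner one is [ppow_conv]. In the moments, s and r
    are the squared norms of the first coordinate and of the others, and v is that of the whole
    vector. *)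
Lemma ppow_convolution j l (phi : R -> R) : measurable_fun setT phi -> (forall r, 0 <= phi r) ->
  (\int[mu]_s \int[mu]_r (ppow j s * (ppow l r * phi (s + r)))%:E =
   (j`!%:R * l`!%:R / (j + l).+1`!%:R)%:E * \int[mu]_v (ppow (j + l).+1 v * phi v)%:E)%E.
Proof.
move=> mphi phi0.
have mT1 : measurable_fun setT (fun z : measurableTypeR R * measurableTypeR R => z.2 - z.1 : measurableTypeR R).
  exact: measurable_funB.
have m1 k : measurable_fun setT (fun z : measurableTypeR R * measurableTypeR R => ppow k z.1).
  exact: (measurableT_comp (measurable_ppow k) measurable_fst).
have m2 k : measurable_fun setT (fun z : measurableTypeR R * measurableTypeR R => ppow k (z.2 - z.1)).
  exact: (measurableT_comp (measurable_ppow k) mT1).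
have m3 : measurable_fun setT (fun z : measurableTypeR R * measurableTypeR R => phi z.2).
  exact: (measurableT_comp mphi measurable_snd).
transitivity (\int[mu]_s \int[mu]_v (ppow j s * (ppow l (v - s) * phi v))%:E)%E.
  apply: eq_integral => s _.
  rewrite -(@ge0_integral_translation _ (- s) (fun r => (ppow j s * (ppow l r * phi (s + r)))%:E)).
  - by apply: eq_integral => v _; rewrite addrCA subrr addr0.
  - apply/measurable_EFinP; apply: measurable_funM => //; apply: measurable_funM.
      exact: measurable_ppow.
    by apply: (measurableT_comp mphi); apply: measurable_funD.
  - by move=> r; rewrite lee_fin !mulr_ge0// ppow_ge0.
have mf : measurable_fun setT (fun z : measurableTypeR R * measurableTypeR R =>
    (ppow j z.1 * (ppow l (z.2 - z.1) * phi z.2))%:E).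
  by apply/measurable_EFinP; apply: measurable_funM => //; exact: measurable_funM.
have f0 (z : measurableTypeR R * measurableTypeR R) : (0 <= (ppow j z.1 * (ppow l (z.2 - z.1) * phi z.2))%:E)%E.
  by rewrite lee_fin !mulr_ge0// ppow_ge0.
have := @prod_measure_tonelli1 _ _ _ _ R mu mu _ mf f0.
rewrite (@prod_measure_tonelli2 _ _ _ _ R mu mu _ mf f0) /= => <-.
rewrite -ge0_integralZl_EFin//.
- apply: eq_integral => v _.
  under eq_integral do rewrite mulrA mulrC EFinM.
  rewrite ge0_integralZl_EFin//; last 2 first.
  + by move=> s _; rewrite lee_fin mulr_ge0// ppow_ge0.
  + apply/measurable_EFinP; apply: measurable_funM; first exact: measurable_ppow.
    by apply: (measurableT_comp (measurable_ppow l)); apply: measurable_funB.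
  by rewrite ppow_conv -!EFinM; congr (_%:E); ring.
- by move=> v _; rewrite lee_fin mulr_ge0// ppow_ge0.
- by apply/measurable_EFinP; apply: measurable_funM => //; exact: measurable_ppow.
Qed.

End power_convolution.

(** * Integration on C^n coordinate by coordinate *)

Section tuple_integration.
Context {R : realType}.
Local Notation mu := (@lebesgue_measure R).
Local Notation muC := (lebesgue_complex R).
Local Notation A := (@disc_area R).
Implicit Types (n : nat).

Definition tsqn n (z : n.-tuple R[i]) : R := \sum_(i < n) sqn (tnth z i).

Lemma tsqn_ge0 n (z : n.-tuple R[i]) : 0 <= tsqn z.
Proof. by apply: sumr_ge0 => i _; exact: sqn_ge0. Qed.

Lemma enorm_sqr n (z : n.-tuple R[i]) : enorm z ^+ 2 = tsqn z.
Proof. by rewrite enormE sqr_sqrtr//; exact: (tsqn_ge0 z). Qed.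

Lemma measurable_tsqn n : measurable_fun setT (@tsqn n).
Proof.
apply: measurable_sum => i.
exact: (measurableT_comp measurable_sqn (measurable_tnth i)).
Qed.

Lemma tsqn_cons n x (t : n.-tuple R[i]) : tsqn [tuple of x :: t] = sqn x + tsqn t.
Proof.
rewrite /tsqn big_ord_recl; congr (sqn _ + _).
by apply: eq_bigr => i _; rewrite tnthS.
Qed.

Lemma inner_cons n (z : n.+1.-tuple R[i]) x (t : n.-tuple R[i]) :
  inner z [tuple of x :: t] = thead z * x^*%C + inner [tuple of behead z] t.
Proof.
rewrite /inner big_ord_recl; congr (_ * _^*%C + _).
apply: eq_bigr => i _; rewrite tnthS tnth_behead; congr (tnth z _ * _).
by apply/val_inj; rewrite /= inordK// ltnS ltn_ord.
Qed.

Lemma measurable_conjC d (T : measurableType d) (h : T -> R[i]) :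
  measurable_fun setT h -> measurable_fun setT (fun t => (h t)^*%C).
Proof.
move=> mh; apply: measurable_complexP.
  have -> : (fun t => complex.Re (h t)^*%C) = (fun t => complex.Re (h t)).
    by apply/funext => t; case: (h t).
  exact: (measurableT_comp (@measurable_complexRe R)).
have -> : (fun t => complex.Im (h t)^*%C) = (fun t => - complex.Im (h t)).
  by apply/funext => t; case: (h t).
by apply: measurableT_comp => //; exact: (measurableT_comp (@measurable_complexIm R)).
Qed.

Lemma measurable_inner n : measurable_fun setT
  (fun x : n.-tuple R[i] * n.-tuple R[i] => inner x.1 x.2).
Proof.
rewrite /inner.
apply: (@measurable_sumC _ _ _ _ _ (fun (i : 'I_n) (x : n.-tuple R[i] * n.-tuple R[i]) =>
  tnth x.1 i * (tnth x.2 i)^*%C)) => i.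
apply: measurable_mulC; first exact: (measurableT_comp (measurable_tnth i) measurable_fst).
by apply: measurable_conjC; exact: (measurableT_comp (measurable_tnth i) measurable_snd).
Qed.

Lemma measurable_inner2 n (z : n.-tuple R[i]) : measurable_fun setT (fun w : n.-tuple R[i] => inner z w).
Proof. exact: (measurableT_comp (@measurable_inner n) (pair1_measurable z)). Qed.

Lemma measurable_glue n : measurable_fun setT
  (fun x : R[i] * n.-tuple R[i] => [tuple of x.1 :: x.2] : n.+1.-tuple R[i]).
Proof. exact: measurable_cons. Qed.

Lemma integral_lebesgue_Cn0 (f : 0.-tuple R[i] -> \bar R) : measurable_fun setT f ->
  (\int[lebesgue_Cn R 0]_w f w = f [tuple])%E.
Proof. by move=> mf; rewrite /lebesgue_Cn /= integral_dirac// diracT mul1e. Qed.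

Lemma integral_lebesgue_CnS n (f : n.+1.-tuple R[i] -> \bar R) : measurable_fun setT f ->
  (forall w, 0 <= f w)%E ->
  (\int[lebesgue_Cn R n.+1]_w f w =
   \int[prod_measure muC (lebesgue_Cn R n)]_x f [tuple of x.1 :: x.2])%E.
Proof.
move=> mf f0.
rewrite (eq_measure_integral (image_measure (prod_measure muC (lebesgue_Cn R n)) (@measurable_glue n))).
  by rewrite ge0_integral_image_measure.
by [].
Qed.

Lemma integral_lebesgue_CnS1 n (f : n.+1.-tuple R[i] -> \bar R) : measurable_fun setT f ->
  (forall w, 0 <= f w)%E ->
  (\int[lebesgue_Cn R n.+1]_w f w = \int[muC]_x \int[lebesgue_Cn R n]_t f [tuple of x :: t])%E.
Proof.
move=> mf f0; rewrite integral_lebesgue_CnS// prod_measure_tonelli1//.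
exact: (measurableT_comp mf (@measurable_glue n)).
Qed.

Lemma integral_lebesgue_CnS2 n (f : n.+1.-tuple R[i] -> \bar R) : measurable_fun setT f ->
  (forall w, 0 <= f w)%E ->
  (\int[lebesgue_Cn R n.+1]_w f w = \int[lebesgue_Cn R n]_t \int[muC]_x f [tuple of x :: t])%E.
Proof.
move=> mf f0; rewrite integral_lebesgue_CnS// prod_measure_tonelli2//.
exact: (measurableT_comp mf (@measurable_glue n)).
Qed.

Definition trot n (u : R[i]) (w : n.-tuple R[i]) : n.-tuple R[i] := [tuple u * tnth w i | i < n].

Lemma measurable_trot n u : measurable_fun setT (@trot n u).
Proof.
apply/measurable_fun_tnthP => i; rewrite /comp.
under eq_fun do rewrite tnth_mktuple.
by apply: measurable_mulC; [exact: measurable_cst|exact: measurable_tnth].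
Qed.

Lemma trot_cons n u x (t : n.-tuple R[i]) :
  trot u [tuple of x :: t] = [tuple of u * x :: trot u t].
Proof.
apply: eq_from_tnth => i; rewrite tnth_mktuple.
case: (unliftP ord0 i) => [j|] ->; last by [].
by rewrite !tnthS tnth_mktuple.
Qed.

Lemma ge0_integral_trot n (u : R[i]) (f : n.-tuple R[i] -> \bar R) : sqn u = 1 ->
  complex.Re u != -1 -> measurable_fun setT f -> (forall w, 0 <= f w)%E ->
  (\int[lebesgue_Cn R n]_w f (trot u w) = \int[lebesgue_Cn R n]_w f w)%E.
Proof.
move=> u1 uN; elim: n f => [|n IH] f mf f0.
  rewrite !integral_lebesgue_Cn0//; last exact: (measurableT_comp mf (@measurable_trot 0 u)).
  by congr f; apply: eq_from_tnth => -[].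
rewrite integral_lebesgue_CnS1//; last exact: (measurableT_comp mf (@measurable_trot n.+1 u)).
rewrite [RHS]integral_lebesgue_CnS1//.
have mG : measurable_fun setT (fun x => \int[lebesgue_Cn R n]_t f [tuple of x :: t])%E.
  apply: (@measurable_fun_fubini_tonelli_F _ _ _ _ _ (lebesgue_Cn R n)
    (fun x => f [tuple of x.1 :: x.2])) => //.
  exact: (measurableT_comp mf (@measurable_glue n)).
rewrite -[RHS](ge0_integral_rotation u1 uN mG); last by move=> x; exact: integral_ge0.
apply: eq_integral => x _.
under eq_integral do rewrite trot_cons.
apply: (IH (fun t => f [tuple of u * x :: t])) => //.
exact: (measurableT_comp mf (measurableT_comp (@measurable_glue n) (pair1_measurable (u * x)))).
Qed.

Lemma inner_trot n (z w : n.-tuple R[i]) u : inner z (trot u w) = u^*%C * inner z w.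
Proof.
rewrite /inner mulr_sumr; apply: eq_bigr => i _.
by rewrite tnth_mktuple rmorphM/= mulrCA.
Qed.

Lemma tsqn_trot n (w : n.-tuple R[i]) u : sqn u = 1 -> tsqn (trot u w) = tsqn w.
Proof. by move=> u1; apply: eq_bigr => i _; rewrite tnth_mktuple sqnM u1 mul1r. Qed.

End tuple_integration.

(** * Moments of the inner product *)

Section moments.
Context {R : realType}.
Local Notation mu := (@lebesgue_measure R).
Local Notation muC := (lebesgue_complex R).
Local Notation A := (@disc_area R).

Lemma sqn_nat k : sqn (k%:R : R[i]) = k%:R ^+ 2.
Proof. by rewrite /sqn !raddfMn/= mul0rn [X in _ + X]expr0n addr0. Qed.

Lemma ge0_integral_radialX j (g : R -> R) : measurable_fun setT g -> (forall r, 0 <= g r) ->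
  (\int[muC]_w (sqn w ^+ j * g (sqn w))%:E = A%:E * \int[mu]_r (ppow j r * g r)%:E)%E.
Proof.
move=> mg g0.
have -> : (\int[muC]_w (sqn w ^+ j * g (sqn w))%:E =
    \int[muC]_w (fun r => (`|r| ^+ j * g r)%:E) (sqn w))%E.
  by apply: eq_integral => w _ /=; rewrite (ger0_norm (sqn_ge0 _)).
rewrite (@ge0_integral_radial _ (fun r => (`|r| ^+ j * g r)%:E)).
- congr (_ * _)%E; under [RHS]eq_integral do rewrite EFinM.
  rewrite integral_ppow; apply: eq_integral => r; rewrite inE/= in_itv/= andbT => r0.
  by rewrite EFinM gtr0_norm.
- apply/measurable_EFinP; apply: measurable_funM => //; apply: measurable_funX.
  exact: normr_measurable.
- by move=> r; rewrite lee_fin mulr_ge0// exprn_ge0.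
Qed.

Lemma measurable_shift (phi : R -> R) (s : R) : measurable_fun setT phi ->
  measurable_fun setT (fun r : R => phi (r + s)).
Proof. by move=> mphi; apply: (measurableT_comp mphi); exact: measurable_funD. Qed.

(** As a function of the first coordinate x of the variable, an inner product has the form z x^* +
    u. Its K-th power is expanded by the binomial theorem, and orthogonality of the powers of x^*
    leaves the squared moduli of the coefficients. *)
Lemma integral_sqn_affine (z u : R[i]) K s (phi : R -> R) : measurable_fun setT phi ->
  (forall r, 0 <= phi r) ->
  (\int[muC]_x (sqn (z * x^*%C + u)%R ^+ K * phi (sqn x + s))%:E =
   \sum_(j < K.+1) (sqn z ^+ j * sqn u ^+ (K - j) * 'C(K, j)%:R ^+ 2 * A)%:E *
     \int[mu]_r (ppow j r * phi (r + s))%:E)%E.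
Proof.
move=> mphi phi0; have mg := measurable_shift s mphi.
have mC : measurable_fun setT (fun x : R[i] => x^*%C).
  by apply: measurable_conjC; exact: measurable_id.
have E x : sqn (z * x^*%C + u) ^+ K =
    sqn (\sum_(j < K.+1) (z ^+ j * u ^+ (K - j) *+ 'C(K, j)) * (x^*%C) ^+ j).
  rewrite -sqnX addrC exprDn; congr sqn; apply: eq_bigr => j _.
  by rewrite mulrnAl exprMn; congr (_ *+ _); ring.
under eq_integral do rewrite E.
rewrite (@ge0_integral_ortho _ _ _ muC (fun x => x^*%C) (fun x => phi (sqn x + s)) mC _ _ _ K.+1
  (fun j => z ^+ j * u ^+ (K - j) *+ 'C(K, j))) //=.
- apply: eq_bigr => j _; under eq_integral do rewrite sqn_conj.
  rewrite (@ge0_integral_radialX j (fun r => phi (r + s))) => //.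
  rewrite muleA -EFinM; congr ((_ * _)%:E * _)%E.
  by rewrite -mulr_natr !sqnM !sqnX; congr (_ * _); rewrite sqn_nat.
- exact: (measurableT_comp mg measurable_sqn).
- move=> v F v1 vN mF F0.
  pose f (x : R[i]) : \bar R := (F x^*%C * phi (sqn x + s))%:E.
  have mf : measurable_fun setT f.
    apply/measurable_EFinP; apply: measurable_funM; first exact: (measurableT_comp mF).
    exact: (measurableT_comp mg measurable_sqn).
  have f0 x : (0 <= f x)%E by rewrite lee_fin mulr_ge0.
  rewrite -(@ge0_integral_rotation _ (v^*%C) f)//; last 2 first.
  - by rewrite -[LHS]/(sqn v^*%C) sqn_conj.
  - by move: vN; case: (v).
  by apply: eq_integral => x _; rewrite /f rmorphM/= conjcK sqnM sqn_conj v1 mul1r.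
Qed.

Let I (phi : R -> R) k := (\int[mu]_r (ppow k r * phi r)%:E)%E.

Let measurable_integral_shift (phi : R -> R) j : measurable_fun setT phi -> (forall r, 0 <= phi r) ->
  measurable_fun setT (fun s => I (fun r => phi (r + s)) j).
Proof.
move=> mphi phi0.
apply: (@measurable_fun_fubini_tonelli_F _ _ _ _ _ mu
  (fun x => (ppow j x.2 * phi (x.2 + x.1))%:E)) => //.
- apply/measurable_EFinP; apply: measurable_funM.
    exact: (measurableT_comp (@measurable_ppow R j) measurable_snd).
  by apply: (measurableT_comp mphi); apply: measurable_funD.
- by move=> x; rewrite lee_fin mulr_ge0// ppow_ge0.
Qed.

(** One binomial term of the induction on the dimension: the first coordinate brings [ppow j], the
    others bring [ppow l] by the hypothesis on g, and the convolution merges the two. *)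
Let step_term n (g : n.-tuple R[i] -> R) (phi : R -> R) j c l (C : R) :
  measurable_fun setT g -> (forall t, 0 <= g t) ->
  measurable_fun setT phi -> (forall r, 0 <= phi r) -> 0 <= C -> 0 <= c ->
  (forall psi : R -> R, measurable_fun setT psi -> (forall r, 0 <= psi r) ->
    (\int[lebesgue_Cn R n]_t (g t * psi (tsqn t))%:E = C%:E * I psi l)%E) ->
  (\int[lebesgue_Cn R n]_t ((c * g t)%:E * I (fun r => phi (r + tsqn t))%R j) =
    (c * C * (j`!%:R * l`!%:R / (j + l).+1`!%:R))%:E * I phi (j + l).+1)%E.
Proof.
move=> mg g0 mphi phi0 C0 c0 IH.
transitivity (\int[lebesgue_Cn R n]_t \int[mu]_s (c%:E * (ppow j s * (g t * phi (s + tsqn t))%R)%:E))%E.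
  apply: eq_integral => t _; rewrite -ge0_integralZl_EFin//.
  - apply: eq_integral => s _; rewrite -!EFinM; congr (_%:E); ring.
  - by move=> s _; rewrite lee_fin mulr_ge0// ppow_ge0.
  - apply/measurable_EFinP; apply: measurable_funM => //; first exact: measurable_ppow.
    exact: measurable_shift.
  - by rewrite mulr_ge0.
pose F (x : n.-tuple R[i] * measurableTypeR R) : \bar R :=
  (c%:E * (ppow j x.2 * (g x.1 * phi (x.2 + tsqn x.1)))%:E)%E.
have mF : measurable_fun setT F.
  apply: measurable_funeM; apply/measurable_EFinP; apply: measurable_funM.
    exact: (measurableT_comp (@measurable_ppow R j) measurable_snd).
  apply: measurable_funM; first exact: (measurableT_comp mg measurable_fst).
  apply: (measurableT_comp mphi); apply: measurable_funD => //.
  exact: (measurableT_comp (@measurable_tsqn R n) measurable_fst).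
have F0 x : (0 <= F x)%E.
  by rewrite mule_ge0 ?lee_fin// mulr_ge0 ?ppow_ge0// mulr_ge0.
rewrite (_ : (\int[_]_t \int[_]_s _ = \int[mu]_s \int[lebesgue_Cn R n]_t F (t, s))%E); last first.
  exact: (etrans (esym (prod_measure_tonelli1 (lebesgue_Cn R n) mu mF F0)) (prod_measure_tonelli2 _ _ mF F0)).
transitivity (\int[mu]_s \int[mu]_r ((c * C)%:E * (ppow j s * (ppow l r * phi (s + r)%R))%:E))%E.
  apply: eq_integral => s _; rewrite /F/=.
  have mphis := measurable_shift s mphi.
  rewrite ge0_integralZl_EFin//; last 2 first.
  - by move=> t _; rewrite lee_fin mulr_ge0 ?ppow_ge0// mulr_ge0.
  - have /= h := measurableT_comp mF (pair2_measurable (T1 := n.-tuple R[i]) (s : measurableTypeR R)).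
    apply/measurable_EFinP; apply: measurable_funM => //; apply: measurable_funM => //.
    apply: (measurableT_comp mphi); apply: measurable_funD => //; exact: measurable_tsqn.
  rewrite [RHS]ge0_integralZl_EFin ?mulr_ge0//; last 2 first.
  - by move=> r _; rewrite lee_fin mulr_ge0 ?ppow_ge0// mulr_ge0 ?ppow_ge0.
  - apply/measurable_EFinP; apply: measurable_funM => //; apply: measurable_funM => //.
      exact: measurable_ppow.
    by under eq_fun do rewrite addrC.
  rewrite EFinM -muleA; congr (_ * _)%E.
  under eq_integral do rewrite EFinM.
  rewrite ge0_integralZl_EFin ?ppow_ge0//; last 2 first.
  - by move=> t _; rewrite lee_fin mulr_ge0.
  - apply/measurable_EFinP; apply: measurable_funM => //.
    apply: (measurableT_comp mphi); apply: measurable_funD => //; exact: measurable_tsqn.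
  under eq_integral do rewrite addrC.
  rewrite (IH (fun r => phi (r + s)))// muleCA; congr (_ * _)%E.
  under [RHS]eq_integral do rewrite EFinM.
  rewrite [RHS]ge0_integralZl_EFin ?ppow_ge0//.
  - by under [in RHS]eq_integral do rewrite addrC.
  - by move=> r _; rewrite lee_fin mulr_ge0 ?ppow_ge0.
  - apply/measurable_EFinP; apply: measurable_funM => //; first exact: measurable_ppow.
    by under eq_fun do rewrite addrC.
have mm s : measurable_fun setT (fun r => ppow j s * (ppow l r * phi (s + r))).
  apply: measurable_funM => //; apply: measurable_funM => //; first exact: measurable_ppow.
  by under eq_fun do rewrite addrC; exact: measurable_shift.
have pp s r : 0 <= ppow j s * (ppow l r * phi (s + r)).
  by rewrite mulr_ge0 ?ppow_ge0// mulr_ge0 ?ppow_ge0.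
rewrite [in RHS]EFinM -muleA -(ppow_convolution j l mphi phi0) -ge0_integralZl_EFin ?mulr_ge0//.
- apply: eq_integral => s _; rewrite ge0_integralZl_EFin ?mulr_ge0//.
  + by move=> r _; rewrite lee_fin.
  + by apply/measurable_EFinP; exact: mm.
- by move=> s _; apply: integral_ge0 => r _; rewrite lee_fin.
- apply: (@measurable_fun_fubini_tonelli_F _ _ _ _ _ mu
    (fun x => (ppow j x.1 * (ppow l x.2 * phi (x.1 + x.2)))%:E)) => //.
    apply/measurable_EFinP; apply: measurable_funM.
      exact: (measurableT_comp (@measurable_ppow R j) measurable_fst).
    apply: measurable_funM.
      exact: (measurableT_comp (@measurable_ppow R l) measurable_snd).
    by apply: (measurableT_comp mphi); apply: measurable_funD.
  by move=> x; rewrite lee_fin.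
Qed.

(** Induction on the dimension, splitting off the first coordinates of z and w. The claim is for
    every measurable nonnegative [phi], because each step applies it to translates of [phi] by the
    squared modulus already split off. *)
Lemma integral_inner_moment m (z : m.+1.-tuple R[i]) K (phi : R -> R) :
  measurable_fun setT phi -> (forall r, 0 <= phi r) ->
  (\int[lebesgue_Cn R m.+1]_w (sqn (inner z w) ^+ K * phi (tsqn w))%:E =
   (tsqn z ^+ K * (A ^+ m.+1 * (K`!%:R / (m + K)`!%:R)))%:E *
     \int[mu]_r (ppow (m + K) r * phi r)%:E)%E.
Proof.
move=> mphi phi0; elim: m z K phi mphi phi0 => [|m IH] z K phi mphi phi0.
- have mf : measurable_fun setT (fun w : 1.-tuple R[i] => (sqn (inner z w) ^+ K * phi (tsqn w))%:E).
    apply/measurable_EFinP; apply: measurable_funM.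
      apply: measurable_funX; apply: (measurableT_comp measurable_sqn).
      exact: measurable_inner2.
    exact: (measurableT_comp mphi (@measurable_tsqn R 1)).
  have f0 (w : 1.-tuple R[i]) : (0 <= (sqn (inner z w) ^+ K * phi (tsqn w))%:E)%E.
    by rewrite lee_fin mulr_ge0// exprn_ge0// sqn_ge0.
  have z1 : sqn (thead z) = tsqn z by rewrite /tsqn big_ord_recl big_ord0 addr0.
  rewrite integral_lebesgue_CnS1//.
  transitivity (\int[muC]_x ((tsqn z ^+ K)%:E * (sqn x ^+ K * phi (sqn x))%:E))%E.
    apply: eq_integral => x _; rewrite integral_lebesgue_Cn0.
      rewrite inner_cons tsqn_cons /tsqn/= big_ord0 addr0 /inner big_ord0 addr0.
      by rewrite sqnM sqn_conj exprMn z1 -EFinM mulrA.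
    exact: (measurableT_comp mf (measurableT_comp (@measurable_glue R 0) (pair1_measurable x))).
  rewrite ge0_integralZl_EFin ?exprn_ge0 ?tsqn_ge0//; last 2 first.
  - by move=> x _; rewrite lee_fin mulr_ge0// exprn_ge0// sqn_ge0.
  - apply/measurable_EFinP; apply: measurable_funM.
      by apply: measurable_funX; exact: measurable_sqn.
    exact: (measurableT_comp mphi measurable_sqn).
  by rewrite ge0_integral_radialX// muleA -EFinM add0n divff ?mulr1 ?pnatr_eq0 -?lt0n ?fact_gt0.
have mf : measurable_fun setT (fun w : m.+2.-tuple R[i] => (sqn (inner z w) ^+ K * phi (tsqn w))%:E).
  apply/measurable_EFinP; apply: measurable_funM.
    apply: measurable_funX; apply: (measurableT_comp measurable_sqn).
    exact: measurable_inner2.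
  exact: (measurableT_comp mphi (@measurable_tsqn R m.+2)).
have f0 (w : m.+2.-tuple R[i]) : (0 <= (sqn (inner z w) ^+ K * phi (tsqn w))%:E)%E.
  by rewrite lee_fin mulr_ge0// exprn_ge0// sqn_ge0.
pose z1 := thead z; pose z' : m.+1.-tuple R[i] := [tuple of behead z].
have zE : tsqn z = sqn z1 + tsqn z' by rewrite (tuple_eta z) tsqn_cons.
rewrite integral_lebesgue_CnS2//.
transitivity (\int[lebesgue_Cn R m.+1]_t \sum_(j < K.+1)
   ((sqn z1 ^+ j * 'C(K, j)%:R ^+ 2 * A * sqn (inner z' t) ^+ (K - j))%:E *
     I (fun r => phi (r + tsqn t)%R) j))%E.
  apply: eq_integral => t _.
  under eq_integral do rewrite inner_cons tsqn_cons.
  rewrite (@integral_sqn_affine z1 (inner z' t) K (tsqn t) phi mphi phi0).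
  apply: eq_bigr => j _; congr ((_%:E) * _)%E; ring.
have A0 := @disc_area_gt0 R.
have c0 j : 0 <= sqn z1 ^+ j * 'C(K, j)%:R ^+ 2 * A.
  by rewrite !mulr_ge0 ?(ltW A0) ?exprn_ge0 ?sqn_ge0.
have mg k : measurable_fun setT (fun t => sqn (inner z' t) ^+ k).
  by apply: measurable_funX; apply: (measurableT_comp measurable_sqn); exact: measurable_inner2.
have g0 k t : 0 <= sqn (inner z' t) ^+ k by rewrite exprn_ge0// sqn_ge0.
rewrite ge0_integral_sum//; last 2 first.
- move=> j; apply: emeasurable_funM.
    by apply/measurable_EFinP; apply: measurable_funM.
  exact: (measurableT_comp (measurable_integral_shift j mphi phi0) (@measurable_tsqn R m.+1)).
- move=> j t _; apply: mule_ge0; first by rewrite lee_fin; apply: mulr_ge0; [exact: c0|exact: g0].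
  by apply: integral_ge0 => r _; rewrite lee_fin mulr_ge0// ppow_ge0.
transitivity (\sum_(j < K.+1) ((sqn z1 ^+ j * 'C(K, j)%:R ^+ 2 * A) *
   (tsqn z' ^+ (K - j) * (A ^+ m.+1 * ((K - j)`!%:R / (m + (K - j))`!%:R))) *
   (j`!%:R * (m + (K - j))`!%:R / (m.+1 + K)`!%:R))%:E * I phi (m.+1 + K))%E.
  apply: eq_bigr => j _.
  have e : (m.+1 + K = (j + (m + (K - j))).+1)%N.
    by rewrite addSn addnCA subnKC// -ltnS.
  have C0 : 0 <= tsqn z' ^+ (K - j) * (A ^+ m.+1 * ((K - j)`!%:R / (m + (K - j))`!%:R)).
    by rewrite !mulr_ge0 ?exprn_ge0 ?tsqn_ge0 ?invr_ge0// ltW.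
  have := step_term j (mg (K - j)%N) (g0 (K - j)%N) mphi phi0 C0 (c0 j) (fun psi mpsi psi0 => IH z' (K - j)%N psi mpsi psi0).
  by rewrite -e.
rewrite -ge0_sume_distrl; last first.
  move=> j _; rewrite lee_fin !mulr_ge0 ?exprn_ge0 ?sqn_ge0 ?tsqn_ge0// ?invr_ge0// ltW//.
rewrite sumEFin; congr (_%:E * _)%E.
(* One of the two binomial coefficients turns j! (K - j)! into K!; the other belongs to the
   expansion of [(sqn z1 + tsqn z') ^+ K]. *)
rewrite zE addrC exprDn mulr_suml; apply: eq_bigr => j _.
have jK : (j <= K)%N by rewrite -ltnS.
have -> : K`!%:R = 'C(K, j)%:R * (j`!%:R * (K - j)`!%:R) :> R by rewrite -!natrM bin_fact.
have nz k : k`!%:R != 0 :> R by rewrite pnatr_eq0 -lt0n fact_gt0.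
rewrite -[X in _ = X * _]mulr_natr [A ^+ m.+2]exprS.
move: (nz (m + (K - j))%N) (nz (m.+1 + K)%N); move: (sqn z1 ^+ j) (tsqn z' ^+ (K - j)) (A ^+ m.+1).
move: (_`!%:R : R) (_`!%:R : R) (_`!%:R : R) (_`!%:R : R) ('C(_, _)%:R : R).
by move=> a b c d e f g h b0 d0; field; rewrite ?b0 ?d0.
Qed.

End moments.

(** * The Berezin kernel *)

Section negative_binomial.
Context {R : realType}.

(** Partial sums of the binomial series of (1 - u)^(-(d+1)). The ring is a parameter since u is an
    inner product in some places and a real majorant in others. *)
Definition negbin (K : comNzRingType) d S (u : K) : K := \sum_(k < S) 'C(d + k, d)%:R * u ^+ k.

(** The exact defect after multiplication by (1 - u)^(d+1), see [negbinE]. All its terms contain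
    u^S, hence a bound uniform in |u| <= q < 1. *)
Definition negbin_err (K : comNzRingType) d S (u : K) : K :=
  u ^+ S + \sum_(j < d) (1 - u) ^+ j.+1 * ('C(j + S, j.+1)%:R * u ^+ S).

Lemma negbin_recl (K : comNzRingType) d S (u : K) :
  (1 - u) * negbin d.+1 S u = negbin d S u - 'C(d + S, d.+1)%:R * u ^+ S.
Proof.
rewrite /negbin; elim: S => [|S IH].
  by rewrite !big_ord0 mulr0 addn0 bin_small// mul0r subr0.
rewrite !big_ord_recr/= mulrDr IH addSn addnS binS natrD exprS; ring.
Qed.

Lemma negbinE (K : comNzRingType) d S (u : K) :
  (1 - u) ^+ d.+1 * negbin d S u = 1 - negbin_err d S u.
Proof.
elim: d => [|d IH]; rewrite /negbin_err.
  rewrite big_ord0 addr0 expr1 /negbin.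
  under eq_bigr do rewrite add0n bin0 mul1r.
  by rewrite -(subr1_expn u) || (rewrite -opprB mulNr -subrX1 opprB).
rewrite exprSr -mulrA negbin_recl mulrBr IH /negbin_err big_ord_recr/=.
ring.
Qed.

Lemma negbin_err_ge0 d S (q : R) : 0 <= q < 1 -> 0 <= negbin_err d S q.
Proof.
move=> /andP[q0 q1]; rewrite addr_ge0 ?exprn_ge0// sumr_ge0// => j _.
by rewrite mulr_ge0 ?mulr_ge0 ?exprn_ge0// subr_ge0 ltW.
Qed.

Lemma negbin_le d S (q : R) : 0 <= q < 1 -> negbin d S q <= (1 - q) ^- d.+1.
Proof.
move=> q01; have := negbin_err_ge0 d S q01; move: q01 => /andP[q0 q1] e0.
have p0 : 0 < (1 - q) ^+ d.+1 by rewrite exprn_gt0// subr_gt0.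
by rewrite -(ler_pM2l p0) mulfV ?gt_eqF// negbinE lerBlDr lerDl.
Qed.

(** For p between q and 1 the products of binomial coefficient and p^S are bounded, being terms of
    partial sums bounded by [negbin_le]; the remaining factor (q / p)^S tends to 0. *)
Lemma cvg_bin_geometric d (q : R) : 0 <= q < 1 ->
  (fun S => 'C(d + S, d)%:R * q ^+ S) @ \oo --> (0 : R).
Proof.
move=> /andP[q0 q1]; pose p := (1 + q) / 2.
have p01 : 0 <= p < 1 by rewrite /p; apply/andP; split; lra.
have p0 : 0 < p by rewrite /p; lra.
have /andP[_ p1] := p01.
pose M := (1 - p) ^- d.+1.
have g : (fun S => M * (q / p) ^+ S) @ \oo --> (0 : R).
  rewrite -[X in _ --> X](mulr0 M); apply: cvgMl_tmp; apply: cvg_expr.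
  have qp : 0 <= q / p by apply: divr_ge0 => //; exact: ltW.
  by rewrite (ger0_norm qp) ltr_pdivrMr// mul1r /p; lra.
apply: (squeeze_cvgr _ (cvg_cst 0) g); apply: nearW => S /=.
rewrite mulr_ge0 ?exprn_ge0//=.
have : 'C(d + S, d)%:R * p ^+ S <= M.
  apply: le_trans (negbin_le d S.+1 p01); rewrite /negbin big_ord_recr/= lerDr.
  by apply: sumr_ge0 => k _; rewrite mulr_ge0// exprn_ge0// ltW.
move=> h; rewrite expr_div_n mulrA ler_pdivlMr ?exprn_gt0// mulrAC ler_wpM2r// exprn_ge0//.
Qed.

(** A majorant of [negbin_err] for complex u with |u| <= q < 1, from |1 - u| <= 2. *)
Let errB d (q : R) S : R := q ^+ S + \sum_(j < d) 2 ^+ j.+1 * ('C(j + S, j.+1)%:R * q ^+ S).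

Let cvg_errB d q : 0 <= q < 1 -> errB d q @ \oo --> (0 : R).
Proof.
move=> q01; have /andP[q0 q1] := q01.
have c1 j : (fun S => 2 ^+ j.+1 * ('C(j + S, j.+1)%:R * q ^+ S)) @ \oo --> (0 : R).
  rewrite -[X in _ --> X](mulr0 (2 ^+ j.+1)); apply: cvgMl_tmp.
  apply: (squeeze_cvgr _ (cvg_cst 0) (cvg_bin_geometric j.+1 q01)); apply: nearW => S /=.
  rewrite mulr_ge0 ?exprn_ge0//= ler_wpM2r ?exprn_ge0// ler_nat addSn.
  by rewrite binS leq_addr.
rewrite /errB; elim: d => [|d IH].
  under eq_fun do rewrite big_ord0 addr0.
  by apply: cvg_expr; rewrite ger0_norm.
under eq_fun do rewrite big_ord_recr/= addrA.
have h := cvgD IH (c1 d); rewrite addr0 in h; exact: h.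
Qed.

Lemma cvg_negbin_err d (q : R) : 0 <= q < 1 -> (fun S => negbin_err d S q) @ \oo --> (0 : R).
Proof.
move=> q01; have /andP[q0 q1] := q01.
apply: (squeeze_cvgr _ (cvg_cst 0) (cvg_errB d q01)); apply: nearW => S /=.
rewrite negbin_err_ge0//= /negbin_err /errB lerD2l ler_sum// => j _.
rewrite ler_wpM2r// ?mulr_ge0 ?exprn_ge0//.
rewrite lerXn2r ?nnegrE//; lra.
Qed.

Lemma cvg_negbin d (q : R) : 0 <= q < 1 -> (fun S => negbin d S q) @ \oo --> (1 - q) ^- d.+1.
Proof.
move=> q01; have /andP[q0 q1] := q01.
have p0 : (1 - q) ^+ d.+1 != 0 by rewrite gt_eqF// exprn_gt0// subr_gt0.
have -> : (fun S => negbin d S q) = (fun S => (1 - q) ^- d.+1 * (1 - negbin_err d S q)).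
  by apply/funext => S; rewrite -negbinE mulKf.
rewrite -[X in _ --> X]mulr1 -{2}[1 in X in _ --> X](subr0 1); apply: cvgMl_tmp.
by apply: cvgB; [exact: cvg_cst|exact: cvg_negbin_err].
Qed.

Lemma normc_sqn (z : R[i]) : ComplexField.Normc.normc z = Num.sqrt (sqn z).
Proof. by case: z. Qed.

Lemma normc_sqr (z : R[i]) : ComplexField.Normc.normc z ^+ 2 = sqn z.
Proof. by rewrite normc_sqn sqr_sqrtr// sqn_ge0. Qed.

Local Notation normc := (@ComplexField.Normc.normc R).

Lemma normc_ge0 z : 0 <= normc z.
Proof. by rewrite normc_sqn sqrtr_ge0. Qed.

Lemma le_normcD (x y : R[i]) : normc (x + y) <= normc x + normc y.
Proof.
have := ler_normD x y.
by rewrite -lecR; rewrite rmorphD.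
Qed.

Lemma normcX (z : R[i]) k : normc (z ^+ k) = normc z ^+ k.
Proof.
by elim: k => [|k IH]; rewrite ?expr0 ?normc1// !exprS normcM IH.
Qed.

Lemma normc_nat k : normc (k%:R : R[i]) = k%:R.
Proof. by rewrite normc_sqn sqn_nat sqrtr_sqr ger0_norm. Qed.

Let normc_err d S (u : R[i]) q : normc u <= q -> q < 1 -> normc (negbin_err d S u) <= errB d q S.
Proof.
move=> uq q1; have q0 : 0 <= q := le_trans (normc_ge0 _) uq.
rewrite /negbin_err /errB; elim: d => [|d IH].
  by rewrite !big_ord0 !addr0 normcX lerXn2r ?nnegrE ?normc_ge0.
rewrite !big_ord_recr/= !addrA; apply: (le_trans (le_normcD _ _)); apply: lerD => //.
rewrite !normcM !normcX normc_nat.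
have n0 := normc_ge0.
apply: ler_pM; rewrite ?mulr_ge0 ?exprn_ge0//; last first.
  by rewrite ler_wpM2l// lerXn2r ?nnegrE.
rewrite lerXn2r ?nnegrE//; apply: (le_trans (le_normcD _ _)).
have -> : normc (- u) = normc u by rewrite !normc_sqn; case: (u) => a b; rewrite /sqn/= !sqrrN.
rewrite normc1; lra.
Qed.

(* A multiplicative error, so that it can be integrated against a weight of infinite mass. *)
Lemma sqn_negbin_near d (q r : R) : q < 1 -> 0 < r < 1 ->
  \forall S \near \oo, forall u : R[i], normc u <= q ->
    r <= sqn (1 - u) ^+ d.+1 * sqn (negbin d S u) /\
    r * (sqn (1 - u) ^+ d.+1 * sqn (negbin d S u)) <= 1.
Proof.
move=> q1 /andP[r0 r1]; pose e := (1 - r) / 3.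
have [q0|q0] := ltP q 0.
  by near=> S => u uq; have := le_lt_trans (le_trans (normc_ge0 u) uq) q0; rewrite ltxx.
have q01 : 0 <= q < 1 by rewrite q0.
have e0 : 0 < e by rewrite /e; lra.
have /cvgrPdist_le /(_ e e0) := cvg_errB d q01.
apply: filterS => S; rewrite sub0r normrN => /(le_trans (ler_norm _)) Se u uq.
have En := le_trans (normc_err d S uq q1) Se.
rewrite -sqnX -sqnM negbinE -normc_sqr.
set E := negbin_err d S u in En *.
have n1 : normc (1 - E) <= 1 + e.
  apply: (le_trans (le_normcD _ _)).
  have -> : normc (- E) = normc E by rewrite !normc_sqn; case: (E) => a b; rewrite /sqn/= !sqrrN.
  by rewrite normc1 lerD2l.
have n2 : 1 - e <= normc (1 - E).
  have := le_normcD (1 - E) E; rewrite subrK normc1 => h.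
  by rewrite lerBlDr; apply: (le_trans h); rewrite lerD2l.
have N0 := normc_ge0 (1 - E).
have rE : r = 1 - 3 * e by rewrite /e; field.
have e1 : e <= 3^-1 by rewrite /e; lra.
split.
  apply: (@le_trans _ _ ((1 - e) ^+ 2)); first by rewrite rE; nra.
  by rewrite lerXn2r ?nnegrE//; lra.
apply: (@le_trans _ _ (r * (1 + e) ^+ 2)).
  by rewrite ler_wpM2l ?(ltW r0)// lerXn2r ?nnegrE//; lra.
have -> : r * (1 + e) ^+ 2 = 1 - e * (1 + 5 * e + 3 * e ^+ 2) by rewrite rE; ring.
by rewrite gerBl mulr_ge0 ?(ltW e0)//; nra.
Unshelve. all: by end_near. Qed.

End negative_binomial.

Lemma ge0_scale_le_integral {d} {T : measurableType d} {R : realType}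
    (mu : {measure set T -> \bar R}) (k : R) (f g : T -> R) : 0 <= k ->
  measurable_fun setT f -> measurable_fun setT g ->
  (forall t, 0 <= f t) -> (forall t, k * f t <= g t) ->
  (k%:E * \int[mu]_t (f t)%:E <= \int[mu]_t (g t)%:E)%E.
Proof.
move=> k0 mf mg f0 fg; rewrite -ge0_integralZl_EFin//; last 2 first.
- by move=> t _; rewrite lee_fin.
- exact/measurable_EFinP.
apply: ge0_le_integral => //.
- by move=> t _; rewrite -EFinM lee_fin mulr_ge0.
- by apply: measurable_funeM; exact/measurable_EFinP.
- exact/measurable_EFinP.
- by move=> t _; rewrite -EFinM lee_fin.
Qed.

(** * Kernel integrals of radial functions *)

Section kernel_integral.
Context {R : realType} (m : nat).
Local Notation mu := (@lebesgue_measure R).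
Local Notation L := (lebesgue_Cn R m.+1).
Local Notation A := (@disc_area R).
Local Notation normc := (@ComplexField.Normc.normc R).
Implicit Types (z w : m.+1.-tuple R[i]) (phi : R -> R).

(** The inequality between geometric and arithmetic means in each coordinate. For w in the ball the
    bound is at most (|z|^2 + 1) / 2, which is below 1 uniformly in w. *)
Lemma normc_inner_le n (z w : n.-tuple R[i]) : normc (inner z w) <= (tsqn z + tsqn w) / 2.
Proof.
rewrite /inner /tsqn -big_split/=.
elim/big_ind2 : _ => [|x1 x2 y1 y2 h1 h2|i _].
- by rewrite normc0 mul0r.
- by apply: (le_trans (le_normcD _ _)); rewrite mulrDl lerD.
- rewrite normcM; have -> : normc (tnth w i)^*%C = normc (tnth w i).
    by rewrite !normc_sqn sqn_conj.
  rewrite -!normc_sqr; move: (normc _) (normc _) => a b.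
  rewrite ler_pdivlMr// -subr_ge0.
  have -> : b ^+ 2 + a ^+ 2 - b * a * 2 = (a - b) ^+ 2 by ring.
  exact: sqr_ge0.
Qed.

Lemma sqn_onem_inner_gt0 n (z w : n.-tuple R[i]) : tsqn z < 1 -> tsqn w <= 1 -> 0 < sqn (1 - inner z w).
Proof.
move=> z1 w1; have h := normc_inner_le z w.
have h2 := le_normcD (1 - inner z w) (inner z w).
rewrite subrK normc1 in h2.
by rewrite -normc_sqr exprn_gt0//; lra.
Qed.

Lemma measurable_sqn_onem_inner n : measurable_fun setT
  (fun x : n.-tuple R[i] * n.-tuple R[i] => sqn (1 - inner x.1 x.2)).
Proof.
apply: (measurableT_comp measurable_sqn).
have -> : (fun x : n.-tuple R[i] * n.-tuple R[i] => 1 - inner x.1 x.2) =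
    (fun x => 1 + (-1) * inner x.1 x.2) by apply/funext => x; rewrite mulN1r.
apply: measurable_addC; first exact: measurable_cst.
by apply: measurable_mulC; [exact: measurable_cst|exact: measurable_inner].
Qed.

Lemma exprVn_powR (y : R) k : 0 <= y -> y ^- k.+1 = y `^ (- k.+1%:R).
Proof. by move=> y0; rewrite powRN powR_mulrn. Qed.

(** The kernel without its factor (1 - |z|^2)^(n+1), which would break the symmetry [bkerC]; the
    Schur test integrates it in either variable. *)
Definition bker n (z w : n.-tuple R[i]) : R := sqn (1 - inner z w) ^- n.+1.

Lemma bker_ge0 n (z w : n.-tuple R[i]) : 0 <= bker z w.
Proof. by rewrite invr_ge0 exprn_ge0// sqn_ge0. Qed.

Lemma bkerC n (z w : n.-tuple R[i]) : bker z w = bker w z.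
Proof.
rewrite /bker -sqn_conj rmorphB rmorph1 /inner rmorph_sum/=.
by under eq_bigr do rewrite rmorphM/= conjcK mulrC.
Qed.

Lemma measurable_bker n : measurable_fun setT
  (fun x : n.-tuple R[i] * n.-tuple R[i] => bker x.1 x.2).
Proof.
rewrite /bker; under eq_fun do rewrite (exprVn_powR _ (sqn_ge0 _)).
exact: (measurableT_comp (@measurable_powR R _) (@measurable_sqn_onem_inner n)).
Qed.

Lemma measurable_bkerr n (z : n.-tuple R[i]) : measurable_fun setT (bker z).
Proof. exact: (measurableT_comp (@measurable_bker n) (pair1_measurable z)). Qed.

Let inner_trot_conj n (z w : n.-tuple R[i]) u : u * inner z w = inner z (trot u^*%C w).
Proof. by rewrite inner_trot conjcK. Qed.

Lemma integral_ppow01 k phi : (forall r, 1 <= r -> phi r = 0) ->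
  (\int[mu]_r (ppow k r * phi r)%:E)%E = I01 (fun r => r ^+ k * phi r).
Proof.
move=> p1; under eq_integral do rewrite EFinM.
rewrite integral_ppow /I01 integral_mkcond [RHS]integral_mkcond.
apply: eq_integral => r _; rewrite !patchE !mem_setE !in_itv/= andbT.
case: (ltP 0 r) => //= r0; case: ltP => // r1.
by rewrite p1// mule0.
Qed.

Definition kappa_term x j r : R := ((m.+1 + j) * 'C(m.+1 + j, m.+1))%:R * x ^+ j * r ^+ (m + j).

(** Orthogonality leaves the squares of the coefficients times the moments. One binomial coefficient
    of each square cancels against the factorials of the moment, which leaves (n + j) 'C(n + j, n) /
    n! with n = [m.+1]. *)
Lemma integral_sqn_negbin z phi S : measurable_fun setT phi -> (forall r, 0 <= phi r) ->
  (forall r, 1 <= r -> phi r = 0) ->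
  (\int[L]_w (sqn (negbin m.+1 S (inner z w)) * phi (tsqn w))%:E =
   (A ^+ m.+1 / m.+1`!%:R)%:E * \sum_(0 <= j < S)
     I01 (fun r => kappa_term (tsqn z) j r * phi r)%R)%E.
Proof.
move=> mphi phi0 phi1; rewrite /negbin.
rewrite (@ge0_integral_ortho _ _ _ L (inner z) (fun w => phi (tsqn w)) (measurable_inner2 z) _ _ _ S
   (fun j => 'C(m.+1 + j, m.+1)%:R)); last 3 first.
- exact: (measurableT_comp mphi (@measurable_tsqn R m.+1)).
- by move=> t; exact: phi0.
- move=> u F u1 uN mF F0.
  have uc1 : sqn u^*%C = 1 by rewrite sqn_conj.
  have ucN : complex.Re u^*%C != -1 by move: uN; case: (u).
  pose f w : \bar R := (F (inner z w) * phi (tsqn w))%:E.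
  have mf : measurable_fun setT f.
    apply/measurable_EFinP; apply: measurable_funM.
      exact: (measurableT_comp mF (measurable_inner2 z)).
    exact: (measurableT_comp mphi (@measurable_tsqn R m.+1)).
  have f0 w : (0 <= f w)%E by rewrite lee_fin mulr_ge0.
  rewrite -(ge0_integral_trot uc1 ucN mf f0).
  by apply: eq_integral => w _; rewrite /f inner_trot_conj (tsqn_trot _ uc1).
have A0 := @disc_area_gt0 R.
rewrite big_mkord ge0_sume_distrr; last first.
  by move=> j _; apply: I01_ge0 => r r0 _; rewrite /kappa_term !mulr_ge0 ?exprn_ge0 ?tsqn_ge0// ltW.
apply: eq_bigr => j _; rewrite (integral_inner_moment z j mphi phi0) muleA -EFinM sqn_nat.
have c0 : 0 <= ((m.+1 + j) * 'C(m.+1 + j, m.+1))%:R * tsqn z ^+ j.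
  by rewrite mulr_ge0 ?exprn_ge0 ?tsqn_ge0.
rewrite integral_ppow01//.
have mr : measurable_fun (`]0%R, 1%R[%classic : set R) (EFin \o (fun r => r ^+ (m + j) * phi r)).
  apply/measurable_EFinP; apply: measurable_funM; first exact: measurable_funX.
  exact: measurable_funS mphi.
have -> : I01 (fun r => kappa_term (tsqn z) j r * phi r) =
    ((((m.+1 + j) * 'C(m.+1 + j, m.+1))%:R * tsqn z ^+ j)%:E * I01 (fun r => r ^+ (m + j) * phi r)%R)%E.
  rewrite /I01 -ge0_integralZl_EFin//.
    by apply: eq_integral => r _; rewrite -EFinM /kappa_term !mulrA.
  by move=> r /= /in01P[r0 _]; rewrite lee_fin mulr_ge0// exprn_ge0// ltW.
rewrite muleA -EFinM; congr (_%:E * _)%E.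
have nz k : k`!%:R != 0 :> R by rewrite pnatr_eq0 -lt0n fact_gt0.
have e : 'C(m.+1 + j, m.+1)%:R * (m.+1`!%:R * j`!%:R) = (m.+1 + j)%:R * (m + j)`!%:R :> R.
  have := bin_fact (leq_addr j m.+1); rewrite addKn => h.
  by rewrite -natrM -natrM h addSn factS natrM.
rewrite (natrM _ (m.+1 + j)); move: (nz m.+1) (nz (m + j)%N) e.
move: (m.+1`!%:R : R) ((m + j)`!%:R : R) (j`!%:R : R) ('C(_, _)%:R : R) ((m.+1 + j)%:R : R) => a b c d f a0 b0 e.
move: (tsqn z ^+ j) (A ^+ m.+1) => x y.
apply: (mulIf b0); apply: (mulIf a0).
transitivity (x * y * d * (d * (a * c))); first by field.
by rewrite e; field.
Qed.

(** Split the factor m + 1 + j. The part with m + 1 is a negative binomial series; the part with j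
    becomes one of the next order by j 'C(m + 1 + j, m + 1) = (m + 2) 'C(m + 1 + j, m + 2). *)
Lemma cvg_kappa_series (q : R) : 0 <= q < 1 ->
  (fun S => \sum_(0 <= j < S) ((m.+1 + j) * 'C(m.+1 + j, m.+1))%:R * q ^+ j) @ \oo -->
  (m.+1%:R + q) / (1 - q) ^+ m.+3.
Proof.
move=> q01; have /andP[q0 q1] := q01.
have q1n : 1 - q != 0 by rewrite gt_eqF// subr_gt0.
have sh (u : nat -> R) (l : R) : ((fun S => u S.+1) @ \oo --> l) = (u @ \oo --> l) := cvg_shiftS u (nbhs l).
rewrite -sh.
have E S : \sum_(0 <= j < S.+1) ((m.+1 + j) * 'C(m.+1 + j, m.+1))%:R * q ^+ j =
    m.+1%:R * negbin m.+1 S.+1 q + m.+2%:R * (q * negbin m.+2 S q).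
  rewrite big_mkord /negbin !mulr_sumr.
  transitivity (\sum_(j < S.+1) (m.+1%:R * ('C(m.+1 + j, m.+1)%:R * q ^+ j)) +
                \sum_(j < S.+1) ((j * 'C(m.+1 + j, m.+1))%:R * q ^+ j)).
    by rewrite -big_split/=; apply: eq_bigr => j _; rewrite mulnDl natrD natrM mulrDl mulrA.
  congr (_ + _); rewrite big_ord_recl mul0n mul0r add0r; apply: eq_bigr => j _.
  rewrite lift0; have -> : (j.+1 * 'C(m.+1 + j.+1, m.+1) = m.+2 * 'C(m.+2 + j, m.+2))%N.
    have := mul_bin_left (m.+1 + j.+1) m.+1; rewrite addKn => <-.
    by rewrite addnS addSn.
  by rewrite natrM exprS; move: ('C(_, _)%:R : R) (m.+2%:R : R) => a b; ring.
under eq_fun do rewrite E.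
have -> : (m.+1%:R + q) / (1 - q) ^+ m.+3 =
    m.+1%:R * (1 - q) ^- m.+2 + m.+2%:R * (q * (1 - q) ^- m.+3).
  by rewrite !exprS -(natr1 m.+1); field; rewrite q1n expf_neq0.
have c1 := cvg_negbin (d := m.+1) q01; rewrite -sh in c1.
have c2 := cvg_negbin (d := m.+2) q01.
have h := cvgD (cvgMl_tmp (a := m.+1%:R) c1) (cvgMl_tmp (a := m.+2%:R) (cvgMl_tmp (a := q) c2)); exact: h.
Qed.

Lemma I01_kappa_series x phi : 0 <= x < 1 -> measurable_fun setT phi -> (forall r, 0 <= phi r) ->
  I01 (fun r => phi r * kappa m x r) =
  (\sum_(0 <= j <oo) I01 (fun r => kappa_term x j r * phi r)%R)%E.
Proof.
move=> x01 mphi phi0; have /andP[x0 x1] := x01; have x1' := ltW x1.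
have mt j : measurable_fun (`]0%R, 1%R[%classic : set R) (fun r => (kappa_term x j r * phi r)%:E).
  apply/measurable_EFinP; apply: measurable_funM; last exact: measurable_funS mphi.
  by apply: measurable_funM => //; exact: measurable_funX.
rewrite -(integral_nneseries mu (measurable_itv _) mt); last first.
  move=> j r /= /in01P[r0 _]; rewrite lee_fin /kappa_term.
  by rewrite !mulr_ge0// exprn_ge0// ltW.
apply: eq_integral => r /set_mem/= /in01P[r0 r1].
have p := onem_mul_gt0 x0 x1' r0 r1.
have xr : 0 <= x * r < 1 by rewrite mulr_ge0 ?(ltW r0)//= -subr_gt0.
have h := cvg_kappa_series xr.
apply/esym/cvg_lim => //; apply: cvg_EFin.
  by apply: nearW => S; rewrite sumEFin.
have -> : fine \o (fun S => \sum_(0 <= j < S) (kappa_term x j r * phi r)%:E)%E =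
    (fun S => phi r * r ^+ m * \sum_(0 <= j < S) ((m.+1 + j) * 'C(m.+1 + j, m.+1))%:R * (x * r) ^+ j).
  apply/funext => S /=; rewrite sumEFin/= mulr_sumr; apply: eq_bigr => j _.
  rewrite /kappa_term exprD exprMn; ring.
have -> : phi r * kappa m x r = phi r * r ^+ m * ((m.+1%:R + x * r) / (1 - x * r) ^+ m.+3).
  by rewrite /kappa !mulrA.
exact: (cvgMl_tmp (a := phi r * r ^+ m) h).
Qed.

(** The kernel is |1 - <z, w>|^(-2(m+2)), the squared modulus of the full series. For every r < 1
    the integral with a long enough partial sum agrees with the kernel integral up to a factor r in
    either direction; then S tends to infinity and r to 1. Infinite values are covered. *)
Let bkernel_lebesgue z phi : tsqn z < 1 -> measurable_fun setT phi -> (forall r, 0 <= phi r) ->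
  (forall r, 1 <= r -> phi r = 0) ->
  (\int[L]_w (phi (tsqn w) * bker z w)%:E =
   (A ^+ m.+1 / m.+1`!%:R)%:E * I01 (fun r => phi r * kappa m (tsqn z) r)%R)%E.
Proof.
move=> z1 mphi phi0 phi1; set x := tsqn z; set C := A ^+ m.+1 / m.+1`!%:R.
have x01 : 0 <= x < 1 by rewrite tsqn_ge0 z1.
have C0 : 0 < C by rewrite divr_gt0 ?exprn_gt0 ?disc_area_gt0// ltr0n fact_gt0.
(* An upper bound below 1 for |<z, w>| on the ball, by [normc_inner_le]. *)
set q := (x + 1) / 2; have q1 : q < 1 by rewrite /q /x; lra.
pose t j := I01 (fun r => kappa_term x j r * phi r).
have t0 j : (0 <= t j)%E.
  by apply: I01_ge0 => r r0 _; rewrite /kappa_term !mulr_ge0 ?exprn_ge0 ?tsqn_ge0// ltW.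
pose a S w : R := sqn (negbin m.+1 S (inner z w)) * phi (tsqn w).
have mphit : measurable_fun setT (fun w => phi (tsqn w)).
  exact: (measurableT_comp mphi (@measurable_tsqn R m.+1)).
have ma S : measurable_fun setT (a S).
  apply: measurable_funM => //; apply: (measurableT_comp measurable_sqn).
  exact: (measurable_polyC (V := inner z) S (fun j => 'C(m.+1 + j, m.+1)%:R) (measurable_inner2 z)).
have a0 S w : 0 <= a S w by rewrite mulr_ge0// sqn_ge0.
have aE S : (\int[L]_w (a S w)%:E = C%:E * \sum_(0 <= j < S) t j)%E.
  exact: integral_sqn_negbin.
have md : measurable_fun setT (fun w => phi (tsqn w) * bker z w).
  by apply: measurable_funM => //; exact: measurable_bkerr.
have d0 w : 0 <= phi (tsqn w) * bker z w by rewrite mulr_ge0// bker_ge0.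
set D := (\int[L]_w (phi (tsqn w) * bker z w)%:E)%E.
have D0 : (0 <= D)%E by apply: integral_ge0 => w _; rewrite lee_fin.
have J0 : (0 <= \sum_(0 <= j <oo) t j)%E by apply: nneseries_ge0.
have near_a r : 0 < r < 1 -> \forall S \near \oo,
    (r%:E * D <= C%:E * \sum_(0 <= j < S) t j)%E /\
    (r%:E * (C%:E * \sum_(0 <= j < S) t j) <= D)%E.
  move=> r01; have /andP[r0 r1] := r01.
  have := sqn_negbin_near m.+1 q1 r01; apply: filterS => S Sr.
  have P w : r * (phi (tsqn w) * bker z w) <= a S w /\ r * a S w <= phi (tsqn w) * bker z w.
    have [w1|w1] := leP 1 (tsqn w); first by rewrite /a phi1// !(mul0r, mulr0) lexx.
    have uq : normc (inner z w) <= q.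
      by apply: (le_trans (normc_inner_le _ _)); rewrite /q ler_pM2r// lerD2l ltW.
    have d := sqn_onem_inner_gt0 z1 (ltW w1).
    have dn : 0 < sqn (1 - inner z w) ^+ m.+2 by rewrite exprn_gt0.
    have [h1 h2] := Sr _ uq; rewrite /a /bker; split.
      rewrite mulrCA mulrC ler_wpM2r// ler_pdivrMr//.
      by rewrite mulrC.
    rewrite mulrA mulrC ler_wpM2l// -[leRHS]mul1r ler_pdivlMr//.
    by rewrite -mulrA [X in r * X]mulrC.
  rewrite -aE; split; apply: ge0_scale_le_integral => //; try exact: ltW.
    by move=> w; have [] := P w.
  by move=> w; have [] := P w.
rewrite (I01_kappa_series x01)// -/t.
have cv : cvgn (fun S => \sum_(0 <= j < S) t j)%E by apply: is_cvg_nneseries.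
apply/eqP; rewrite eq_le; apply/andP; split.
- apply/lee_mul01Pr => // r r01.
  have [S _ /(_ S (leqnn S))[h _]] := near_a r r01.
  apply: (le_trans h); rewrite lee_wpmul2l ?lee_fin ?(ltW C0)//.
  exact: nneseries_lim_ge.
- apply/lee_mul01Pr; first by rewrite mule_ge0// lee_fin ltW.
  move=> r r01; have /andP[r0 r1] := r01.
  have rC : 0 < r * C := mulr_gt0 r0 C0.
  rewrite muleA -EFinM muleC -lee_pdivlMr//.
  apply: lime_le => //; have := near_a r r01; apply: filterS => S [_].
  by rewrite muleA -EFinM lee_pdivlMr// [X in _ -> (X <= _)%E]muleC.
Qed.

Local Notation B := (@unit_ball R m.+1).
Local Notation dv := (@dv R m.+1).

Lemma unit_ballP w : unit_ball w <-> tsqn w < 1.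
Proof.
have e0 : 0 <= enorm w by exact: sqrtr_ge0.
by rewrite /unit_ball/= -enorm_sqr -[X in _ <-> is_true (_ < X)](expr1n R 2) ltr_pXn2r ?nnegrE.
Qed.

Let mcut (phi : R -> R) : measurable_fun setT phi ->
  measurable_fun setT (fun r : R => if r < 1 then phi r else 0).
Proof.
move=> mphi; apply: measurable_fun_ifT => //.
by apply: measurable_fun_ltr => //; exact: measurable_cst.
Qed.

Let z0 : m.+1.-tuple R[i] := [tuple 0 | i < m.+1].

Let tsqn_z0 : tsqn z0 = 0.
Proof. by rewrite /tsqn big1// => i _; rewrite tnth_mktuple /sqn/= expr0n addr0. Qed.

Let z0_in : tsqn z0 < 1. Proof. by rewrite tsqn_z0. Qed.

Let bker_z0 w : bker z0 w = 1.
Proof.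
rewrite /bker /inner big1 ?subr0 ?sqn1 ?expr1n ?invr1// => i _.
by rewrite tnth_mktuple mul0r.
Qed.

(** At z = 0 the kernel is 1, so the kernel formula itself computes the volume. It comes in the same
    unit as in [bkernel_lebesgue], so that after normalization no constant is left. *)
Let volE : L B = (A ^+ m.+1 / m.+1`!%:R)%:E.
Proof.
have := bkernel_lebesgue z0_in (mcut (@measurable_cst _ _ _ _ setT (1 : R))).
have c0 (r : R) : 0 <= (if r < 1 then 1 else 0) :> R by case: ifP.
have c1 (r : R) : 1 <= r -> (if r < 1 then 1 else 0) = 0 :> R by move=> r1; rewrite ltNge r1.
rewrite /cst => /(_ c0 c1).
have -> : I01 (fun r => (if r < 1 then 1 else 0) * kappa m (tsqn z0) r) = 1%E.
  have zz : 0 <= (0 : R) < 1 by rewrite lexx ltr01.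
  have := I01_kappa m 0 zz; rewrite I01_gker0// mule1 subr0 powR1 => <-.
  by apply: eq_I01 => r r0 r1; rewrite -subr_gt0 r1 oppr0 powRr0 tsqn_z0.
have LB : L B = (\int[L]_w (\1_B w)%:E)%E.
  exact: (esym (etrans (integral_indic L measurableT (@measurable_unit_ball R m.+1)) (congr1 L (setIT B)))).
rewrite mule1 => <-; rewrite LB.
apply: eq_integral => w _; rewrite bker_z0 mulr1 indicE.
by congr (_%:E); case: ifPn => [/unit_ballP/mem_set->//|/negP h]; rewrite memNset// => /unit_ballP.
Qed.

Lemma ge0_integral_dv (g : m.+1.-tuple R[i] -> R) : measurable_fun setT g -> (forall w, 0 <= g w) ->
  (\int[dv]_(w in B) (g w)%:E =
   ((A ^+ m.+1 / m.+1`!%:R)^-1)%:E * \int[L]_w (if (tsqn w < 1)%R then g w else 0%R)%:E)%E.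
Proof.
move=> mg g0; have mB := @measurable_unit_ball R m.+1.
have k0 : 0 <= (A ^+ m.+1 / m.+1`!%:R)^-1.
  by rewrite invr_ge0 divr_ge0 ?exprn_ge0// ltW// disc_area_gt0.
rewrite (eq_measure_integral (mscale (NngNum k0) L)); last first.
  move=> X mX XB.
  change (((fine (L B))^-1)%:E * L (X `&` B) = ((A ^+ m.+1 / m.+1`!%:R)^-1)%:E * L X)%E.
  by rewrite volE (setIidl XB).
have mgB : measurable_fun B (fun w => (g w)%:E).
  by apply/measurable_EFinP; exact: measurable_funS mg.
have g0B w : B w -> (0 <= (g w)%:E)%E by rewrite lee_fin.
rewrite (ge0_integral_mscale L mB (NngNum k0) mgB g0B).
congr (_ * _)%E; rewrite integral_mkcond; apply: eq_integral => w _.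
rewrite patchE; case: ifPn => [/set_mem/unit_ballP->//|/negP h].
by case: ifPn => // /unit_ballP/mem_set.
Qed.

Lemma integral_bker z phi : tsqn z < 1 -> measurable_fun setT phi -> (forall r, 0 <= phi r) ->
  (\int[dv]_(w in B) (phi (tsqn w) * bker z w)%:E = I01 (fun r => phi r * kappa m (tsqn z) r)%R)%E.
Proof.
move=> z1 mphi phi0; rewrite ge0_integral_dv; last 2 first.
- apply: measurable_funM; last exact: measurable_bkerr.
  exact: (measurableT_comp mphi (@measurable_tsqn R m.+1)).
- by move=> w; rewrite mulr_ge0// bker_ge0.
have C0 : 0 < A ^+ m.+1 / m.+1`!%:R by rewrite divr_gt0 ?exprn_gt0 ?disc_area_gt0// ltr0n fact_gt0.
have p0 (r : R) : 0 <= (if r < 1 then phi r else 0) by case: ifP.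
have p1 (r : R) : 1 <= r -> (if r < 1 then phi r else 0) = 0 by move=> r1; rewrite ltNge r1.
transitivity (((A ^+ m.+1 / m.+1`!%:R)^-1)%:E *
    \int[L]_w ((if (tsqn w < 1)%R then phi (tsqn w) else 0%R) * bker z w)%:E)%E.
  by congr (_ * _)%E; apply: eq_integral => w _; case: ifP => //; rewrite mul0r.
rewrite (bkernel_lebesgue z1 (mcut mphi) p0 p1) muleA -EFinM mulVf ?gt_eqF// mul1e.
by apply: eq_I01 => r r0 r1; rewrite -subr_gt0 r1.
Qed.

Lemma integral_bker_powR z a : tsqn z < 1 ->
  (\int[dv]_(w in B) ((1 - tsqn w) `^ (- a) * bker z w)%:E =
   ((1 - tsqn z) `^ (- (m.+2%:R + a)))%:E * I01 (gker m a (tsqn z)))%E.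
Proof.
move=> z1; rewrite (@integral_bker z (fun r => (1 - r) `^ (- a)))//.
- by rewrite I01_kappa// tsqn_ge0.
- by apply: (measurableT_comp (@measurable_powR R _)); exact: measurable_funB.
- by move=> r; exact: powR_ge0.
Qed.

Lemma integral_dv_radial phi : measurable_fun setT phi -> (forall r, 0 <= phi r) ->
  (\int[dv]_(w in B) (phi (tsqn w))%:E = I01 (fun r => phi r * (m.+1%:R * r ^+ m))%R)%E.
Proof.
move=> mphi phi0.
transitivity (\int[dv]_(w in B) (phi (tsqn w) * bker z0 w)%:E)%E.
  by apply: eq_integral => w _; rewrite bker_z0 mulr1.
rewrite (integral_bker z0_in mphi phi0) tsqn_z0; apply: eq_I01 => r r0 r1; rewrite /kappa mul0r addr0 subr0 expr1n divr1.
by rewrite [r ^+ m * _]mulrC.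
Qed.

End kernel_integral.

(** * Norm estimates *)

Section jensen.
Local Open Scope ereal_scope.
Context d (T : measurableType d) (R : realType) (mu : {measure set T -> \bar R}).

Lemma integral_weight_powR (k G : T -> R) (p M : R) : (1 < p)%R ->
  measurable_fun setT k -> measurable_fun setT G ->
  (forall t, 0 <= k t)%R -> (forall t, 0 <= G t)%R ->
  \int[mu]_t (k t)%:E <= M%:E ->
  (\int[mu]_t (k t * G t)%:E) `^ p <= (M `^ (p - 1))%:E * \int[mu]_t (k t * G t `^ p)%:E.
Proof.
move=> p1 mk mG k0 G0 kM.
have p0 : (0 < p)%R by exact: lt_trans p1.
have pn : p != 0%R by rewrite gt_eqF.
have pm1 : (0 < p - 1)%R by rewrite subr_gt0.
have pm1n : (p - 1 != 0)%R by rewrite gt_eqF.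
pose q := (p / (p - 1))%R.
have q0 : (0 < q)%R by rewrite divr_gt0.
have qn : q != 0%R by rewrite gt_eqF.
have pq : (q^-1 + p^-1 = 1)%R by rewrite /q; field; rewrite pn pm1n.
have mk' a : measurable_fun setT (fun t => k t `^ a)%R.
  exact: (measurableT_comp (@measurable_powR R a) mk).
have mg : measurable_fun setT (fun t => k t `^ p^-1 * G t)%R by exact: measurable_funM.
have := hoelder mu (mk' q^-1%R) mg q0 p0 pq.
rewrite Lnorm1.
have -> : \int[mu]_x `|(EFin \o ((fun t => k t `^ q^-1) \* (fun t => k t `^ p^-1 * G t))%R) x| =
    \int[mu]_t (k t * G t)%:E.
  apply: eq_integral => t _ /=; rewrite ger0_norm; last by rewrite !mulr_ge0 ?powR_ge0.
  rewrite mulrA -powRD ?pq ?powRr1//.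
  by rewrite (gt_eqF ltr01) implyFb.
set I := \int[mu]_t _ => h.
have I0 : 0 <= I by apply: integral_ge0 => t _; rewrite lee_fin mulr_ge0.
have hp : I `^ p <= ('N[mu]_q%:E[EFin \o (fun t => k t `^ q^-1)%R] *
    'N[mu]_p%:E[EFin \o (fun t => k t `^ p^-1 * G t)%R]) `^ p.
  by apply: gt0_ler_poweR; rewrite ?(ltW p0)// in_itv/= ?leey ?andbT// mule_ge0// Lnorm_ge0.
apply: (le_trans hp); rewrite poweRM ?Lnorm_ge0// poweR_Lnorm//.
have -> : \int[mu]_x (`|(EFin \o (fun t => k t `^ p^-1 * G t)%R) x| `^ p) =
    \int[mu]_t (k t * G t `^ p)%:E.
  apply: eq_integral => t _ /=; rewrite ger0_norm; last by rewrite mulr_ge0 ?powR_ge0.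
  by rewrite powRM ?powR_ge0// -powRrM mulVf// powRr1.
apply: lee_wpmul2r; first by apply: integral_ge0 => t _; rewrite lee_fin mulr_ge0 ?powR_ge0.
have -> : p = (q * (p - 1))%R by rewrite /q; field.
rewrite poweRrM poweR_Lnorm//.
have -> : \int[mu]_x (`|(EFin \o (fun t => k t `^ q^-1)%R) x| `^ q) = \int[mu]_t (k t)%:E.
  apply: eq_integral => t _ /=; rewrite ger0_norm ?powR_ge0//.
  by rewrite -powRrM mulVf// powRr1.
have J0 : 0 <= \int[mu]_t (k t)%:E by apply: integral_ge0 => t _; rewrite lee_fin.
have -> : (q * (p - 1) - 1 = p - 1)%R by rewrite /q; field.
rewrite -poweR_EFin; apply: gt0_ler_poweR; rewrite ?(ltW pm1)// in_itv/= ?leey ?andbT//.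
exact: le_trans kM.
Qed.

End jensen.

(** * The normalized measure as a finite measure *)

Section dv_finite.
Local Open Scope ereal_scope.
Context (R : realType) (n : nat).

(* [dv] is only a measure; the alias carries the sigma-finiteness required by Fubini. *)
Definition dvf : set (n.-tuple R[i]) -> \bar R := @dv R n.

HB.instance Definition _ := Measure.on dvf.

Lemma dv_setT : @dv R n setT = 1.
Proof.
rewrite -(@dv_unit_ball R n).
change (((fine (lebesgue_Cn R n (@unit_ball R n)))^-1)%:E * lebesgue_Cn R n (setT `&` @unit_ball R n) =
  ((fine (lebesgue_Cn R n (@unit_ball R n)))^-1)%:E * lebesgue_Cn R n (@unit_ball R n `&` @unit_ball R n)).
by rewrite setTI setIid.
Qed.

Lemma dv_setC_unit_ball : @dv R n (~` @unit_ball R n) = 0.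
Proof.
change (((fine (lebesgue_Cn R n (@unit_ball R n)))^-1)%:E * lebesgue_Cn R n (~` @unit_ball R n `&` @unit_ball R n) = 0).
by rewrite setICl measure0 mule0.
Qed.

Let dvf_sigma_finite : sigma_finite setT dvf.
Proof.
exists (fun=> setT); first by rewrite bigcup_const.
by move=> _; split => //; rewrite /dvf dv_setT ltry.
Qed.

HB.instance Definition _ := Measure_isSigmaFinite.Build _ _ _ dvf dvf_sigma_finite.

Lemma integral_dvT (h : n.-tuple R[i] -> \bar R) : measurable_fun setT h -> (forall w, 0 <= h w) ->
  \int[@dv R n]_(w in @unit_ball R n) h w = \int[@dv R n]_w h w.
Proof.
move=> mh h0; rewrite [RHS](@ge0_negligible_integral _ _ _ (@dv R n) setT (~` @unit_ball R n))//.
- by rewrite setDE setCK setTI.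
- by apply: measurableC; exact: measurable_unit_ball.
- exact: dv_setC_unit_ball.
Qed.

Lemma measurable_dv_F (h : n.-tuple R[i] * n.-tuple R[i] -> \bar R) : measurable_fun setT h ->
  (forall x, 0 <= h x) ->
  measurable_fun setT (fun z => \int[@dv R n]_w h (z, w)).
Proof.
move=> mh h0; exact: (@measurable_fun_fubini_tonelli_F _ _ _ _ _ dvf h mh h0).
Qed.

Lemma dv_tonelli (h : n.-tuple R[i] * n.-tuple R[i] -> \bar R) : measurable_fun setT h ->
  (forall x, 0 <= h x) ->
  \int[@dv R n]_z \int[@dv R n]_w h (z, w) = \int[@dv R n]_w \int[@dv R n]_z h (z, w).
Proof.
move=> mh h0.
exact: (etrans (esym (@prod_measure_tonelli1 _ _ _ _ _ dvf dvf h mh h0)) (@prod_measure_tonelli2 _ _ _ _ _ dvf dvf h mh h0)).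
Qed.

End dv_finite.

(** * Schur's test for the kernel *)

Section schur_test.
Context (R : realType) (m : nat) (p : R).
Hypothesis p1 : 1 < p.
Local Notation T := (m.+1.-tuple R[i]).
Local Notation B := (@unit_ball R m.+1).
Local Notation dv := (@dv R m.+1).
Let s := p^-1.
Let c := gconst m s.
Implicit Types (z w : T).

Let p0 : 0 < p. Proof. exact: lt_trans p1. Qed.
Let s0 : 0 < s. Proof. by rewrite invr_gt0. Qed.
Let s1 : s < 1. Proof. by rewrite invf_lt1. Qed.
Let ps : p * s = 1. Proof. by rewrite mulfV// gt_eqF. Qed.

Let measurable_onem_powR a : measurable_fun setT (fun w : T => (1 - tsqn w) `^ a).
Proof.
apply: (measurableT_comp (@measurable_powR R a)); apply: measurable_funB => //.
exact: measurable_tsqn.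
Qed.

Variable F : T -> R.
Hypotheses (mF : measurable_fun setT F) (F0 : forall w, 0 <= F w).
Hypothesis FB : forall w, 1 <= tsqn w -> F w = 0.

Let mbkerF z (G : T -> R) : measurable_fun setT G -> measurable_fun setT (fun w => bker z w * G w).
Proof. by move=> mG; apply: measurable_funM => //; exact: measurable_bkerr. Qed.

Lemma measurable_bkerF : measurable_fun setT (fun z => \int[dv]_w (bker z w * F w)%:E)%E.
Proof.
apply: (@measurable_dv_F _ _ (fun x => (bker x.1 x.2 * F x.2)%:E)).
- apply/measurable_EFinP; apply: measurable_funM; first exact: measurable_bker.
  exact: (measurableT_comp mF measurable_snd).
- by move=> x; rewrite lee_fin mulr_ge0// bker_ge0.
Qed.

Let mFp : measurable_fun setT (fun w => F w `^ p).
Proof. exact: (measurableT_comp (@measurable_powR R p) mF). Qed.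

(** F^p divided by the (p - 1)-th power of the weight (1 - |w|^2)^(-s), since (p - 1) s = 1 - s. *)
Let Q w := F w `^ p * (1 - tsqn w) `^ (1 - s).

Let mQ : measurable_fun setT Q. Proof. exact: measurable_funM. Qed.

Let Q0 w : 0 <= Q w. Proof. by rewrite mulr_ge0 ?powR_ge0. Qed.

Let c_ge0 : 0 <= c. Proof. exact: gconst_ge0. Qed.

Let weight_bound z : tsqn z < 1 ->
  (\int[dv]_w (bker z w * (1 - tsqn w) `^ (- s))%:E <=
   (c * (1 - tsqn z) `^ (- (m.+2%:R + s)))%:E)%E.
Proof.
move=> z1; rewrite -integral_dvT; last 2 first.
- by apply/measurable_EFinP; exact: mbkerF.
- by move=> w; rewrite lee_fin mulr_ge0 ?bker_ge0 ?powR_ge0.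
under eq_integral do rewrite mulrC.
rewrite integral_bker_powR// mulrC EFinM; apply: lee_wpmul2l; first by rewrite lee_fin powR_ge0.
by apply: I01_gker_le => //; [exact: tsqn_ge0|rewrite addr_gt0// addr_gt0].
Qed.

(** The kernel integral with a = -(m + 1 + s). The condition at the end 1 becomes 1 - s > 0, and the
    exponent m + 1 + s is the one left over by [pointwise]. *)
Let dual_bound w : tsqn w < 1 ->
  (\int[dv]_z ((1 - tsqn z) `^ (m.+1%:R + s) * bker z w)%:E <=
   (c * (1 - tsqn w) `^ (- (1 - s)))%:E)%E.
Proof.
move=> w1; rewrite -integral_dvT; last 2 first.
- apply/measurable_EFinP; apply: measurable_funM => //.
  by under eq_fun do rewrite bkerC; exact: measurable_bkerr.
- by move=> z; rewrite lee_fin mulr_ge0 ?bker_ge0 ?powR_ge0.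
under eq_integral do rewrite bkerC -[m.+1%:R + s]opprK.
rewrite integral_bker_powR// mulrC EFinM /c -gconst_dual//.
have -> : m.+2%:R - (m.+1%:R + s) = 1 - s by rewrite -(natr1 m.+1); ring.
apply: lee_wpmul2l; first by rewrite lee_fin powR_ge0.
apply: I01_gker_le => //; first exact: tsqn_ge0.
- by rewrite (lt_trans _ (@ltr01 R))// oppr_lt0 addr_gt0.
- by rewrite opprD addrA subrr add0r addrC subr_gt0.
Qed.

(** Jensen's inequality for the density k, the kernel times the weight, and G, which is F divided by
    the weight; [weight_bound] controls the mass of k. *)
Let pointwise z : tsqn z < 1 ->
  ((((1 - tsqn z) ^+ m.+2)%:E * \int[dv]_w (bker z w * F w)%:E) `^ p <=
   (c `^ (p - 1))%:E * \int[dv]_w ((1 - tsqn z) `^ (m.+1%:R + s) * bker z w * Q w)%:E)%E.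
Proof.
move=> z1; have x0 : 0 < 1 - tsqn z by rewrite subr_gt0.
pose k w := bker z w * (1 - tsqn w) `^ (- s).
pose G w := F w * (1 - tsqn w) `^ s.
have h := @integral_weight_powR _ _ _ dv k G p _ p1 (mbkerF z (measurable_onem_powR _))
  (measurable_funM mF (measurable_onem_powR s)) _ _ (weight_bound z1).
have k0 w : 0 <= k w by rewrite mulr_ge0 ?bker_ge0 ?powR_ge0.
have G0 w : 0 <= G w by rewrite mulr_ge0 ?powR_ge0.
have {h} := h k0 G0.
have -> : (\int[dv]_w (k w * G w)%:E = \int[dv]_w (bker z w * F w)%:E)%E.
  apply: eq_integral => w _; congr (_%:E); rewrite /k /G.
  (* Off the open ball 1 - |w|^2 is not positive and its powers need not cancel, but F vanishes
     there. *)
  have [w1|w1] := leP 1 (tsqn w); first by rewrite FB// !(mul0r, mulr0).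
  rewrite powRN mulrACA [X in _ * X]mulrC -mulrA mulfV ?mulr1//.
  by rewrite gt_eqF// powR_gt0// subr_gt0.
have -> : (\int[dv]_w (k w * G w `^ p)%:E = \int[dv]_w (bker z w * Q w)%:E)%E.
  apply: eq_integral => w _; congr (_%:E); rewrite /k /G /Q.
  have [w1|w1] := leP 1 (tsqn w).
    by rewrite FB// !mul0r powR0 ?gt_eqF// !(mul0r, mulr0).
  have y0 : 0 < 1 - tsqn w by rewrite subr_gt0.
  rewrite powRM ?powR_ge0// -powRrM [s * p]mulrC ps -mulrA; congr (_ * _).
  rewrite mulrCA; congr (_ * _); rewrite -powRD ?(gt_eqF y0) ?implybT//.
  by congr (_ `^ _); rewrite addrC.
move=> h.
rewrite poweRM ?lee_fin ?exprn_ge0 ?(ltW x0)//; last first.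
  by apply: integral_ge0 => w _; rewrite lee_fin mulr_ge0 ?bker_ge0.
rewrite poweR_EFin.
apply: (@le_trans _ _ ((((1 - tsqn z) ^+ m.+2) `^ p)%:E *
   (((c * (1 - tsqn z) `^ (- (m.+2%:R + s))) `^ (p - 1))%:E * \int[dv]_w (bker z w * Q w)%:E))%E).
  by apply: lee_wpmul2l; rewrite ?lee_fin ?powR_ge0.
rewrite muleA -EFinM.
have -> : (\int[dv]_w ((1 - tsqn z) `^ (m.+1%:R + s) * bker z w * Q w)%:E =
   ((1 - tsqn z) `^ (m.+1%:R + s))%:E * \int[dv]_w (bker z w * Q w)%:E)%E.
  rewrite -ge0_integralZl_EFin ?powR_ge0//.
  - by apply: eq_integral => w _; rewrite -EFinM -[in LHS]mulrA.
  - by move=> w _; rewrite lee_fin mulr_ge0 ?bker_ge0.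
  - by apply/measurable_EFinP; exact: mbkerF.
rewrite muleA -EFinM; apply: lee_wpmul2r.
  by apply: integral_ge0 => w _; rewrite lee_fin mulr_ge0 ?bker_ge0.
rewrite lee_fin -powR_mulrn ?(ltW x0)// powRM ?powR_ge0// -!powRrM mulrCA.
rewrite -powRD ?(gt_eqF x0) ?implybT//.
(* The power of 1 - |z|^2: (m + 2) p from the factor of the transform, and -(m + 2 + s)(p - 1) from
   the mass of k. *)
suff -> : m.+2%:R * p + - (m.+2%:R + s) * (p - 1) = m.+1%:R + s by [].
transitivity (m.+2%:R + s - p * s); first by ring.
by rewrite ps -(natr1 m.+1); ring.
Qed.

(* Schur test with the weight [(1 - |w|^2) `^ (- s)], [s = p^-1]; the constants of the two
   weight estimates agree by [gconst_dual]. *)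
Lemma schur_bound :
  (\int[dv]_(z in B) (((1 - tsqn z) ^+ m.+2)%:E * \int[dv]_w (bker z w * F w)%:E) `^ p <=
   (c `^ p)%:E * \int[dv]_w (F w `^ p)%:E)%E.
Proof.
pose h (x : T * T) : \bar R := ((1 - tsqn x.1) `^ (m.+1%:R + s) * bker x.1 x.2 * Q x.2)%:E.
have h0 x : (0 <= h x)%E by rewrite lee_fin !mulr_ge0 ?powR_ge0 ?bker_ge0.
have mh : measurable_fun setT h.
  apply/measurable_EFinP; apply: measurable_funM; last exact: (measurableT_comp mQ measurable_snd).
  apply: measurable_funM; last exact: measurable_bker.
  exact: (measurableT_comp (measurable_onem_powR _) measurable_fst).
have mI := measurable_dv_F mh h0.
have I0 z : (0 <= \int[dv]_w h (z, w))%E by exact: integral_ge0.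
have cp0 : 0 <= c `^ (p - 1) by exact: powR_ge0.
apply: (@le_trans _ _ (\int[dv]_(z in B) ((c `^ (p - 1))%:E * \int[dv]_w h (z, w))))%E.
  apply: ge0_le_integral => //.
  - exact: measurable_unit_ball.
  - by move=> z _; exact: poweR_ge0.
  - apply: (measurableT_comp (measurable_poweR p)).
    apply: emeasurable_funM; last exact: measurable_funS measurable_bkerF.
    apply/measurable_EFinP; apply: measurable_funX; apply: measurable_funB => //.
    exact: measurable_funS (@measurable_tsqn R m.+1).
  - by apply: measurable_funeM; exact: measurable_funS mI.
  - by move=> z /unit_ballP z1; exact: pointwise.
rewrite integral_dvT; last 2 first.
- exact: measurable_funeM.
- by move=> z; rewrite mule_ge0.
rewrite ge0_integralZl_EFin// dv_tonelli//.
(* The power c^(p-1) comes from [pointwise], the last factor c from [dual_bound]. *)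
have -> : c `^ p = c `^ (p - 1) * c.
  have [->|cn] := eqVneq c 0; first by rewrite powR0 ?gt_eqF// mulr0.
  by rewrite -[X in _ * X]powRr1// -powRD ?cn ?implybT// subrK.
rewrite EFinM -muleA; apply: lee_wpmul2l => //.
have mFpE : measurable_fun setT (fun w => (F w `^ p)%:E) by exact/measurable_EFinP.
rewrite -ge0_integralZl_EFin//; last by move=> w _; rewrite lee_fin powR_ge0.
have mI' : measurable_fun setT (fun w => \int[dv]_z h (z, w))%E.
  apply: (@measurable_dv_F _ _ (fun x => h (x.2, x.1))); last by move=> x; exact: h0.
  exact: (measurableT_comp mh (measurable_fun_pair measurable_snd measurable_fst)).
have I0' w : setT w -> (0 <= \int[dv]_z h (z, w))%E by move=> _; exact: integral_ge0.
refine (@ge0_le_integral _ _ _ dv setT measurableT _ _ I0' mI' (measurable_funeM _ mFpE) _).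
move=> w _; have [w1|w1] := leP 1 (tsqn w).
  rewrite /h/= /Q FB// powR0 ?gt_eqF// mule0.
  by under eq_integral do rewrite mul0r mulr0; rewrite integral0.
rewrite /h/=; under eq_integral do rewrite EFinM muleC.
have mz : measurable_fun setT (fun z => ((1 - tsqn z) `^ (m.+1%:R + s) * bker z w)%:E).
  apply/measurable_EFinP; apply: measurable_funM => //.
  by under eq_fun do rewrite bkerC; exact: measurable_bkerr.
rewrite ge0_integralZl_EFin//; last by move=> z _; rewrite lee_fin mulr_ge0 ?powR_ge0 ?bker_ge0.
apply: (le_trans (lee_wpmul2l _ (dual_bound w1))); first by rewrite lee_fin.
have y0 : 0 < 1 - tsqn w by rewrite subr_gt0.
rewrite -!EFinM lee_fin /Q powRN.
have := powR_gt0 (1 - s) y0; move: ((1 - tsqn w) `^ (1 - s)) (F w `^ p) => b a b0.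
have -> : a * b * (c * b^-1) = c * a by field; rewrite gt_eqF.
exact: lexx.
Qed.

End schur_test.

(** * Upper bounds for the transform *)

Section berezin_bounds.
Context (R : realType) (m : nat).
Local Notation T := (m.+1.-tuple R[i]).
Local Notation B := (@unit_ball R m.+1).
Local Notation dv := (@dv R m.+1).
Local Notation normc := (@ComplexField.Normc.normc R).
Implicit Types (z w : T) (f g : T -> R[i]).

Let mB : measurable B. Proof. exact: measurable_unit_ball. Qed.

Lemma complex_re_im (z : R[i]) a b :
  a * complex.Re z + b * complex.Im z <= Num.sqrt (a ^+ 2 + b ^+ 2) * normc z.
Proof.
rewrite normc_sqn -sqrtrM ?addr_ge0 ?sqr_ge0// /sqn; case: z => x y /=.
apply: le_trans (ler_norm _) _; rewrite -sqrtr_sqr ler_wsqrtr//.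
rewrite -subr_ge0; have -> : (a ^+ 2 + b ^+ 2) * (x ^+ 2 + y ^+ 2) - (a * x + b * y) ^+ 2 =
   (a * y - b * x) ^+ 2 by ring.
exact: sqr_ge0.
Qed.

Lemma normRe_le (z : R[i]) : `|complex.Re z| <= normc z.
Proof.
by rewrite normc_sqn -sqrtr_sqr ler_wsqrtr// /sqn lerDl sqr_ge0.
Qed.

Lemma normIm_le (z : R[i]) : `|complex.Im z| <= normc z.
Proof.
by rewrite normc_sqn -sqrtr_sqr ler_wsqrtr// /sqn lerDr sqr_ge0.
Qed.

Lemma measurable_normc : measurable_fun setT normc.
Proof.
rewrite (_ : normc = (@Num.sqrt R) \o sqn); last by apply/funext => z; exact: normc_sqn.
apply: measurableT_comp; last exact: measurable_sqn.
by apply: continuous_measurable_fun; exact: sqrt_continuous.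
Qed.

(** With a + i b the integral and r its modulus, r^2 = a^2 + b^2 is the integral of a Re g + b Im g,
    hence at most r times the integral of |g| by Cauchy-Schwarz in the plane. If |g| has infinite
    integral there is nothing to prove. *)
Lemma normc_cintegral_le g : measurable_fun B g ->
  ((normc (cintegral g))%:E <= \int[dv]_(w in B) (normc (g w))%:E)%E.
Proof.
move=> mg.
have mN : measurable_fun B (fun w => (normc (g w))%:E).
  by apply/measurable_EFinP; exact: (measurableT_comp measurable_normc mg).
have [I0|] := ltP (\int[dv]_(w in B) (normc (g w))%:E)%E +oo%E; last first.
  by rewrite leye_eq => /eqP ->; rewrite leey.
have iN : dv.-integrable B (EFin \o (fun w => normc (g w))).
  apply/integrableP; split => //.
  by under eq_integral do rewrite /= (ger0_norm (normc_ge0 _)).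
have iR : dv.-integrable B (EFin \o (fun w => complex.Re (g w))).
  apply: le_integrable iN => //.
    by apply/measurable_EFinP; exact: (measurableT_comp (@measurable_complexRe R) mg).
  by move=> w _ /=; rewrite lee_fin [leRHS]ger0_norm ?normc_ge0// normRe_le.
have iI : dv.-integrable B (EFin \o (fun w => complex.Im (g w))).
  apply: le_integrable iN => //.
    by apply/measurable_EFinP; exact: (measurableT_comp (@measurable_complexIm R) mg).
  by move=> w _ /=; rewrite lee_fin [leRHS]ger0_norm ?normc_ge0// normIm_le.
have fN : (\int[dv]_(w in B) (normc (g w))%:E)%E \is a fin_num.
  by rewrite ge0_fin_numE// integral_ge0// => w _; rewrite lee_fin normc_ge0.
rewrite -(fineK fN) lee_fin -[leRHS]/(\int[dv]_(w in B) normc (g w)).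
set r := normc _; set J := \int[dv]_(w in B) normc (g w).
have r0 : 0 <= r by exact: normc_ge0.
have [->|rn] := eqVneq r 0.
  by apply: fine_ge0; apply: integral_ge0 => w _; rewrite lee_fin normc_ge0.
have rp : 0 < r by rewrite lt_neqAle eq_sym rn.
rewrite -(ler_pM2l rp).
pose a := \int[dv]_(w in B) complex.Re (g w); pose b := \int[dv]_(w in B) complex.Im (g w).
have rE : r = Num.sqrt (a ^+ 2 + b ^+ 2) by rewrite /r normc_sqn.
have -> : r * r = a * a + b * b.
  by rewrite -expr2 rE sqr_sqrtr ?addr_ge0 ?sqr_ge0// !expr2.
have iZ (k : R) (h : T -> R) : dv.-integrable B (EFin \o h) -> dv.-integrable B (EFin \o (fun w => k * h w)).
  move=> ih; have -> : EFin \o (fun w => k * h w) = (fun w => k%:E * (EFin \o h) w)%E by [].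
  exact: integrableZl.
rewrite -(RintegralZl a mB iR) -(RintegralZl b mB iI) -RintegralD//; [|exact: iZ..].
rewrite -(RintegralZl r mB iN); apply: le_Rintegral => //.
- exact: (integrableD mB (iZ a _ iR) (iZ b _ iI)).
- exact: iZ.
- by move=> w _; rewrite rE complex_re_im.
Qed.

Let kern z w : R := (1 - tsqn z) ^+ m.+2 * bker z w.

Lemma berezinE f z : berezin R m.+1 f z = cintegral (fun w => (kern z w)%:C%C * f w).
Proof.
rewrite /berezin; congr cintegral; apply/funext => w; congr (_%:C%C * _).
rewrite /kern enorm_sqr; congr (_ * _); rewrite /bker -normc_sqr -exprM.
by congr (_ ^- _); rewrite [RHS]mulnS addnC.
Qed.

Definition cutnorm f : T -> R := (normc \o f) \_ B.

Lemma measurable_cutnorm f : measurable_fun B f -> measurable_fun setT (cutnorm f).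
Proof.
by move=> mf; apply/(measurable_restrictT _ mB); exact: (measurableT_comp measurable_normc mf).
Qed.

Lemma cutnorm_ge0 f w : 0 <= cutnorm f w.
Proof. by rewrite /cutnorm patchE; case: ifP => // _; exact: normc_ge0. Qed.

Lemma cutnorm_out f w : 1 <= tsqn w -> cutnorm f w = 0.
Proof.
move=> w1; rewrite /cutnorm patchE memNset// => /unit_ballP.
by rewrite ltNge w1.
Qed.

Lemma cutnorm_in f w : tsqn w < 1 -> cutnorm f w = normc (f w).
Proof. by move=> /unit_ballP w1; rewrite /cutnorm patchE mem_set. Qed.

Lemma normc_real (x : R) : normc x%:C%C = `|x|.
Proof. by rewrite /= expr0n addr0 sqrtr_sqr. Qed.

Lemma measurable_real_mulC (k : T -> R) f D : measurable D -> measurable_fun setT k ->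
  measurable_fun D f -> measurable_fun D (fun w => (k w)%:C%C * f w).
Proof.
move=> mD mk mf; apply/(measurable_restrictT _ mD).
have -> : (fun w => (k w)%:C%C * f w) \_ D = (fun w => (k w)%:C%C * (f \_ D) w).
  by apply/funext => w; rewrite !patchE; case: ifP => // _; rewrite [point]/(0 : R[i]) mulr0.
apply: measurable_mulC; last exact/(measurable_restrictT _ mD).
by apply: measurable_complexP => //=; exact: measurable_cst.
Qed.

Let measurable_kern z : measurable_fun setT (kern z).
Proof. by apply: measurable_funM; [exact: measurable_cst|exact: measurable_bkerr]. Qed.

Lemma normc_berezin_le f z : measurable_fun B f -> tsqn z < 1 ->
  ((normc (berezin R m.+1 f z))%:E <=
   ((1 - tsqn z) ^+ m.+2)%:E * \int[dv]_w (bker z w * cutnorm f w)%:E)%E.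
Proof.
move=> mf z1; rewrite berezinE.
apply: (le_trans (normc_cintegral_le (measurable_real_mulC mB (measurable_kern z) mf))).
have x0 : 0 <= 1 - tsqn z by rewrite subr_ge0 ltW.
have mh : measurable_fun setT (fun w => (bker z w * cutnorm f w)%:E).
  apply/measurable_EFinP; apply: measurable_funM; first exact: measurable_bkerr.
  exact: measurable_cutnorm.
have h0 w : (0 <= (bker z w * cutnorm f w)%:E)%E.
  by rewrite lee_fin mulr_ge0 ?bker_ge0 ?cutnorm_ge0.
rewrite -(integral_dvT mh h0) -ge0_integralZl_EFin ?exprn_ge0//; last exact: measurable_funS mh.
rewrite le_eqVlt; apply/orP; left; apply/eqP; apply: eq_integral => w /set_mem/unit_ballP w1.
rewrite cutnorm_in// normcM normc_real ger0_norm.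
  by rewrite -EFinM mulrA.
by rewrite mulr_ge0 ?exprn_ge0 ?bker_ge0.
Qed.

Let measurable_kern_integral (g : T -> R) : measurable_fun setT g ->
  measurable_fun setT (fun z => fine (\int[dv]_w (kern z w * g w)%:E)%E).
Proof.
move=> mg; apply: measurableT_comp; first exact: fine_measurable.
pose h (x : T * T) : \bar R := (kern x.1 x.2 * g x.2)%:E.
have mh : measurable_fun setT h.
  apply/measurable_EFinP; apply: measurable_funM; last exact: (measurableT_comp mg measurable_snd).
  apply: measurable_funM; last exact: measurable_bker.
  apply: measurable_funX; apply: measurable_funB => //.
  exact: (measurableT_comp (@measurable_tsqn R m.+1) measurable_fst).
(* The integral is by definition the difference of those of the positive and negative parts, so the
   identity holds even where the integrand is not integrable; Tonelli makes each part measurable in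
   z. *)
have -> : (fun z => \int[dv]_w (kern z w * g w)%:E)%E =
    (fun z => \int[dv]_w (h^\+ (z, w)) - \int[dv]_w (h^\- (z, w)))%E.
  apply/funext => z; have := integralE dv setT (h \o pair z).
  by rewrite funepos_comp funeneg_comp.
apply: emeasurable_funB; apply: measurable_dv_F.
- exact: measurable_funepos.
- by move=> x; exact: funepos_ge0.
- exact: measurable_funeneg.
- by move=> x; exact: funeneg_ge0.
Qed.

Let kern_restrict z (h : T -> R) :
  fine (\int[dv]_(w in B) (kern z w * h w)%:E)%E = fine (\int[dv]_w (kern z w * (h \_ B) w)%:E)%E.
Proof.
congr fine; rewrite integral_mkcond; apply: eq_integral => w _.
by rewrite !patchE; case: ifP => // _; rewrite mulr0.
Qed.

Lemma measurable_berezin f : measurable_fun B f -> measurable_fun setT (berezin R m.+1 f).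
Proof.
move=> mf; apply: measurable_complexP.
- have -> : (fun z => complex.Re (berezin R m.+1 f z)) =
      (fun z => fine (\int[dv]_w (kern z w * ((fun w => complex.Re (f w)) \_ B) w)%:E)%E).
    apply/funext => z; rewrite berezinE -kern_restrict /=; congr fine; apply: eq_integral => w _.
    by case: (f w) => a b /=; rewrite mul0r subr0.
  apply: measurable_kern_integral; apply/(measurable_restrictT _ mB).
  exact: (measurableT_comp (@measurable_complexRe R) mf).
- have -> : (fun z => complex.Im (berezin R m.+1 f z)) =
      (fun z => fine (\int[dv]_w (kern z w * ((fun w => complex.Im (f w)) \_ B) w)%:E)%E).
    apply/funext => z; rewrite berezinE -kern_restrict /=; congr fine; apply: eq_integral => w _.
    by case: (f w) => a b /=; rewrite mul0r addr0.
  apply: measurable_kern_integral; apply/(measurable_restrictT _ mB).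
  exact: (measurableT_comp (@measurable_complexIm R) mf).
Qed.

Lemma Lp_normE (p : R) f : 0 < p ->
  Lp_norm R m.+1 p%:E f = ((\int[dv]_w (cutnorm f w `^ p)%:E) `^ p^-1)%E.
Proof.
move=> p0; rewrite /Lp_norm [@Lnorm]unlock; congr (_ `^ _)%E.
by apply: eq_integral => w _; rewrite /= ger0_norm// cutnorm_ge0.
Qed.

Lemma Lp_norm_berezin_le (p : R) f : 1 < p -> measurable_fun B f ->
  (Lp_norm R m.+1 p%:E (berezin R m.+1 f) <= (gconst m p^-1)%:E * Lp_norm R m.+1 p%:E f)%E.
Proof.
move=> p1 mf; have p0 : 0 < p by exact: lt_trans p1.
have pn : p != 0 by rewrite gt_eqF.
have mF := measurable_cutnorm mf.
have F0 := cutnorm_ge0 f.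
have mbf := measurable_funS measurableT (@subsetT _ B) (measurable_berezin mf).
have c0 := @gconst_ge0 R m p^-1.
have I0 h : (0 <= \int[dv]_w (cutnorm h w `^ p)%:E)%E.
  by apply: integral_ge0 => w _; rewrite lee_fin powR_ge0.
rewrite !Lp_normE//.
have -> : (gconst m p^-1)%:E = (((gconst m p^-1) `^ p)%:E `^ p^-1)%E.
  by rewrite poweR_EFin -powRrM mulfV// powRr1.
rewrite -poweRM ?lee_fin ?powR_ge0//.
apply: gt0_ler_poweR; rewrite ?invr_ge0 ?(ltW p0)// ?in_itv/= ?leey ?andbT ?mule_ge0 ?lee_fin ?powR_ge0//.
apply: le_trans (schur_bound p1 mF F0 (@cutnorm_out f)).
have mp : measurable_fun setT (fun w => (cutnorm (berezin R m.+1 f) w `^ p)%:E).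
  apply/measurable_EFinP; apply: (measurableT_comp (@measurable_powR R p)).
  exact: measurable_cutnorm.
rewrite -integral_dvT//; last by move=> w; rewrite lee_fin powR_ge0.
have mb : measurable_fun B (fun z => (((1 - tsqn z) ^+ m.+2)%:E *
    \int[dv]_w (bker z w * cutnorm f w)%:E) `^ p)%E.
  apply: (measurableT_comp (measurable_poweR p)).
  apply: emeasurable_funM; last exact: measurable_funS (measurable_bkerF mF F0).
  apply/measurable_EFinP; apply: measurable_funX; apply: measurable_funB => //.
  exact: measurable_funS (@measurable_tsqn R m.+1).
have pos z : B z -> (0 <= (cutnorm (berezin R m.+1 f) z `^ p)%:E)%E by rewrite lee_fin powR_ge0.
refine (@ge0_le_integral _ _ _ dv B mB _ _ pos (measurable_funS measurableT (@subsetT _ B) mp) mb _).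
move=> z /unit_ballP z1; rewrite cutnorm_in// -poweR_EFin.
have le := normc_berezin_le mf z1.
have n0 : (0 <= (normc (berezin R m.+1 f z))%:E)%E by rewrite lee_fin normc_ge0.
apply: (gt0_ler_poweR (ltW p0)) => //; rewrite in_itv; apply/andP; split; try exact: leey.
  exact: n0.
exact: le_trans le.
Qed.

Lemma Linfty_normE f : Lp_norm R m.+1 +oo f = ess_sup dv (fun w => (cutnorm f w)%:E).
Proof.
rewrite /Lp_norm [@Lnorm]unlock dv_setT lte01; congr ess_sup.
by apply/funext => w; rewrite /= ger0_norm// cutnorm_ge0.
Qed.

Lemma Linfty_norm_berezin_le f : measurable_fun B f -> (Lp_norm R m.+1 +oo f < +oo)%E ->
  (Lp_norm R m.+1 +oo (berezin R m.+1 f) <= Lp_norm R m.+1 +oo f)%E.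
Proof.
move=> mf foo; have F0 := Lnorm_ge0 dv +oo%E (EFin \o cutnorm f).
have fin : Lp_norm R m.+1 +oo f \is a fin_num by rewrite ge0_fin_numE.
pose M := fine (Lp_norm R m.+1 +oo f).
have M0 : 0 <= M by apply: fine_ge0.
have fM : (\forall w \ae dv, (cutnorm f w)%:E <= M%:E)%E.
  by apply/ess_supP; rewrite -Linfty_normE fineK.
rewrite -(fineK fin) -/M Linfty_normE; apply/ess_supP; apply: nearW => z.
have [z1|z1] := leP 1 (tsqn z); first by rewrite cutnorm_out.
rewrite cutnorm_in//; apply: (le_trans (normc_berezin_le mf z1)).
have x0 : 0 < 1 - tsqn z by rewrite subr_gt0.
have mk : measurable_fun setT (fun w => (bker z w)%:E) by apply/measurable_EFinP; exact: measurable_bkerr.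
have k0 w : (0 <= (bker z w)%:E)%E by rewrite lee_fin bker_ge0.
(* The case a = 0: with the factor (1 - |z|^2)^(n+1), the kernel is a probability density. *)
have kI : (\int[dv]_w (bker z w)%:E = ((1 - tsqn z) ^- m.+2)%:E)%E.
  rewrite -integral_dvT//.
  have := integral_bker_powR 0 z1; rewrite addr0 I01_gker0 ?tsqn_ge0// mule1 powRN powR_mulrn ?(ltW x0)// => <-.
  by apply: eq_integral => w _; rewrite oppr0 powRr0 mul1r.
apply: (@le_trans _ _ (((1 - tsqn z) ^+ m.+2)%:E * (M%:E * \int[dv]_w (bker z w)%:E)))%E.
  apply: lee_wpmul2l; first by rewrite lee_fin exprn_ge0// ltW.
  rewrite -ge0_integralZl_EFin//.
  have mF := measurable_cutnorm mf.
  apply: ae_ge0_le_integral => //.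
  - by move=> w _; rewrite lee_fin mulr_ge0 ?bker_ge0 ?cutnorm_ge0.
  - by apply/measurable_EFinP; apply: measurable_funM => //; exact: measurable_bkerr.
  - by move=> w _; rewrite mule_ge0.
  - exact: measurable_funeM.
  - apply: filterS fM => w; rewrite lee_fin => fM _.
    by rewrite -EFinM lee_fin mulrC ler_wpM2r// bker_ge0.
rewrite kI -!EFinM lee_fin mulrCA mulfV ?mulr1//.
by rewrite expf_neq0// gt_eqF.
Qed.

End berezin_bounds.

(** * Test functions for the lower bounds *)

Section berezin_lower_bound.
Context (R : realType) (m : nat).
Local Notation T := (m.+1.-tuple R[i]).
Local Notation B := (@unit_ball R m.+1).
Local Notation dv := (@dv R m.+1).
Local Notation normc := (@ComplexField.Normc.normc R).
Implicit Types (z w : T).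

(** The nearly extremal functions, with l a normalizing constant. For l = 1 and a = 0 it is the
    constant function 1. *)
Definition radial_power (l a : R) (w : T) : R[i] := ((l * (1 - tsqn w) `^ (- a))%:C)%C.

Let mrad a : measurable_fun setT (fun w : T => (1 - tsqn w) `^ a).
Proof.
apply: (measurableT_comp (@measurable_powR R a)); apply: measurable_funB => //.
exact: measurable_tsqn.
Qed.

Lemma measurable_radial_power l a : measurable_fun setT (radial_power l a).
Proof.
apply: measurable_complexP => /=; last exact: measurable_cst.
exact: measurable_funM.
Qed.

Lemma normc_radial_power l a w : 0 <= l -> normc (radial_power l a w) = l * (1 - tsqn w) `^ (- a).
Proof. by move=> l0; rewrite normc_real ger0_norm// mulr_ge0 ?powR_ge0. Qed.

Lemma berezin_radial_power l a z : 0 <= l -> tsqn z < 1 ->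
  berezin R m.+1 (radial_power l a) z =
  ((fine ((l * (1 - tsqn z) `^ (- a))%:E * I01 (gker m a (tsqn z)))%E)%:C)%C.
Proof.
move=> l0 z1; rewrite berezinE; have x0 : 0 < 1 - tsqn z by rewrite subr_gt0.
apply/eqP; rewrite eq_complex/=; apply/andP; split; apply/eqP; last first.
  rewrite /Rintegral (_ : \int[_]_(_ in _) _ = 0)%E//.
  rewrite -[RHS](integral0 dv B); apply: eq_integral => w _.
  by rewrite mulr0 mul0r addr0.
rewrite /Rintegral; congr fine.
have k0 : 0 <= l * (1 - tsqn z) ^+ m.+2 by rewrite mulr_ge0// exprn_ge0// ltW.
transitivity (\int[dv]_(w in B) ((l * (1 - tsqn z) ^+ m.+2)%:E * ((1 - tsqn w) `^ (- a) * bker z w)%:E))%E.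
  by apply: eq_integral => w _; rewrite mul0r subr0 -EFinM; congr (_%:E); ring.
rewrite ge0_integralZl_EFin//; last 3 first.
- exact: measurable_unit_ball.
- by move=> w _; rewrite lee_fin mulr_ge0 ?powR_ge0 ?bker_ge0.
- apply/measurable_EFinP; apply: (measurable_funS measurableT) => //.
  by apply: measurable_funM => //; exact: measurable_bkerr.
rewrite integral_bker_powR// muleA -EFinM; congr (_%:E * _)%E.
rewrite -mulrA; congr (_ * _); rewrite opprD powRD; last by rewrite (gt_eqF x0) implybT.
rewrite (powRN _ m.+2%:R) powR_mulrn ?(ltW x0)// mulrA mulfV ?mul1r//.
by rewrite expf_neq0// gt_eqF.
Qed.

Lemma ae_unit_ball : \forall w \ae dv, B w.
Proof.
exists (~` B); split => //; first by apply: measurableC; exact: measurable_unit_ball.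
exact: dv_setC_unit_ball.
Qed.

Lemma Linfty_berezin_cst1 : (Lp_norm R m.+1 +oo (radial_power 1 0) <= 1)%E /\
  (1 <= Lp_norm R m.+1 +oo (berezin R m.+1 (radial_power 1 0)))%E.
Proof.
rewrite !Linfty_normE; split.
  apply/ess_supP; apply: nearW => w; rewrite lee_fin.
  have [w1|w1] := leP 1 (tsqn w); first by rewrite cutnorm_out.
  by rewrite cutnorm_in// normc_radial_power// oppr0 powRr0 mulr1.
apply: ess_sup_gee; first by rewrite dv_setT lte01.
apply: filterS ae_unit_ball => w /unit_ballP w1; rewrite lee_fin cutnorm_in//.
rewrite berezin_radial_power// I01_gker0 ?tsqn_ge0// oppr0 powRr0 mulr1 mule1/=.
by rewrite expr1n expr0n addr0 sqrtr1.
Qed.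

(** Obtained from [powR_le_Bernoulli] at the base a^q with the exponent 1/q. *)
Lemma powR_ge_Bernoulli (a q : R) : 0 < a -> 1 < q -> 1 + q * (a - 1) <= a `^ q.
Proof.
move=> a0 q1; have q0 : 0 < q by exact: lt_trans q1.
have qn : q != 0 by rewrite gt_eqF.
have s01 : 0 <= q^-1 <= 1 by rewrite invr_ge0 (ltW q0) invf_le1// ltW.
have := @powR_le_Bernoulli R (a `^ q) q^-1 (powR_gt0 _ a0) s01.
rewrite -powRrM mulfV// powRr1 ?(ltW a0)// -lerBlDl -(ler_pM2l q0) mulrA mulfV// mul1r.
by rewrite lerBrDl.
Qed.

(* The integrals of [|w|^(2p) * (1 - |w|^2)^(- tp)] and [(1 - |w|^2)^(- tp)] differ by a factor
   at least [1 - d], by Bernoulli's inequality and the recurrence of the beta integral. *)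
Lemma Lp_berezin_radial_power (p t : R) : 1 < p -> 0 < t -> t * p < 1 ->
  let d := p * (1 - t * p) / (m.+2%:R - t * p) in d <= 1 ->
  exists l, [/\ 0 <= l, Lp_norm R m.+1 p%:E (radial_power l t) = 1%E &
    ((gconst m t * (1 - d))%:E <= Lp_norm R m.+1 p%:E (berezin R m.+1 (radial_power l t)))%E].
Proof.
move=> p1 t0 tp d d1; have p0 : 0 < p by exact: lt_trans p1.
have pn : p != 0 by rewrite gt_eqF.
have t1 : t < 1 by apply: lt_trans tp; rewrite ltr_pMr.
pose b := - (t * p).
have b1 : -1 < b by rewrite ltrN2.
have b0 : b <= 0 by rewrite oppr_le0 mulr_ge0 ?(ltW p0) ?(ltW t0).
have m1 : -1 < m%:R :> R by exact: ltrN1_nat.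
have bb1 : -1 < b + 1 by lra.
have d0 : 0 <= d.
  have m2 : 1 <= m.+2%:R :> R by rewrite ler1n.
  by apply: divr_ge0; first apply: mulr_ge0; lra.
pose N (a : R) := m.+1%:R * betaR m%:R a.
have N0 : 0 < N b.
  rewrite mulr_gt0// -lte_fin -betaRE//; apply: (@lt_le_trans _ _ (beta01 m%:R 0)).
    by rewrite beta01b0// lte_fin invr_gt0; lra.
  apply: le_I01; [exact: beta01_cont|exact: beta01_cont|move=> x x0 x1].
  rewrite beta01_integrand_ge0/= ler_wpM2l ?powR_ge0//.
  by apply: ger_powR => //; rewrite x1/=; lra.
have NE a : -1 < a -> I01 (fun r => (1 - r) `^ a * (m.+1%:R * r ^+ m)) = (N a)%:E.
  move=> a1; rewrite /N EFinM -betaRE// -beta01Z//; apply: eq_I01 => r r0 r1.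
  by rewrite powR_mulrn ?(ltW r0)//; ring.
have mp1 a : measurable_fun setT (fun r : R => (1 - r) `^ a).
  by apply: (measurableT_comp (@measurable_powR R a)); exact: measurable_funB.
have NI a : -1 < a -> (\int[dv]_w ((1 - tsqn w) `^ a)%:E = (N a)%:E)%E.
  move=> a1; rewrite -integral_dvT; last 2 first.
  - exact/measurable_EFinP.
  - by move=> w; rewrite lee_fin powR_ge0.
  rewrite (@integral_dv_radial _ _ (fun r => (1 - r) `^ a))//; first exact: NE.
  by move=> r; exact: powR_ge0.
pose l := (N b) `^ (- p^-1).
have l0 : 0 <= l by exact: powR_ge0.
have lp : l `^ p = (N b)^-1.
  by rewrite /l -powRrM mulNr mulVf// powRN powRr1// ltW.
have lN : l `^ p * N b = 1 by rewrite lp mulVf// gt_eqF.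
have fp w : tsqn w < 1 -> cutnorm (radial_power l t) w `^ p = l `^ p * (1 - tsqn w) `^ b.
  move=> w1; rewrite cutnorm_in// normc_radial_power//.
  by rewrite powRM ?powR_ge0// -powRrM mulNr.
have mf := measurable_radial_power l t.
have mBf := measurable_funS measurableT (@subsetT _ B) mf.
have mc f : measurable_fun B f -> measurable_fun setT (fun w => (cutnorm f w `^ p)%:E).
  move=> mf'; apply/measurable_EFinP; apply: (measurableT_comp (@measurable_powR R p)).
  exact: measurable_cutnorm.
exists l; split => //.
  rewrite Lp_normE// -integral_dvT; last 2 first.
  - exact: mc.
  - by move=> w; rewrite lee_fin powR_ge0.
  rewrite (_ : (\int[dv]_(w in B) _ = (l `^ p)%:E * \int[dv]_w ((1 - tsqn w) `^ b)%:E)%E).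
    by rewrite NI// -EFinM lN poweR_EFin powR1.
  rewrite -ge0_integralZl_EFin ?powR_ge0//; last 2 first.
  - by move=> w _; rewrite lee_fin powR_ge0.
  - exact/measurable_EFinP.
  rewrite -integral_dvT; last 2 first.
  - by apply: measurable_funeM; exact/measurable_EFinP.
  - by move=> w; rewrite -EFinM lee_fin mulr_ge0 ?powR_ge0.
  by apply: eq_integral => w /set_mem/unit_ballP w1; rewrite fp// EFinM.
pose g := gconst m t.
have g0 : 0 <= g by exact: gconst_ge0.
have Bge w : tsqn w < 1 ->
    l * (1 - tsqn w) `^ (- t) * (tsqn w * g) <= cutnorm (berezin R m.+1 (radial_power l t)) w.
  move=> w1; rewrite cutnorm_in// berezin_radial_power// normc_real.
  have k0 : 0 <= l * (1 - tsqn w) `^ (- t) by rewrite mulr_ge0 ?powR_ge0.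
  have Ile := @I01_gker_le R m t (tsqn w) (tsqn_ge0 w) w1 t1.
  have Ige := @I01_gker_ge R m t (tsqn w) (tsqn_ge0 w) w1 (ltW t0) t1.
  have I0 : (0 <= I01 (gker m t (tsqn w)))%E.
    by apply: le_trans Ige; rewrite lee_fin mulr_ge0// tsqn_ge0.
  have fin : I01 (gker m t (tsqn w)) \is a fin_num.
    rewrite ge0_fin_numE//; apply: (le_lt_trans (Ile _)); last exact: ltry.
    by rewrite addr_gt0// addr_gt0.
  rewrite fineM// ger0_norm; last by rewrite mulr_ge0// fine_ge0.
  by rewrite ler_wpM2l// -lee_fin fineK.
have mbf := measurable_funS measurableT (@subsetT _ B) (measurable_berezin mBf).
pose X := (\int[dv]_w (cutnorm (berezin R m.+1 (radial_power l t)) w `^ p)%:E)%E.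
have X0 : (0 <= X)%E by apply: integral_ge0 => w _; rewrite lee_fin powR_ge0.
have XB : ((g `^ p * (1 - d))%:E <= X)%E.
  (* The origin of [d]: Bernoulli gives |w|^(2p) >= 1 - p (1 - |w|^2), and the subtracted term
     integrates to p N(b + 1), where N(b + 1) / N(b) = (1 - t p) / (m + 2 - t p). *)
  have Nd : N (b + 1) * p = N b * d.
    have := betaR_recr m1 b1; rewrite /N /d => h.
    have mb : m%:R + b + 2 != 0 :> R by rewrite gt_eqF//; lra.
    have -> : m.+2%:R - t * p = m%:R + b + 2 by rewrite -[m.+2]addn2 natrD /b; ring.
    have -> : betaR m%:R (b + 1) = (b + 1) * betaR m%:R b / (m%:R + b + 2) by rewrite h mulrC mulKf.
    by rewrite /b; field; move: mb; rewrite /b.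
  (* The loss stands on the right, so that all integrands are nonnegative and [X] may be
     infinite. *)
  have key : ((g `^ p)%:E <= X + (g `^ p * d)%:E)%E.
    have -> : (X + (g `^ p * d)%:E = \int[dv]_w ((cutnorm (berezin R m.+1 (radial_power l t)) w `^ p)%:E +
        ((g `^ p * l `^ p * p)%:E * ((1 - tsqn w) `^ (b + 1))%:E)))%E.
      rewrite ge0_integralD//; last 4 first.
      - by move=> w _; rewrite lee_fin powR_ge0.
      - exact: mc.
      - by move=> w _; rewrite -EFinM lee_fin !mulr_ge0 ?powR_ge0 ?(ltW p0).
      - by apply: measurable_funeM; exact/measurable_EFinP.
      congr (_ + _)%E; rewrite ge0_integralZl_EFin//; last 3 first.
      - by move=> w _; rewrite lee_fin powR_ge0.
      - exact/measurable_EFinP.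
      - by rewrite !mulr_ge0 ?powR_ge0 ?(ltW p0).
      rewrite NI// -EFinM -!mulrA [p * _]mulrC Nd [l `^ p * _]mulrA lN mul1r//.
    have -> : (g `^ p)%:E = ((g `^ p * l `^ p)%:E * \int[dv]_w ((1 - tsqn w) `^ b)%:E)%E.
      by rewrite NI// -EFinM -mulrA lN mulr1.
    rewrite -ge0_integralZl_EFin ?mulr_ge0 ?powR_ge0//; last 2 first.
    - by move=> w _; rewrite lee_fin powR_ge0.
    - exact/measurable_EFinP.
    rewrite -[leLHS]integral_dvT; last 2 first.
    - by apply: measurable_funeM; exact/measurable_EFinP.
    - by move=> w; rewrite -EFinM lee_fin !mulr_ge0 ?powR_ge0.
    have m3 : measurable_fun setT (fun w => (cutnorm (berezin R m.+1 (radial_power l t)) w `^ p)%:E +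
        ((g `^ p * l `^ p * p)%:E * ((1 - tsqn w) `^ (b + 1))%:E))%E.
      by apply: emeasurable_funD; [exact: mc|apply: measurable_funeM; exact/measurable_EFinP].
    rewrite -[leRHS]integral_dvT//; last first.
      by move=> w; rewrite -EFinM -EFinD lee_fin addr_ge0 ?powR_ge0// !mulr_ge0 ?powR_ge0 ?(ltW p0).
    apply: ge0_le_integral.
    - exact: measurable_unit_ball.
    - by move=> w _; rewrite -EFinM lee_fin !mulr_ge0 ?powR_ge0.
    - apply: measurable_funeM; apply/measurable_EFinP; exact: measurable_funS (mrad b).
    - exact: measurable_funS m3.
    move=> w /unit_ballP w1; rewrite -!EFinM -EFinD lee_fin.
    have x0 : 0 < 1 - tsqn w by rewrite subr_gt0.
    (* Bernoulli asks for a positive base; at the origin the claim follows from 1 <= p. *)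
    have [y0|y0] := leP (tsqn w) 0.
      have -> : tsqn w = 0 by apply/eqP; rewrite eq_le y0 tsqn_ge0.
      rewrite subr0 !powR1 !mulr1; apply: ler_wpDl; first exact: powR_ge0.
      by rewrite ler_peMr ?mulr_ge0 ?powR_ge0// ltW.
    have hs : 0 <= tsqn w * g by exact: mulr_ge0 (ltW y0) g0.
    have hl : 0 <= l * (1 - tsqn w) `^ (- t) by exact: mulr_ge0 l0 (powR_ge0 _ _).
    have h1 : (l * (1 - tsqn w) `^ (- t) * (tsqn w * g)) `^ p <=
        cutnorm (berezin R m.+1 (radial_power l t)) w `^ p.
      by apply: (ge0_ler_powR (ltW p0)); rewrite ?nnegrE ?cutnorm_ge0 ?Bge// mulr_ge0.
    apply: le_trans (lerD h1 (lexx _)).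
    rewrite (powRM _ hl hs) (powRM _ l0 (powR_ge0 _ _)) (powRM _ (ltW y0) g0).
    rewrite -powRrM mulNr -/b powRD1//.
    have := powR_ge_Bernoulli y0 p1.
    have : 0 <= l `^ p * (1 - tsqn w) `^ b * g `^ p by rewrite !mulr_ge0 ?powR_ge0.
    move: (tsqn w) (l `^ p) ((1 - tsqn w) `^ b) (g `^ p) (tsqn w `^ p) => y L P G Y h0 h.
    rewrite -subr_ge0.
    have -> : L * P * (Y * G) + G * L * p * (P * (1 - y)) - G * L * P = L * P * G * (Y - (1 + p * (y - 1))) by ring.
    by rewrite mulr_ge0// subr_ge0.
  by rewrite mulrBr mulr1 EFinB leeBlDr.
rewrite Lp_normE// -/X.
have X1 := gt0_ler_poweR (ltW (_ : 0 < p^-1)).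
apply: (@le_trans _ _ ((g `^ p * (1 - d))%:E `^ p^-1)%E); last first.
  by apply: X1; rewrite ?invr_gt0// in_itv/= ?leey ?andbT// lee_fin mulr_ge0 ?powR_ge0// subr_ge0.
rewrite poweR_EFin lee_fin powRM ?powR_ge0 ?subr_ge0//.
rewrite -powRrM mulfV// powRr1// ler_wpM2l//.
have [->|dn] := eqVneq (1 - d) 0; first exact: powR_ge0.
have dp : 0 < 1 - d by rewrite lt_neqAle eq_sym dn subr_ge0.
rewrite -[leLHS]powRr1 ?(ltW dp)//.
by apply: ger_powR; [rewrite dp/= gerBl|rewrite invf_le1// ltW].
Qed.

End berezin_lower_bound.

(** * The limit of the lower bounds as t increases to 1/p *)

Lemma cvg_lower_defect {R : realType} (m : nat) (p : R) : 0 < p ->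
  p * (1 - t * p) / (m.+2%:R - t * p) @[t --> p^-1] --> (0 : R).
Proof.
move=> p0; have ps : p^-1 * p = 1 by rewrite mulVf// gt_eqF.
have cMr : t * p @[t --> p^-1] --> (1 : R).
  by rewrite -[X in _ --> X]ps; apply: cvgM; [exact: cvg_id|exact: cvg_cst].
have n0 : m.+2%:R - 1 != 0 :> R by rewrite -natr1 addrK pnatr_eq0.
have -> : 0 = p * (1 - 1) / (m.+2%:R - 1) by rewrite subrr mulr0 mul0r.
apply: cvgM; first by apply: cvgM; [exact: cvg_cst|apply: cvgB => //; exact: cvg_cst].
by apply: cvgV => //; apply: cvgB => //; exact: cvg_cst.
Qed.

(** Continuity in t is read off the closed form [gconstE], a finite product times a quotient of
    elementary functions, rather than off the integral that defines [gconst]. *)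
Lemma gconst_lower_bound_cvg {R : realType} (m : nat) (p : R) : 1 < p ->
  gconst m t * (1 - p * (1 - t * p) / (m.+2%:R - t * p)) @[t --> p^-1^'-] --> gconst m p^-1.
Proof.
move=> p1; have p0 : 0 < p by exact: lt_trans p1.
have pn : p != 0 by rewrite gt_eqF.
have s0 : 0 < p^-1 by rewrite invr_gt0.
have s1 : p^-1 < 1 by rewrite invf_lt1.
have s01 : 0 < p^-1 < 1 by rewrite s0.
pose H (t : R) := (\prod_(1 <= k < m.+2) (1 + t / k%:R)) * (pi * t / sin (pi * t)).
have sn : sin (pi * p^-1) != 0 :> R.
  by rewrite gt_eqF// sin_gt0_pi// mulr_gt0 ?pi_gt0//= gtr_pMr ?pi_gt0.
have cH : H t @[t --> p^-1] --> H p^-1.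
  have cid : t @[t --> p^-1] --> p^-1 by exact: cvg_id.
  have cM : pi * t @[t --> p^-1] --> pi * p^-1 by apply: cvgM => //; exact: cvg_cst.
  apply: cvgM.
  - elim: (index_iota 1 m.+2) => [|k r IH].
      by rewrite big_nil; under eq_fun do rewrite big_nil; exact: cvg_cst.
    rewrite big_cons; under eq_fun do rewrite big_cons.
    apply: cvgM => //; apply: cvgD; first exact: cvg_cst.
    by apply: cvgM => //; exact: cvg_cst.
  - apply: cvgM => //; apply: cvgV => //.
    apply: (cvg_comp (fun t => pi * t) sin cM); exact: continuous_sin.
have cHd : H t * (1 - p * (1 - t * p) / (m.+2%:R - t * p)) @[t --> p^-1] --> gconst m p^-1.
  have -> : gconst m p^-1 = H p^-1 * (1 - 0) by rewrite subr0 mulr1 /H -gconstE.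
  by apply: cvgM => //; apply: cvgB; [exact: cvg_cst|exact: cvg_lower_defect].
apply: cvg_trans (cvg_at_left_filter cHd); apply: near_eq_cvg.
near=> t; rewrite /H gconstE//; apply/andP; split; first by near: t; exact: nbhs_left_gt.
apply: lt_trans s1; near: t; exact: nbhs_left_lt.
Unshelve. all: by end_near. Qed.

(** * The operator norms *)

Section operator_norms.
Context (R : realType) (m : nat).
Local Notation B := (@unit_ball R m.+1).

Lemma Lp_berezin (p : R) f : 1 < p -> Lp R m.+1 p%:E f -> Lp R m.+1 p%:E (berezin R m.+1 f).
Proof.
move=> p1 [mf foo]; split; first exact: measurable_funS (measurable_berezin mf).
apply: (le_lt_trans (Lp_norm_berezin_le p1 mf)); apply: lte_mul_pinfty => //.
by rewrite lee_fin gconst_ge0.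
Qed.

Lemma Linfty_berezin f : Lp R m.+1 +oo f -> Lp R m.+1 +oo (berezin R m.+1 f).
Proof.
move=> [mf foo]; split; first exact: measurable_funS (measurable_berezin mf).
exact: le_lt_trans (Linfty_norm_berezin_le mf foo) foo.
Qed.

Lemma operator_norm_berezin (p : R) : 1 < p ->
  operator_norm (Lp R m.+1 p%:E) (Lp_norm R m.+1 p%:E) (Lp_norm R m.+1 p%:E) (berezin R m.+1) =
  (gconst m p^-1)%:E.
Proof.
move=> p1; have p0 : 0 < p by exact: lt_trans p1.
have c0 := @gconst_ge0 R m p^-1.
apply/eqP; rewrite eq_le; apply/andP; split.
  apply: ub_ereal_sup => _ [f [[mf _] f1] <-].
  apply: (le_trans (Lp_norm_berezin_le p1 mf)).
  by rewrite -[leRHS]mule1; apply: lee_wpmul2l.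
set S := operator_norm _ _ _ _.
have S0 (t : R) : 0 < t -> t * p < 1 -> p * (1 - t * p) / (m.+2%:R - t * p) <= 1 ->
    ((gconst m t * (1 - p * (1 - t * p) / (m.+2%:R - t * p)))%:E <= S)%E.
  move=> t0 tp d1; have [l [l0 l1 lB]] := Lp_berezin_radial_power p1 t0 tp d1.
  apply: (le_trans lB); apply: ereal_sup_ubound.
  exists (radial_power l t) => //; split; last by rewrite l1.
  split; last by rewrite l1 ltry.
  exact: measurable_funS (measurable_radial_power l t).
apply/lee_addgt0Pr => e e0.
have s0 : 0 < p^-1 by rewrite invr_gt0.
have h1 := @gconst_lower_bound_cvg R m p p1.
have hd := cvg_at_left_filter (cvg_lower_defect m p0).
have : \forall t \near p^-1^'-, [/\ 0 < t, t * p < 1,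
    p * (1 - t * p) / (m.+2%:R - t * p) <= 1 &
    gconst m p^-1 <= gconst m t * (1 - p * (1 - t * p) / (m.+2%:R - t * p)) + e].
  near=> t; split.
  - by near: t; exact: nbhs_left_gt.
  - by rewrite -ltr_pdivlMr// mul1r; near: t; exact: nbhs_left_lt.
  - apply: le_trans (ler_norm _) _; rewrite -normrN -sub0r; near: t.
    by move/cvgrPdist_le : hd => /(_ 1 ltr01).
  - rewrite -lerBlDl; apply: le_trans (ler_norm _) _; near: t.
    by move/cvgrPdist_le : h1 => /(_ e e0).
move=> /filter_ex[t [t0 tp d1 le]].
apply: (@le_trans _ _ ((gconst m t * (1 - p * (1 - t * p) / (m.+2%:R - t * p)))%:E + e%:E)%E).
  by rewrite -EFinD lee_fin.
by apply: leeD => //; exact: S0.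
Unshelve. all: by end_near. Qed.

Lemma operator_norm_Linfty_berezin :
  operator_norm (Lp R m.+1 +oo) (Lp_norm R m.+1 +oo) (Lp_norm R m.+1 +oo) (berezin R m.+1) = 1%E.
Proof.
have [le1 ge1] := Linfty_berezin_cst1 R m.
apply/eqP; rewrite eq_le; apply/andP; split.
  apply: ub_ereal_sup => _ [f [[mf foo] f1] <-].
  exact: le_trans (Linfty_norm_berezin_le mf foo) f1.
apply: (le_trans ge1); apply: ereal_sup_ubound.
exists (radial_power 1 0) => //; split => //; split.
  exact: measurable_funS (measurable_radial_power 1 0).
by apply: le_lt_trans le1 _; rewrite ltry.
Qed.

End operator_norms.

Theorem corollary2p6 (R : realType) (n : nat) (n_gt0 : (0 < n)%N) :
  (forall p : R, 1 < p ->
    (forall f, Lp R n p%:E f -> Lp R n p%:E (berezin R n f)) /\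
    operator_norm (Lp R n p%:E) (Lp_norm R n p%:E) (Lp_norm R n p%:E) (berezin R n) =
      ((\prod_(1 <= k < n.+1) (1 + 1 / (k%:R * p)))
        * ((pi / p) / sin (pi / p)))%:E) /\
  ((forall f, Lp R n +oo%E f -> Lp R n +oo%E (berezin R n f)) /\
    operator_norm (Lp R n +oo%E) (Lp_norm R n +oo%E) (Lp_norm R n +oo%E) (berezin R n) =
      1%E).
Proof.
case: n n_gt0 => // m _; split=> [p p1|]; last first.
  by split; [exact: Linfty_berezin|exact: operator_norm_Linfty_berezin].
split; first by move=> f; exact: Lp_berezin.
have p0 : 0 < p by exact: lt_trans p1.
rewrite operator_norm_berezin// gconstE ?invr_gt0 ?p0 ?invf_lt1//.
congr ((_ * _)%:E); apply: eq_bigr => k _.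
by rewrite div1r invfM mulrC.
Qed.
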